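(* Let $(M,g,\nabla)$ be a compact statistical manifold with $\dim M>2$. For each real number $L$ and each sufficiently small radius $r>0$ (i.e. for every $L$ there is $r_0>0$ such that this holds for all $r\in(0,r_0)$), the sphere bundle $S^rM$ has scalar curvature greater than $L$ (everywhere on $S^rM$).
   Context: All objects are smooth. A statistical manifold $(M,g,\nabla)$ is a manifold $M$ with a (positive definite) Riemannian metric $g$ and a torsion-free affine connection $\nabla$ such that $(\nabla_Xg)(Y,Z)=(\nabla_Yg)(X,Z)$ for all $X,Y,Z$. Let $\pi:TM\to M$ be the tangent bundle. For $\xi,X\in T_pM$: the vertical lift $X^v_\xi\in T_\xi TM$ is the velocity at $t=0$ of the curve $t\mapsto \xi+tX$; the horizontal lift $X^h_\xi\in T_\xi TM$ is the velocity at $t=0$ of the curve $t\mapsto\xi_t$ obtained by $\nabla$-parallel transport of $\xi$ along the $\nabla$-geodesic with initial velocity $X$. One has $T_\xi TM=\{X^v_\xi\}\oplus\{X^h_\xi\}$, both lifts being linear and injective in $X$. $TM$ is equipped with the Sasakian metric $\tilde g$ determined by $g$ and $\nabla$: the Riemannian metric with $\tilde g(X^v,Y^v)=g(X,Y)=\tilde g(X^h,Y^h)$ and $\tilde g(X^v,Y^h)=0$. For $r>0$, $S^rM=\{\xi\in TM:\ g(\xi,\xi)=r^2\}$, equipped with the Riemannian metric induced from $\tilde g$; the scalar curvature in the claim is that of this induced metric. *)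

(* Defs.v *)
From HB Require Import structures.
From mathcomp Require Import all_boot all_order all_algebra.
From mathcomp Require Import all_classical all_reals all_analysis.

Set Implicit Arguments.
Unset Strict Implicit.
Unset Printing Implicit Defensive.

Import Order.TTheory GRing.Theory Num.Theory.
Import numFieldNormedType.Exports.

Local Open Scope classical_set_scope.
Local Open Scope ring_scope.

(** * Smooth maps between normed spaces *)

(** [f] is C^k on the open set [U]; all uses are on finite-dimensional [V]. *)
Fixpoint Ck_on (R : realType) (V W : normedModType R) (k : nat)
    (U : set V) (f : V -> W) : Prop :=
  if k is k'.+1 then
    (forall x, U x -> differentiable f x) /\
    (forall v : V, Ck_on k' U (fun x => 'D_v f x))
  else forall x, U x -> {for x, continuous f}.

Definition smooth_on (R : realType) (V W : normedModType R)
    (U : set V) (f : V -> W) : Prop := forall k, Ck_on k U f.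

(** * Charts, manifolds, tangent vectors *)

(** [cinv] is only meaningful on the image [cimg c] of the chart. *)
Record chart (R : realType) (n : nat) (T : Type) := Chart {
  cdom : set T;
  cmap : T -> 'rV[R]_n;
  cinv : 'rV[R]_n -> T }.

Definition cimg (R : realType) (n : nat) (T : Type) (c : chart R n T)
    : set 'rV[R]_n := cmap c @` cdom c.

(** A set of charts, with a preferred chart around every point. A tangent
    vector at [p] is represented by its components in the chart [chart_at A p],
    so that every T_pT is the vector space 'rV[R]_n. *)
Record atlas (R : realType) (n : nat) (T : Type) := Atlas {
  charts : set (chart R n T);
  chart_at : T -> chart R n T }.

Record manifold (R : realType) (n : nat) := Manifold {
  mcarrier :> topologicalType;
  matlas : atlas R n mcarrier;
  mhausdorff : hausdorff_space mcarrier;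
  msecond_countable : @second_countable mcarrier;
  mchart_at : forall p, charts matlas (chart_at matlas p) /\
        cdom (chart_at matlas p) p;
  mchart : forall c, charts matlas c ->
        [/\ open (cdom c), open (cimg c),
            (forall p, cdom c p -> cinv c (cmap c p) = p),
            (forall p, cdom c p -> {for p, continuous (cmap c)}) &
            (forall x, cimg c x -> {for x, continuous (cinv c)})];
  mcompat : forall c d, charts matlas c -> charts matlas d ->
        smooth_on (cmap c @` (cdom c `&` cdom d)) (cmap d \o cinv c) }.

Section Calculus.
Variables (R : realType) (n : nat) (T : Type) (A : atlas R n T).

(** Change of components at [q] from the chart [c] to the chart [d]. *)
Definition tchange (c d : chart R n T) (q : T) (v : 'rV[R]_n) : 'rV[R]_n :=
  'D_v (cmap d \o cinv c) (cmap c q).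

(** The coordinate vector field d/dx^i of the chart [c], meaningful on
    [cdom c]. *)
Definition coord_field (c : chart R n T) (i : 'I_n) (q : T) : 'rV[R]_n :=
  tchange c (chart_at A q) q (delta_mx 0 i).

(** Components in the chart [c], as functions of the coordinates, of the vector
    field [Y]. *)
Definition field_in (c : chart R n T) (Y : T -> 'rV[R]_n) (x : 'rV[R]_n)
    : 'rV[R]_n :=
  tchange (chart_at A (cinv c x)) c (cinv c x) (Y (cinv c x)).

(** "Smooth at [p]" always means: on some neighbourhood of [p]. *)
Definition smooth_fun_at (p : T) (f : T -> R) : Prop :=
  let c := chart_at A p in
  exists W : set 'rV[R]_n, [/\ open W, W (cmap c p), W `<=` cimg c &
    smooth_on W (f \o cinv c : 'rV[R]_n -> R^o)].

Definition smooth_field_at (p : T) (Y : T -> 'rV[R]_n) : Prop :=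
  let c := chart_at A p in
  exists W : set 'rV[R]_n, [/\ open W, W (cmap c p), W `<=` cimg c &
    smooth_on W (field_in c Y)].

(** The derivative X(f) for X a tangent vector at [p]. *)
Definition dir_deriv (p : T) (X : 'rV[R]_n) (f : T -> R) : R :=
  'D_X (f \o cinv (chart_at A p) : 'rV[R]_n -> R^o) (cmap (chart_at A p) p).

Definition lie_bracket (X Y : T -> 'rV[R]_n) (p : T) : 'rV[R]_n :=
  let c := chart_at A p in
  'D_(X p) (field_in c Y) (cmap c p) - 'D_(Y p) (field_in c X) (cmap c p).

(** Maps from a normed space (an interval of R for curves, an open set of R^m
    for parametrizations) to [T], and their differentials. *)
Definition smooth_map_at (V : normedModType R) (psi : V -> T) (x : V) : Prop :=
  let c := chart_at A (psi x) in
  exists W : set V, [/\ open W, W x, psi @` W `<=` cdom c &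
    smooth_on W (cmap c \o psi)].

Definition tangent_map (V : normedModType R) (psi : V -> T) (x v : V)
    : 'rV[R]_n := 'D_v (cmap (chart_at A (psi x)) \o psi) x.

Definition velocity (gam : R -> T) (t : R) : 'rV[R]_n :=
  tangent_map (gam : R^o -> T) t 1.

(** * Riemannian metrics and affine connections *)

Record is_riemannian (g : T -> 'rV[R]_n -> 'rV[R]_n -> R) : Prop := {
  metric_linear : forall p a X Y Z, g p (a *: X + Y) Z = a * g p X Z + g p Y Z;
  metric_sym : forall p X Y, g p X Y = g p Y X;
  metric_pos : forall p X, X != 0 -> 0 < g p X X;
  metric_smooth : forall c, charts A c -> forall i j,
    smooth_on (cimg c) ((fun q => g q (coord_field c i q) (coord_field c j q))
                          \o cinv c : 'rV[R]_n -> R^o) }.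

(** [nabla p X Y] is (nabla_X Y)(p), for X in T_pT and Y a vector field defined
    and smooth near [p] (the values elsewhere are irrelevant: apply the Leibniz
    rule to the indicator function of a neighbourhood of [p]). *)
Record is_affine_connection
    (nabla : T -> 'rV[R]_n -> (T -> 'rV[R]_n) -> 'rV[R]_n) : Prop := {
  conn_linear : forall p a X X' Y, smooth_field_at p Y ->
    nabla p (a *: X + X') Y = a *: nabla p X Y + nabla p X' Y;
  conn_add : forall p X Y Y', smooth_field_at p Y -> smooth_field_at p Y' ->
    nabla p X (fun q => Y q + Y' q) = nabla p X Y + nabla p X Y';
  conn_leibniz : forall p X f Y, smooth_fun_at p f -> smooth_field_at p Y ->
    nabla p X (fun q => f q *: Y q) =
      dir_deriv p X f *: Y p + f p *: nabla p X Y;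
  conn_smooth : forall p X Y, smooth_field_at p X -> smooth_field_at p Y ->
    smooth_field_at p (fun q => nabla q (X q) Y) }.

Definition torsion_free
    (nabla : T -> 'rV[R]_n -> (T -> 'rV[R]_n) -> 'rV[R]_n) : Prop :=
  forall p X Y, smooth_field_at p X -> smooth_field_at p Y ->
    nabla p (X p) Y - nabla p (Y p) X = lie_bracket X Y p.

(** ((nabla_X g)(Y, Z))(p) *)
Definition nabla_metric
    (nabla : T -> 'rV[R]_n -> (T -> 'rV[R]_n) -> 'rV[R]_n)
    (g : T -> 'rV[R]_n -> 'rV[R]_n -> R) (X Y Z : T -> 'rV[R]_n) (p : T) : R :=
  dir_deriv p (X p) (fun q => g q (Y q) (Z q))
  - g p (nabla p (X p) Y) (Z p) - g p (Y p) (nabla p (X p) Z).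

Record is_statistical (g : T -> 'rV[R]_n -> 'rV[R]_n -> R)
    (nabla : T -> 'rV[R]_n -> (T -> 'rV[R]_n) -> 'rV[R]_n) : Prop := {
  stat_riemannian : is_riemannian g;
  stat_connection : is_affine_connection nabla;
  stat_torsion_free : torsion_free nabla;
  stat_codazzi : forall p X Y Z,
    smooth_field_at p X -> smooth_field_at p Y -> smooth_field_at p Z ->
    nabla_metric nabla g X Y Z p = nabla_metric nabla g Y X Z p }.

(** Covariant derivative at time [t] of the vector field [V] along the curve
    [gam]: writing V = \sum_j V^j d/dx^j in the chart at gam(t), it is
    \sum_j (V^j)' d/dx^j + \sum_j V^j nabla_{gam'} d/dx^j. *)
Definition cov_along (nabla : T -> 'rV[R]_n -> (T -> 'rV[R]_n) -> 'rV[R]_n)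
    (gam : R -> T) (V : R -> 'rV[R]_n) (t : R) : 'rV[R]_n :=
  let c := chart_at A (gam t) in
  'D_1 (fun s : R^o => tchange (chart_at A (gam s)) c (gam s) (V s)) t
  + \sum_j V t 0 j *: nabla (gam t) (velocity gam t) (coord_field c j).

(** * Scalar curvature of submanifolds *)

Definition local_parametrization (m : nat) (S : set T) (U : set 'rV[R]_m)
    (psi : 'rV[R]_m -> T) : Prop :=
  open U /\ forall x, U x ->
    [/\ S (psi x), smooth_map_at psi x &
        forall v, tangent_map psi x v = 0 -> v = 0].

Definition pullback_metric (m : nat) (g : T -> 'rV[R]_n -> 'rV[R]_n -> R)
    (psi : 'rV[R]_m -> T) (x : 'rV[R]_m) : 'M[R]_m :=
  \matrix_(i, j) g (psi x) (tangent_map psi x (delta_mx 0 i))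
                           (tangent_map psi x (delta_mx 0 j)).

End Calculus.

Section CoordinateCurvature.
Variables (R : realType) (m : nat) (h : 'rV[R]_m -> 'M[R]_m).

Definition pd (i : 'I_m) (f : 'rV[R]_m -> R) (x : 'rV[R]_m) : R :=
  'D_(delta_mx 0 i) (f : 'rV[R]_m -> R^o) x.

(** Gamma^k_ij of the Levi-Civita connection of [h]. *)
Definition christoffel (k i j : 'I_m) (x : 'rV[R]_m) : R :=
  2^-1 * \sum_l invmx (h x) k l *
    (pd i (fun y => h y j l) x + pd j (fun y => h y i l) x
     - pd l (fun y => h y i j) x).

(** R(d_i, d_j) d_k = \sum_l (curvature l k i j) d_l, with
    R(X, Y) = [nabla_X, nabla_Y] - nabla_[X, Y]. *)
Definition curvature (l k i j : 'I_m) (x : 'rV[R]_m) : R :=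
  pd i (christoffel l j k) x - pd j (christoffel l i k) x
  + \sum_a (christoffel a j k x * christoffel l i a x
            - christoffel a i k x * christoffel l j a x).

Definition ricci (j k : 'I_m) (x : 'rV[R]_m) : R := \sum_i curvature i k i j x.

Definition coord_scalar_curvature (x : 'rV[R]_m) : R :=
  \sum_j \sum_k invmx (h x) j k * ricci j k x.

End CoordinateCurvature.

(** Scalar curvature at [p] of the [m]-dimensional submanifold [S], for the
    metric induced by [g]: it is computed in any local parametrization of [S]
    around [p], and does not depend on the choice of the latter. (Since
    dim S = m, an immersion of an open set of R^m into [S] is locally a
    diffeomorphism onto an open subset of [S].) *)
Definition induced_scalar_curvature (R : realType) (n : nat) (T : Type)
    (A : atlas R n T) (g : T -> 'rV[R]_n -> 'rV[R]_n -> R)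
    (m : nat) (S : set T) (p : T) : R :=
  xget 0 [set s | exists (U : set 'rV[R]_m) (psi : 'rV[R]_m -> T)
                         (u : 'rV[R]_m),
    [/\ local_parametrization A S U psi, U u, psi u = p &
        s = coord_scalar_curvature (pullback_metric A g psi) u]].

(** * The tangent bundle *)

(** A point of TM is a pair [(p, xi)] with xi in T_pM; the smooth structure is
    the one given by [tangent_atlas], not by the product type. *)
Definition tangent_bundle (R : realType) (n : nat) (M : manifold R n) : Type :=
  (M * 'rV[R]_n)%type.

Section TangentBundle.
Variables (R : realType) (n : nat) (M : manifold R n).
Local Notation A := (matlas M).
Local Notation TM := (tangent_bundle M).

(** The chart (x, y) of TM induced by the chart x of M: y is the vector of
    components in the chart x. *)
Definition tangent_chart (c : chart R n M) : chart R (n + n) TM :=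
  {| cdom := [set z : TM | cdom c z.1];
     cmap := fun z : TM =>
       row_mx (cmap c z.1) (tchange (chart_at A z.1) c z.1 z.2);
     cinv := fun w =>
       let p := cinv c (lsubmx w) in
       (p, tchange c (chart_at A p) p (rsubmx w)) |}.

Definition tangent_atlas : atlas R (n + n) TM :=
  {| charts := tangent_chart @` charts A;
     chart_at := fun z : TM => tangent_chart (chart_at A z.1) |}.

Definition vertical_lift (z : TM) (X : 'rV[R]_n) : 'rV[R]_(n + n) :=
  velocity tangent_atlas (fun t => (z.1, z.2 + t *: X) : TM) 0.

(** [w] is the velocity at 0 of a curve [zeta] in TM which starts at [z] and is
    a parallel vector field along a geodesic with initial velocity [X]. *)
Definition is_horizontal_lift
    (nabla : M -> 'rV[R]_n -> (M -> 'rV[R]_n) -> 'rV[R]_n)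
    (z : TM) (X : 'rV[R]_n) (w : 'rV[R]_(n + n)) : Prop :=
  exists (e : R) (zeta : R -> TM),
    let gam := fun t => (zeta t).1 in
    let xi := fun t => (zeta t).2 in
    [/\ 0 < e,
        forall t, `|t| < e ->
          [/\ smooth_map_at tangent_atlas (zeta : R^o -> TM) t,
              cov_along A nabla gam (velocity A gam) t = 0 &
              cov_along A nabla gam xi t = 0],
        zeta 0 = z,
        velocity A gam 0 = X &
        w = velocity tangent_atlas zeta 0].

(** [G] is the Sasakian metric on TM of [g] and [nabla]. [H z X] is the
    horizontal lift of [X] to T_z TM: by the local theory of ODEs it exists and
    is unique, so that [H] is not a choice. *)
Definition is_sasakian (g : M -> 'rV[R]_n -> 'rV[R]_n -> R)
    (nabla : M -> 'rV[R]_n -> (M -> 'rV[R]_n) -> 'rV[R]_n)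
    (G : TM -> 'rV[R]_(n + n) -> 'rV[R]_(n + n) -> R) : Prop :=
  is_riemannian tangent_atlas G /\
  exists2 H : TM -> 'rV[R]_n -> 'rV[R]_(n + n),
    (forall z X, is_horizontal_lift nabla z X (H z X)) &
    forall (z : TM) X Y,
      [/\ G z (vertical_lift z X) (vertical_lift z Y) = g z.1 X Y,
          G z (H z X) (H z Y) = g z.1 X Y &
          G z (vertical_lift z X) (H z Y) = 0].

Definition sphere_bundle (g : M -> 'rV[R]_n -> 'rV[R]_n -> R) (r : R) : set TM :=
  [set z : TM | g z.1 z.2 z.2 = r ^+ 2].

Definition sphere_scalar_curvature (g : M -> 'rV[R]_n -> 'rV[R]_n -> R)
    (G : TM -> 'rV[R]_(n + n) -> 'rV[R]_(n + n) -> R) (r : R) (z : TM) : R :=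
  @induced_scalar_curvature R (n + n) TM tangent_atlas G (n + n).-1
    (sphere_bundle g r) z.

End TangentBundle.

(* Main.v *)
Require Import Defs.
From mathcomp Require Import all_boot all_order all_algebra.
From mathcomp Require Import all_classical all_reals all_analysis.
From mathcomp Require Import ring lra.
Import Order.TTheory GRing.Theory Num.Theory.
Import numFieldNormedType.Exports.
Local Open Scope classical_set_scope.
Local Open Scope ring_scope.
Set Implicit Arguments.
Unset Strict Implicit.
Unset Printing Implicit Defensive.

(** Let [n] be the dimension of [M]. In a chart [(x, y)] of the tangent bundle
    that comes from a chart [x] of [M], the Sasakian metric is
    [g (dx, dx) + g (dy + Gamma (dx, y), dy + Gamma (dx, y))] with the
    Christoffel symbols [Gamma] of the connection ([sasaki_pullback]). Near a
    point of the sphere bundle of radius [r] over [x0], substitute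
    [x = x0 + r s] and [y = r eta], where [eta] is a unit vector described by
    [n - 1] coordinates [u]. Every term of the metric then has a factor
    [r ^ 2], and the quotient
    [g (ds, ds) + g (d eta + r Gamma (ds, eta), d eta + r Gamma (ds, eta))]
    ([blowup]) is smooth in [x0], [r], [u] and [s], also at [r = 0]. There it is
    the product of a flat metric and of the round metric of the unit sphere of
    dimension [n - 1], and its scalar curvature is [(n - 1) * (n - 2)]
    ([scal_blowup_limit]), which is at least 2.

    Scalar curvature is continuous in the parameters of a smooth family of
    metrics ([smooth_dir_scalar_curvature]), and dividing a metric by [r ^ 2]
    multiplies it by [r ^ 2]. Hence, close to a given point of [M] and a given
    direction, and for small [r], the scalar curvature of the sphere bundle
    exceeds [1 / r ^ 2] ([large_near_direction]). As [M] and the set of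
    directions are compact, one bound on [r] serves for all points.

    The scalar curvature is defined by the metric in an arbitrary local
    parametrization, so that two more facts are needed: it is invariant under
    changes of coordinates ([scalar_curvature_change]), and any parametrization
    of the sphere bundle factors smoothly through the coordinates [(u, s)]
    ([scalar_curvature_parametrization]). *)

(** * Smooth functions on open subsets of normed spaces *)

Section SmoothCalculus.
Context {R : realType}.
Implicit Types (V W : normedModType R).

Lemma Ck_on_subset V W k (U U' : set V) (f : V -> W) :
  U' `<=` U -> Ck_on k U f -> Ck_on k U' f.
Proof.
elim: k f => [|k IH] f UU' /=; first by move=> h x /UU'; exact: h.
by move=> [h1 h2]; split=> [x /UU'|v]; [exact: h1|exact: IH].
Qed.

Lemma Ck_on_pred V W k (U : set V) (f : V -> W) :
  Ck_on k.+1 U f -> Ck_on k U f.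
Proof.
elim: k f => [|k IH] f.
  by move=> [h _] x /h; exact: differentiable_continuous.
by move=> [h1 h2]; split=> // v; exact: (IH ('D_v f) (h2 v)).
Qed.

(** The difference of the two functions vanishes near [x], so that it is
    differentiable at [x] with differential 0. *)
Lemma near_eq_differentiable V W (f g : V -> W) (x : V) :
  (\forall y \near x, f y = g y) -> differentiable f x -> differentiable g x.
Proof.
move=> fg df.
have -> : g = f + (g - f) by apply/funext => y /=; rewrite [RHS]addrC subrK.
apply: (differentiableD df).
have h0 : (g - f) \o shift x = cst ((g - f) x) + (\0 : {linear V -> W}) +o_ 0 id.
  apply/eqaddoP => _/posnumP[e]; have := fg; rewrite (near_shift 0 x) /=.
  apply: filterS => y /=; rewrite subr0 => fgy.
  rewrite (_ : _ y = 0) ?normr0 ?mulr_ge0//.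
  have gfx : g x - f x = 0.
    by apply/eqP; rewrite subr_eq0 -(nbhs_singleton fg).
  by rewrite -[LHS]/((g (y + x) - f (y + x)) - ((g x - f x) + 0)) gfx fgy addr0 !subrr.
apply/diff_locallyP.
rewrite (@diff_unique _ _ _ (g - f) (\0 : {linear V -> W}) x) //.
  by split=> //; exact: cst_continuous.
exact: cst_continuous.
Qed.

Lemma nbhs_eq_on V W (U : set V) (f g : V -> W) (x : V) :
  open U -> U x -> (forall y, U y -> f y = g y) -> \forall y \near x, f y = g y.
Proof. by move=> oU Ux fg; apply: filterS fg _; exact: open_nbhs_nbhs. Qed.

Lemma eq_Ck_on V W k (U : set V) (f g : V -> W) : open U ->
  (forall x, U x -> f x = g x) -> Ck_on k U f -> Ck_on k U g.
Proof.
move=> oU; elim: k f g => [|k IH] f g fg /=.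
  move=> h x Ux; have hx : f @ x --> f x := h x Ux.
  have hg : g @ x --> f x.
    by apply: cvg_trans hx; apply: near_eq_cvg; exact: nbhs_eq_on fg.
  by rewrite (fg x Ux) in hg.
move=> [h1 h2]; split=> [x Ux|v].
  by apply: near_eq_differentiable (h1 x Ux); apply: nbhs_eq_on fg.
apply: IH (h2 v) => x Ux; apply: near_eq_derive.
exact: nbhs_eq_on fg.
Qed.

Lemma Ck_on_cst V W k (U : set V) (a : W) : Ck_on k U (cst a : V -> W).
Proof.
elim: k a => [|k IH] a /=; first by move=> x _; exact: cst_continuous.
split=> [x _|v]; first exact: differentiable_cst.
rewrite (_ : (fun x => _) = cst 0); first exact: IH.
by apply/funext => x; rewrite derive_cst.
Qed.

Lemma Ck_on_linear V W k (U : set V) (f : {linear V -> W}) :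
  continuous f -> Ck_on k U f.
Proof.
move=> cf; case: k => [|k] /=; first by move=> x _; exact: cf.
split=> [x _|v]; first exact: linear_differentiable.
rewrite (_ : (fun x => _) = cst (f v)); first exact: Ck_on_cst.
apply/funext => x; rewrite deriveE ?diff_lin //.
exact: linear_differentiable.
Qed.

Lemma Ck_onD V W k (U : set V) (f g : V -> W) : open U ->
  Ck_on k U f -> Ck_on k U g -> Ck_on k U (fun x => f x + g x).
Proof.
move=> oU; elim: k f g => [|k IH] f g /=.
  by move=> hf hg x Ux; apply: continuousD; [exact: hf|exact: hg].
move=> [f1 f2] [g1 g2]; split=> [x Ux|v].
  by apply: differentiableD; [exact: f1|exact: g1].
apply: eq_Ck_on (IH _ _ (f2 v) (g2 v)) => // x Ux.
by rewrite deriveD//; apply: diff_derivable; [exact: f1|exact: g1].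
Qed.

Lemma Ck_onM V k (U : set V) (f g : V -> R^o) : open U ->
  Ck_on k U f -> Ck_on k U g -> Ck_on k U (fun x => f x * g x : R^o).
Proof.
move=> oU; elim: k f g => [|k IH] f g.
  by move=> hf hg x Ux; apply: (@continuousM R V f g); [exact: hf|exact: hg].
move=> Hf Hg; have [f1 f2] := Hf; have [g1 g2] := Hg; split=> [x Ux|v].
  by apply: (@differentiableM R V f g); [exact: f1|exact: g1].
have H := Ck_onD oU (IH _ _ (Ck_on_pred Hf) (g2 v))
                    (IH _ _ (Ck_on_pred Hg) (f2 v)).
apply: eq_Ck_on H => // x Ux.
by rewrite (@deriveM R V f g)//; apply: diff_derivable; [exact: f1|exact: g1].
Qed.

(** The derivative of [1 / f] is a product of [1 / f] with itself and the
    derivative of [f], which gives one order of smoothness after the other. *)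
Lemma Ck_onV V k (U : set V) (f : V -> R^o) : open U ->
  (forall x, U x -> f x != 0) ->
  Ck_on k U f -> Ck_on k U (fun x => (f x)^-1 : R^o).
Proof.
move=> oU f0; elim: k => [|k IH].
  by move=> hf x Ux; apply: (@continuousV R V f); [exact: f0|exact: hf].
move=> Hf; have [f1 f2] := Hf; split=> [x Ux|v].
  by apply: (@differentiableV R V f); [exact: f1|exact: f0].
have Hi := IH (Ck_on_pred Hf).
have H := Ck_onM oU (@Ck_on_cst V R^o k U (-1)) (Ck_onM oU (Ck_onM oU Hi Hi) (f2 v)).
apply: eq_Ck_on H => // x Ux.
rewrite (@deriveV R V f)//; last by apply: diff_derivable; exact: f1.
  by rewrite /= mulN1r -invfM -expr2 scaleNr.
exact: f0.
Qed.

Lemma derive_sqrt_comp V (f : V -> R^o) (x v : V) :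
  differentiable f x -> 0 < f x ->
  differentiable (fun y => Num.sqrt (f y) : R^o) x /\
  'D_v (fun y => Num.sqrt (f y) : R^o) x = (2 * Num.sqrt (f x))^-1 * 'D_v f x.
Proof.
move=> df f0.
have ds := @is_derive1_sqrt R (f x) f0.
have dS : differentiable (Num.sqrt : R^o -> R^o) (f x).
  by apply/derivable1_diffP; exact: (@ex_derive _ _ _ _ _ _ _ ds).
have dc : differentiable ((Num.sqrt : R^o -> R^o) \o f) x.
  exact: differentiable_comp.
split=> //.
have := @deriveE R V R^o ((Num.sqrt : R^o -> R^o) \o f) x v dc.
rewrite /comp => ->; rewrite diff_comp//= deriveE//.
have E : 'd (Num.sqrt : R^o -> R^o) (f x) 1 = (2 * Num.sqrt (f x))^-1.
  by rewrite -deriveE // derive_val.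
by rewrite -[X in 'd (Num.sqrt : R^o -> R^o) (f x) X]mulr1 linearZ /= E [RHS]mulrC.
Qed.

Lemma Ck_on_sqrt V k (U : set V) (f : V -> R^o) : open U ->
  (forall x, U x -> 0 < f x) ->
  Ck_on k U f -> Ck_on k U (fun x => Num.sqrt (f x) : R^o).
Proof.
move=> oU f0; elim: k => [|k IH].
  move=> hf x Ux.
  by apply: (@continuous_comp _ _ _ f (@Num.sqrt R)); [exact: hf|exact: sqrt_continuous].
move=> Hf; have [f1 f2] := Hf; split=> [x Ux|v].
  by have [] := derive_sqrt_comp 0 (f1 x Ux) (f0 x Ux).
have Hi := IH (Ck_on_pred Hf).
have Hi2 : Ck_on k U (fun x => (2 * Num.sqrt (f x))^-1 : R^o).
  apply: Ck_onV => //; last exact: (Ck_onM oU (@Ck_on_cst V R^o k U 2) Hi).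
  by move=> x Ux; rewrite mulf_neq0 ?pnatr_eq0// gt_eqF// sqrtr_gt0 f0.
apply: eq_Ck_on (Ck_onM oU Hi2 (f2 v)) => // x Ux.
by have [_ ->] := derive_sqrt_comp v (f1 x Ux) (f0 x Ux).
Qed.

Lemma mx_sum_delta m n (M : 'M[R]_(m, n)) :
  M = \sum_(p : 'I_m * 'I_n) M p.1 p.2 *: delta_mx p.1 p.2.
Proof.
rewrite [LHS]matrix_sum_delta pair_big /=; by [].
Qed.

Lemma differentiable_bigsum V W (I : Type) (r : seq I) (F : I -> V -> W) (x : V) :
  (forall i, differentiable (F i) x) ->
  differentiable (fun y => \sum_(i <- r) F i y) x.
Proof.
move=> dF; elim: r => [|i r IH].
  by under eq_fun do rewrite big_nil; exact: differentiable_cst.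
by under eq_fun do rewrite big_cons; exact: differentiableD.
Qed.

Lemma differentiable_mx V m n (f : V -> 'M[R]_(m, n)) (x : V) :
  (forall i j, differentiable (fun y => f y i j : R^o) x) -> differentiable f x.
Proof.
move=> df.
have -> : f = fun y => \sum_(p : 'I_m * 'I_n) f y p.1 p.2 *: delta_mx p.1 p.2.
  by apply/funext => y; exact: mx_sum_delta.
apply: differentiable_bigsum => p.
exact: (@differentiableZl R V _ (fun y => f y p.1 p.2) (delta_mx p.1 p.2 : 'M[R]_(m, n))).
Qed.

Lemma derive_mxE V m n (f : V -> 'M[R]_(m, n)) (x v : V) i j :
  differentiable f x -> 'D_v f x i j = 'D_v (fun y => f y i j : R^o) x.
Proof. by move=> df; rewrite derive_mx ?mxE//; exact: diff_derivable. Qed.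

Lemma differentiable_mx_coord V m n (f : V -> 'M[R]_(m, n)) (x : V) i j :
  differentiable f x -> differentiable (fun y => f y i j : R^o) x.
Proof.
move=> df; apply: (@differentiable_comp R V _ R^o f (fun M : 'M[R]_(m, n) => M i j : R^o)) => //.
exact: differentiable_coord.
Qed.

(** This reduces the smoothness of vector- and matrix-valued maps to that of
    real functions. *)
Lemma Ck_on_mxP V m n k (U : set V) (f : V -> 'M[R]_(m, n)) : open U ->
  Ck_on k U f <-> forall i j, Ck_on k U (fun x => f x i j : R^o).
Proof.
move=> oU; elim: k f => [|k IH] f /=.
  split=> [hf i j x Ux|hf x Ux].
    by apply: (@continuous_comp _ _ _ f (fun M : 'M[R]_(m, n) => M i j));
      [exact: hf|exact: coord_continuous].
  move=> /= A [P hP sPA]; apply: filterS sPA _.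
  have H := @filter_forall _ _ (fun (ij : 'I_m * 'I_n) y => P ij.1 ij.2 (f y ij.1 ij.2))
    (nbhs x) (nbhs_filter x).
  apply: filterS (H _) => [y h i j|[i j]]; first exact: (h (i, j)).
  by apply: hf; [|exact: hP].
split=> [[h1 h2] i j|h].
  split=> [x Ux|v]; first by apply: differentiable_mx_coord; exact: h1.
  apply: eq_Ck_on ((IH _).1 (h2 v) i j) => // x Ux.
  by rewrite derive_mxE//; exact: h1.
have df x : U x -> differentiable f x.
  by move=> Ux; apply: differentiable_mx => i j; have [+ _] := h i j; apply.
split=> // v; apply/IH => i j.
have [_ /(_ v)] := h i j; apply: eq_Ck_on => // x Ux.
by rewrite derive_mxE//; exact: df.
Qed.

Lemma Ck_on_sum V W k (U : set V) (I : Type) (r : seq I) (F : I -> V -> W) : open U ->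
  (forall i, Ck_on k U (F i)) -> Ck_on k U (fun y => \sum_(i <- r) F i y).
Proof.
move=> oU dF; elim: r => [|i r IH].
  by under eq_fun do rewrite big_nil; exact: Ck_on_cst.
by under eq_fun do rewrite big_cons; exact: Ck_onD.
Qed.

Lemma derive_bigsum V W (I : Type) (r : seq I) (F : I -> V -> W) (x v : V) :
  (forall i, differentiable (F i) x) ->
  'D_v (fun y => \sum_(i <- r) F i y) x = \sum_(i <- r) 'D_v (F i) x.
Proof.
move=> dF; elim: r => [|i r IH].
  by under eq_fun do rewrite big_nil; rewrite big_nil derive_cst.
under eq_fun do rewrite big_cons.
rewrite deriveD ?IH ?big_cons//; apply: diff_derivable => //.
exact: differentiable_bigsum.
Qed.

Lemma derive_rV_delta n W (f : 'rV[R]_n -> W) (x v : 'rV[R]_n) :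
  differentiable f x -> 'D_v f x = \sum_i v 0 i *: 'D_(delta_mx 0 i) f x.
Proof.
move=> df; rewrite deriveE// {1}(row_sum_delta v) linear_sum.
by apply: eq_bigr => i _; rewrite linearZ/= deriveE.
Qed.

Lemma derive_compE V W n (f : 'rV[R]_n -> W) (g : V -> 'rV[R]_n) (x v : V) :
  differentiable g x -> differentiable f (g x) ->
  'D_v (f \o g) x = 'D_('D_v g x) f (g x).
Proof.
move=> dg df; rewrite deriveE; last exact: differentiable_comp.
by rewrite diff_comp//= -deriveE// -deriveE.
Qed.

(** The derivative of [f \o g] in the direction [v] is the sum of the products
    of the coordinates of ['D_v g] with the partial derivatives of [f] taken at
    [g]: only compositions with the same [g] occur, of one order less. *)
Lemma Ck_on_comp V n k (U : set V) (U' : set 'rV[R]_n)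
    (f : 'rV[R]_n -> R^o) (g : V -> 'rV[R]_n) : open U -> open U' ->
  (forall x, U x -> U' (g x)) -> Ck_on k U' f -> Ck_on k U g ->
  Ck_on k U (f \o g).
Proof.
move=> oU oU' gU; elim: k f => [|k IH] f.
  move=> hf hg x Ux; apply: continuous_comp; first exact: hg.
  by apply: hf; exact: gU.
move=> [f1 f2] Hg; have [g1 g2] := Hg; split=> [x Ux|v].
  by apply: differentiable_comp; [exact: g1|apply: f1; exact: gU].
have H : Ck_on k U (fun x => \sum_i 'D_v g x 0 i * 'D_(delta_mx 0 i) f (g x) : R^o).
  apply: Ck_on_sum => // i; apply: Ck_onM => //.
    exact: ((Ck_on_mxP _ _ oU).1 (g2 v) 0 i).
  exact: IH (f2 _) (Ck_on_pred Hg).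
apply: eq_Ck_on H => // x Ux.
rewrite derive_compE; [|exact: g1|by apply: f1; exact: gU].
by rewrite derive_rV_delta//; apply: f1; exact: gU.
Qed.

Section Clairaut.
Variable V : normedModType R.
Implicit Types (f : V -> R^o) (x u v : V).

Lemma is_derive_line f x u (t : R) : differentiable f (x + t *: u) ->
  is_derive (t : R^o) 1 (fun s : R^o => f (x + s *: u)) ('D_u f (x + t *: u)).
Proof.
move=> df.
have E : (fun h : R^o => h^-1 *: (((fun s : R^o => f (x + s *: u)) \o shift t) (h *: 1) -
    f (x + t *: u))) =
  (fun h : R => h^-1 *: ((f \o shift (x + t *: u)) (h *: u) - f (x + t *: u))).
  apply/funext => h /=; congr (_ *: (f _ - _)).
  by rewrite scalerDl /GRing.scale /= mulr1 addrCA addrA.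
apply: DeriveDef; last by rewrite /derive E.
by rewrite /derivable E; exact: diff_derivable.
Qed.

(** The mean value theorem, applied to the difference quotient in the direction
    [u] and then, at the intermediate point, in the direction [v]. *)
Lemma second_difference f x u v (s : R) (U : set V) : 0 < s ->
  (forall a b, 0 <= a <= s -> 0 <= b <= s -> U (x + a *: u + b *: v)) ->
  (forall y, U y -> differentiable f y) ->
  (forall y, U y -> differentiable ('D_u f) y) ->
  exists c d, [/\ 0 <= c <= s, 0 <= d <= s &
    f (x + s *: u + s *: v) - f (x + s *: u) - f (x + s *: v) + f x =
    s ^+ 2 * 'D_v ('D_u f) (x + c *: u + d *: v)].
Proof.
move=> s0 sU df ddf; have s_ge0 := ltW s0.
pose F (a : R^o) : R^o := f (x + s *: v + a *: u) - f (x + a *: u).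
pose dF (a : R^o) : R^o := 'D_u f (x + s *: v + a *: u) - 'D_u f (x + a *: u).
have U1 a : 0 <= a <= s -> U (x + s *: v + a *: u).
  by move=> ha; rewrite addrAC; apply: sU => //; rewrite s_ge0 lexx.
have U2 a : 0 <= a <= s -> U (x + a *: u).
  by move=> ha; rewrite -[X in U X]addr0 -(scale0r v); apply: sU => //; rewrite lexx.
have FdF a : 0 <= a <= s -> is_derive (a : R^o) 1 F (dF a).
  move=> ha; apply: is_deriveB; apply: is_derive_line; apply: df.
    exact: U1.
  exact: U2.
have [c cs Fc] : exists2 c, c \in `]0, s[ & F s - F 0 = dF c * (s - 0).
  apply: (@MVT R F dF 0 s s0).
    by move=> a /[!in_itv] /= /andP[a0 as_]; apply: FdF; rewrite !ltW.
  apply: derivable_within_continuous => a /[!in_itv] /= ha.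
  by have := FdF a ha => -[].
have {cs}cs : 0 <= c <= s by move: cs; rewrite in_itv /= => /andP[? ?]; rewrite !ltW.
pose H (b : R^o) : R^o := 'D_u f (x + c *: u + b *: v).
pose dH (b : R^o) : R^o := 'D_v ('D_u f) (x + c *: u + b *: v).
have HdH b : 0 <= b <= s -> is_derive (b : R^o) 1 H (dH b).
  by move=> hb; apply: is_derive_line; apply: ddf; exact: sU.
have [d ds Hd] : exists2 d, d \in `]0, s[ & H s - H 0 = dH d * (s - 0).
  apply: (@MVT R H dH 0 s s0).
    by move=> a /[!in_itv] /= /andP[a0 as_]; apply: HdH; rewrite !ltW.
  apply: derivable_within_continuous => a /[!in_itv] /= ha.
  by have := HdH a ha => -[].
exists c, d; split=> //.
  by move: ds; rewrite in_itv /= => /andP[? ?]; rewrite !ltW.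
move: Fc Hd; rewrite /F /dF /H /dH !subr0 !scale0r !addr0.
rewrite ![x + s *: v + _ *: u]addrAC => Fc Hd.
rewrite expr2 -mulrA [X in s * X]mulrC -Hd [RHS]mulrC -Fc.
by rewrite opprB; ring.
Qed.

(** The second difference quotient in the directions [u] and [v] is symmetric,
    and by [second_difference] it takes values of either mixed derivative at
    points which are arbitrarily close to [x]. *)
Lemma derive_comm f (U : set V) x u v : open U -> Ck_on 2 U f -> U x ->
  'D_u ('D_v f) x = 'D_v ('D_u f) x.
Proof.
have alg (s p q z k l X Y : R) : s != 0 -> p = q -> p - k - l + z = s ^+ 2 * X ->
    q - l - k + z = s ^+ 2 * Y -> X = Y.
  move=> s0 -> e1 e2'; apply: (@mulfI _ (s ^+ 2)); first by rewrite expf_neq0.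
  by rewrite -e1 -e2' (addrAC q).
have tri (e a b z w : R) : z = w -> `|a - w| <= e / 2 -> `|b - z| <= e / 2 -> `|a - b| <= e.
  move=> -> ha hb; apply: le_trans (ler_distD w _ _) _.
  by rewrite (splitr e) lerD// distrC.
move=> oU [f1 f2] Ux.
have Cuv w w' : {for x, continuous ('D_w ('D_w' f))}.
  by have [_ /(_ w) h] := f2 w'; exact: h.
apply/eqP; rewrite -subr_eq0 -normr_le0; apply/ler_addgt0Pr => e e0.
rewrite add0r.
have e2 : 0 < e / 2 by rewrite divr_gt0.
have N : \forall y \near x, [/\ U y, `|'D_u ('D_v f) x - 'D_u ('D_v f) y| <= e / 2
   & `|'D_v ('D_u f) x - 'D_v ('D_u f) y| <= e / 2].
  have N1 : \forall y \near x, U y by exact: open_nbhs_nbhs.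
  have N2 : \forall y \near x, `|'D_u ('D_v f) x - 'D_u ('D_v f) y| <= e / 2.
    exact: (cvgrPdist_le _ _).1 (Cuv u v) _ e2.
  have N3 : \forall y \near x, `|'D_v ('D_u f) x - 'D_v ('D_u f) y| <= e / 2.
    exact: (cvgrPdist_le _ _).1 (Cuv v u) _ e2.
  exact: filterS3 N1 N2 N3.
have /nbhs_ballP[r /= r0 rN] := N.
pose C := `|u| + `|v| + 1.
have C0 : 0 < C by rewrite /C; have := normr_ge0 u; have := normr_ge0 v; lra.
pose s := r / 2 / C.
have s0 : 0 < s by rewrite !divr_gt0.
have sB a b : 0 <= a <= s -> 0 <= b <= s -> ball x r (x + a *: u + b *: v).
  move=> /andP[a0 as_] /andP[b0 bs]; rewrite -ball_normE /ball_ /= -addrA opprD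
    addrA subrr add0r normrN.
  apply: (le_lt_trans (ler_normD _ _)); rewrite !normrZ !ger0_norm//.
  apply: (@le_lt_trans _ _ (s * C)).
    have := ler_wpM2r (normr_ge0 u) as_; have := ler_wpM2r (normr_ge0 v) bs.
    by rewrite /C !mulrDr mulr1; lra.
  by rewrite /s divfK ?gt_eqF//; lra.
have U1 y : ball x r y -> U y by move=> /rN [].
have D1 y : ball x r y -> differentiable f y by move=> /U1; exact: f1.
have D2 w y : ball x r y -> differentiable ('D_w f) y.
  by move=> /U1 Uy; have [h _] := f2 w; exact: h.
have [c [d [hc hd E1]]] := second_difference s0 sB D1 (D2 u).
have sB' a b : 0 <= a <= s -> 0 <= b <= s -> ball x r (x + a *: v + b *: u).
  by move=> ha hb; rewrite addrAC; exact: sB.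
have [c' [d' [hc' hd' E2]]] := second_difference s0 sB' D1 (D2 v).
have E := alg s _ _ _ _ _ _ _ (lt0r_neq0 s0) (congr1 f (addrAC x (s *: u) (s *: v))) E1 E2.
have [_ _ h1] := rN _ (sB _ _ hc hd).
have [_ h2 _] := rN _ (sB' _ _ hc' hd').
exact: tri E h2 h1.
Qed.

End Clairaut.

(** Both sides are the limit of the same difference quotient. *)
Lemma derive_along V V' W (F : V' -> W) (phi : V -> V') (w v : V) (v' : V') :
  (forall t : R, phi (t *: v + w) = t *: v' + phi w) ->
  'D_v (F \o phi) w = 'D_v' F (phi w).
Proof.
move=> E; rewrite /derive (_ : (fun h : R => _) =
  (fun h : R => h^-1 *: ((F \o shift (phi w)) (h *: v') - F (phi w)))) //.
by apply/funext => t /=; rewrite E.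
Qed.

Section Smooth.
Variable V : normedModType R.
Variable U : set V.
Hypothesis oU : open U.

Lemma smooth_derive W (f : V -> W) v : smooth_on U f -> smooth_on U ('D_v f).
Proof. by move=> sf k; have [_ h] := sf k.+1; exact: h. Qed.

Lemma smooth_differentiable W (f : V -> W) x : smooth_on U f -> U x -> differentiable f x.
Proof. by move=> sf Ux; have [h _] := sf 1%N; exact: h. Qed.

Lemma smooth_continuous W (f : V -> W) x : smooth_on U f -> U x -> {for x, continuous f}.
Proof. by move=> sf Ux; exact: (sf 0%N). Qed.

Lemma smooth_subset W (U' : set V) (f : V -> W) : U' `<=` U ->
  smooth_on U f -> smooth_on U' f.
Proof. by move=> UU' sf k; exact: Ck_on_subset (sf k). Qed.

Lemma eq_smooth W (f g : V -> W) : (forall x, U x -> f x = g x) ->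
  smooth_on U f -> smooth_on U g.
Proof. by move=> fg sf k; exact: eq_Ck_on fg (sf k). Qed.

Lemma smooth_cst W (a : W) : smooth_on U (cst a : V -> W).
Proof. by move=> k; exact: Ck_on_cst. Qed.

Lemma smoothD W (f g : V -> W) : smooth_on U f -> smooth_on U g ->
  smooth_on U (fun x => f x + g x).
Proof. by move=> sf sg k; exact: Ck_onD. Qed.

Lemma smooth_sum W (I : Type) (r : seq I) (F : I -> V -> W) :
  (forall i, smooth_on U (F i)) -> smooth_on U (fun y => \sum_(i <- r) F i y).
Proof. by move=> sF k; apply: Ck_on_sum => // i; exact: sF. Qed.

Lemma smoothM (f g : V -> R^o) : smooth_on U f -> smooth_on U g ->
  smooth_on U (fun x => f x * g x : R^o).
Proof. by move=> sf sg k; exact: Ck_onM. Qed.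

Lemma smooth_prod (I : Type) (r : seq I) (F : I -> V -> R^o) :
  (forall i, smooth_on U (F i)) -> smooth_on U (fun y => \prod_(i <- r) F i y : R^o).
Proof.
move=> sF; elim: r => [|i r IH].
  by under eq_fun do rewrite big_nil; exact: smooth_cst.
by under eq_fun do rewrite big_cons; exact: smoothM.
Qed.

Lemma smoothN (f : V -> R^o) : smooth_on U f -> smooth_on U (fun x => - f x : R^o).
Proof.
move=> sf; under eq_fun do rewrite -mulN1r.
by apply: (smoothM (smooth_cst (-1 : R^o))).
Qed.

Lemma smoothB (f g : V -> R^o) : smooth_on U f -> smooth_on U g ->
  smooth_on U (fun x => f x - g x : R^o).
Proof. by move=> sf sg; apply: (@smoothD R^o f (fun x => - g x)) => //; exact: smoothN. Qed.

Lemma smoothV (f : V -> R^o) : (forall x, U x -> f x != 0) -> smooth_on U f ->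
  smooth_on U (fun x => (f x)^-1 : R^o).
Proof. by move=> f0 sf k; exact: Ck_onV. Qed.

Lemma smooth_sqrt (f : V -> R^o) : (forall x, U x -> 0 < f x) -> smooth_on U f ->
  smooth_on U (fun x => Num.sqrt (f x) : R^o).
Proof. by move=> f0 sf k; exact: Ck_on_sqrt. Qed.

Lemma smooth_mxP m n (f : V -> 'M[R]_(m, n)) :
  smooth_on U f <-> forall i j, smooth_on U (fun x => f x i j : R^o).
Proof.
split=> [sf i j k|sf k]; first exact: ((Ck_on_mxP k f oU).1 (sf k)).
by apply/(Ck_on_mxP k f oU) => i j; exact: sf.
Qed.

Lemma smooth_coord m n (f : V -> 'M[R]_(m, n)) i j :
  smooth_on U f -> smooth_on U (fun x => f x i j : R^o).
Proof. by move=> /smooth_mxP; exact. Qed.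

Lemma smoothZ m n (f : V -> R^o) (g : V -> 'M[R]_(m, n)) :
  smooth_on U f -> smooth_on U g -> smooth_on U (fun x => f x *: g x).
Proof.
move=> sf sg; apply/smooth_mxP => i j; under eq_fun do rewrite mxE.
by apply: smoothM => //; exact: smooth_coord.
Qed.

Lemma smooth_mulmx m n p (f : V -> 'M[R]_(m, n)) (g : V -> 'M[R]_(n, p)) :
  smooth_on U f -> smooth_on U g -> smooth_on U (fun x => f x *m g x).
Proof.
move=> sf sg; apply/smooth_mxP => i j; under eq_fun do rewrite mxE.
by apply: smooth_sum => k; apply: smoothM; exact: smooth_coord.
Qed.

Lemma smooth_mxlinear m n p q (L : {linear 'M[R]_(m, n) -> 'M[R]_(p, q)})
    (f : V -> 'M[R]_(m, n)) : smooth_on U f -> smooth_on U (fun x => L (f x)).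
Proof.
move=> sf; have -> : (fun x => L (f x)) = fun x =>
    \sum_(ab : 'I_m * 'I_n) f x ab.1 ab.2 *: L (delta_mx ab.1 ab.2).
  by apply/funext => x; rewrite {1}(mx_sum_delta (f x)) linear_sum;
    under eq_bigr do rewrite linearZ.
apply: smooth_sum => ab; apply: smoothZ; first exact: smooth_coord.
exact: smooth_cst.
Qed.

Lemma smooth_row_mx m n1 n2 (f : V -> 'M[R]_(m, n1)) (g : V -> 'M[R]_(m, n2)) :
  smooth_on U f -> smooth_on U g -> smooth_on U (fun x => row_mx (f x) (g x)).
Proof.
move=> sf sg; apply/smooth_mxP => i j; under eq_fun do rewrite mxE.
by case: (fintype.split j) => k; exact: smooth_coord.
Qed.

Lemma smooth_det m (f : V -> 'M[R]_m) : smooth_on U f -> smooth_on U (fun x => \det (f x) : R^o).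
Proof.
move=> sf; rewrite /determinant; apply: smooth_sum => s.
apply: smoothM; first exact: smooth_cst.
by apply: smooth_prod => i; exact: smooth_coord.
Qed.

Lemma smooth_invmx m (f : V -> 'M[R]_m) : (forall x, U x -> f x \in unitmx) ->
  smooth_on U f -> smooth_on U (fun x => invmx (f x)).
Proof.
move=> fu sf.
have sadj : smooth_on U (fun x => \adj (f x)).
  apply/smooth_mxP => i j; under eq_fun do rewrite mxE /cofactor.
  apply: smoothM; first exact: smooth_cst.
  apply: smooth_det; apply/smooth_mxP => k l; under eq_fun do rewrite !mxE.
  exact: smooth_coord.
have : smooth_on U (fun x => (\det (f x))^-1 *: \adj (f x)).
  apply: smoothZ => //; apply: smoothV; last exact: smooth_det.
  by move=> x /fu; rewrite unitmxE unitfE.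
by apply: eq_smooth => x /fu xu; rewrite /invmx xu.
Qed.

Lemma smooth_comp m n p (U' : set 'rV[R]_n) (f : 'rV[R]_n -> 'M[R]_(m, p)) (g : V -> 'rV[R]_n) :
  open U' -> (forall x, U x -> U' (g x)) -> smooth_on U' f -> smooth_on U g ->
  smooth_on U (f \o g).
Proof.
move=> oU' UU' sf sg k; apply/(Ck_on_mxP _ _ oU) => i j.
apply: (@Ck_on_comp V n k U U' (fun y => f y i j) g) => //.
exact: ((Ck_on_mxP k f oU').1 (sf k)).
Qed.

End Smooth.

Lemma smooth_id_mx m n (U : set 'M[R]_(m, n)) : smooth_on U (id : 'M[R]_(m, n) -> 'M[R]_(m, n)).
Proof. by move=> k; apply: (@Ck_on_linear _ _ k U idfun) => x; exact: cvg_id. Qed.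

Lemma derive_mulmx V m n p (f : V -> 'M[R]_(m, n)) (g : V -> 'M[R]_(n, p)) (x v : V) :
  differentiable f x -> differentiable g x ->
  'D_v (fun y => f y *m g y) x = 'D_v f x *m g x + f x *m 'D_v g x.
Proof.
move=> df dg.
have dfij i j : differentiable (fun y => f y i j : R^o) x by exact: differentiable_mx_coord.
have dgij i j : differentiable (fun y => g y i j : R^o) x by exact: differentiable_mx_coord.
have dM i k j : differentiable (fun y => f y i k * g y k j : R^o) x.
  exact: (@differentiableM R V (fun y => f y i k) (fun y => g y k j)).
have dfg : differentiable (fun y => f y *m g y) x.
  apply: differentiable_mx => i j; under eq_fun do rewrite mxE.
  exact: differentiable_bigsum.
apply/matrixP => i j; rewrite derive_mxE//; under eq_fun do rewrite mxE.
rewrite derive_bigsum// !mxE -big_split /=; apply: eq_bigr => k _.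
rewrite (@deriveM R V (fun y => f y i k) (fun y => g y k j)); try exact: diff_derivable.
by rewrite !derive_mxE// [LHS]addrC; congr (_ + _); exact: mulrC.
Qed.

Lemma differentiable_scalemx V m n (a : V -> R^o) (F : V -> 'M[R]_(m, n)) (x : V) :
  differentiable a x -> differentiable F x -> differentiable (fun y => a y *: F y) x.
Proof.
move=> da dF; apply: differentiable_mx => i j; under eq_fun do rewrite mxE.
apply: (@differentiableM R V a (fun y => F y i j)) => //.
exact: differentiable_mx_coord.
Qed.

Lemma derive_scalemx V m n (a : V -> R^o) (F : V -> 'M[R]_(m, n)) (x v : V) :
  differentiable a x -> differentiable F x ->
  'D_v (fun y => a y *: F y) x = 'D_v a x *: F x + a x *: 'D_v F x.
Proof.
move=> da dF; apply/matrixP => i j.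
rewrite (derive_mxE _ _ _ (differentiable_scalemx da dF)).
under eq_fun do rewrite mxE.
rewrite (@deriveM R V a (fun y => F y i j)); last 2 first.
- exact: diff_derivable.
- by apply: diff_derivable; exact: differentiable_mx_coord.
rewrite [RHS]mxE [X in _ = X + _]mxE [X in _ = _ + X]mxE (derive_mxE _ _ _ dF).
by rewrite [LHS]addrC; congr (_ + _); exact: mulrC.
Qed.

Lemma derive_row_mx V m n1 n2 (F : V -> 'M[R]_(m, n1)) (G : V -> 'M[R]_(m, n2)) (x v : V) :
  differentiable F x -> differentiable G x ->
  'D_v (fun y => row_mx (F y) (G y)) x = row_mx ('D_v F x) ('D_v G x).
Proof.
move=> dF dG.
have dFG : differentiable (fun y => row_mx (F y) (G y)) x.
  apply: differentiable_mx => i j; under eq_fun do rewrite mxE.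
  by case: (fintype.split j) => k; exact: differentiable_mx_coord.
apply/matrixP => i j; rewrite (derive_mxE _ _ _ dFG).
under eq_fun do rewrite mxE.
by rewrite [RHS]mxE; case: (fintype.split j) => k; rewrite derive_mxE.
Qed.

Lemma derive_lsubmx V m n1 n2 (f : V -> 'M[R]_(m, n1 + n2)) (x v : V) :
  differentiable f x -> 'D_v (fun y => lsubmx (f y)) x = lsubmx ('D_v f x).
Proof.
move=> df; have dl : differentiable (fun y => lsubmx (f y)) x.
  exact: (differentiable_comp df (differentiable_lsubmx _)).
apply/matrixP => i j; rewrite (derive_mxE _ _ _ dl); under eq_fun do rewrite mxE.
by rewrite [RHS]mxE (derive_mxE _ _ _ df).
Qed.

Lemma derive_rsubmx V m n1 n2 (f : V -> 'M[R]_(m, n1 + n2)) (x v : V) :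
  differentiable f x -> 'D_v (fun y => rsubmx (f y)) x = rsubmx ('D_v f x).
Proof.
move=> df; have dl : differentiable (fun y => rsubmx (f y)) x.
  exact: (differentiable_comp df (differentiable_rsubmx _)).
apply/matrixP => i j; rewrite (derive_mxE _ _ _ dl); under eq_fun do rewrite mxE.
by rewrite [RHS]mxE (derive_mxE _ _ _ df).
Qed.

Lemma derive_affine V W (f : V -> W) (w v : V) (c : W) :
  (forall t : R, f (t *: v + w) = f w + t *: c) -> 'D_v f w = c.
Proof.
move=> E; rewrite /derive; apply: cvg_lim; first exact: norm_hausdorff.
apply: cvg_near_cst; near=> t.
have t0 : t != 0 by near: t; exact: nbhs_dnbhs_neq.
by rewrite /= E addrC addKr scalerA mulVf// scale1r.
Unshelve. all: by end_near. Qed.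

End SmoothCalculus.

Local Opaque derive.

(** * Scalar curvature of families of metrics *)

Section DirectionalCurvature.
Context {R : realType} {V : normedModType R} {m : nat}.
Variables (eps : 'I_m -> V) (h : V -> 'M[R]_m).

(** The formulas for the curvature in coordinates, with the partial derivatives
    replaced by derivatives along fixed vectors [eps i] of a larger space [V].
    When [V] is the product of a space of parameters and of the coordinate space,
    and [eps] the coordinate directions of the latter, they give the scalar
    curvature of a family of metrics jointly in parameters and coordinates. *)
Definition dir_pd (i : 'I_m) (f : V -> R) (x : V) : R := 'D_(eps i) (f : V -> R^o) x.

Definition dir_christoffel (k i j : 'I_m) (x : V) : R :=
  2^-1 * \sum_l invmx (h x) k l *
    (dir_pd i (fun y => h y j l) x + dir_pd j (fun y => h y i l) x
     - dir_pd l (fun y => h y i j) x).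

Definition dir_curvature (l k i j : 'I_m) (x : V) : R :=
  dir_pd i (dir_christoffel l j k) x - dir_pd j (dir_christoffel l i k) x
  + \sum_a (dir_christoffel a j k x * dir_christoffel l i a x
            - dir_christoffel a i k x * dir_christoffel l j a x).

Definition dir_scalar_curvature (x : V) : R :=
  \sum_j \sum_k invmx (h x) j k * \sum_i dir_curvature i k i j x.

Lemma smooth_dir_scalar_curvature (U : set V) : open U -> smooth_on U h ->
  (forall x, U x -> h x \in unitmx) ->
  smooth_on U (dir_scalar_curvature : V -> R^o).
Proof.
move=> oU sh hu; have si := smooth_invmx oU hu sh.
have sk (f : V -> R^o) i : smooth_on U f -> smooth_on U (dir_pd i f : V -> R^o).
  exact: smooth_derive.
have sC k i j : smooth_on U (dir_christoffel k i j : V -> R^o).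
  apply: smoothM => //; first exact: smooth_cst.
  apply: smooth_sum => // l; apply: smoothM => //; first exact: smooth_coord.
  apply: smoothB => //; last by apply: sk; exact: smooth_coord.
  by apply: (@smoothD R V U oU R^o) => //; apply: sk; exact: smooth_coord.
have sK l k i j : smooth_on U (dir_curvature l k i j : V -> R^o).
  apply: (@smoothD R V U oU R^o) => //; first by apply: smoothB => //; exact: sk.
  by apply: smooth_sum => // a; apply: smoothB => //; apply: smoothM.
apply: smooth_sum => // j; apply: smooth_sum => // k; apply: smoothM => //.
  exact: smooth_coord.
exact: smooth_sum.
Qed.

End DirectionalCurvature.

Section Pullback.
Context {R : realType}.

(** Here [phi] is the inclusion of the slice of [V] on which the parameters are
    frozen. *)
Lemma coord_scalar_curvature_along (V : normedModType R) m (h : V -> 'M[R]_m)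
    (phi : 'rV[R]_m -> V) (eps : 'I_m -> V) :
  (forall i t w, phi (t *: delta_mx 0 i + w) = t *: eps i + phi w) ->
  forall w, coord_scalar_curvature (fun z => h (phi z)) w = dir_scalar_curvature eps h (phi w).
Proof.
move=> E w.
have pdE i (F : V -> R^o) : pd i (fun z => F (phi z)) = (fun z => dir_pd eps i F (phi z)).
  by apply/funext => y; rewrite /pd /dir_pd (derive_along F (v' := eps i)).
have pdEw i (F : V -> R) y : pd i (fun z => F (phi z)) y = dir_pd eps i F (phi y).
  exact: (congr1 (@^~ y) (pdE i F)).
have CEw k i j y : christoffel (fun z => h (phi z)) k i j y = dir_christoffel eps h k i j (phi y).
  rewrite /christoffel /dir_christoffel.
  have E1 l : pd i (fun z => h (phi z) j l) y + pd j (fun z => h (phi z) i l) y -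
      pd l (fun z => h (phi z) i j) y = dir_pd eps i (fun z => h z j l) (phi y) +
      dir_pd eps j (fun z => h z i l) (phi y) - dir_pd eps l (fun z => h z i j) (phi y).
    by rewrite (pdEw i (fun z => h z j l)) (pdEw j (fun z => h z i l)) (pdEw l (fun z => h z i j)).
  by apply: (congr1 ( *%R _)); apply: eq_bigr => l _; exact: (congr1 ( *%R _) (E1 l)).
have CE k i j : christoffel (fun z => h (phi z)) k i j =
    (fun y => dir_christoffel eps h k i j (phi y)).
  by apply/funext => y; exact: CEw.
have KE l k i j : curvature (fun z => h (phi z)) l k i j w = dir_curvature eps h l k i j (phi w).
  rewrite /curvature /dir_curvature.
  rewrite (CE l j k) (CE l i k) (pdEw i (dir_christoffel eps h l j k)).
  rewrite (pdEw j (dir_christoffel eps h l i k)).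
  by apply: (congr1 ( +%R _)); apply: eq_bigr => a _; rewrite !CEw.
rewrite /coord_scalar_curvature /dir_scalar_curvature /ricci.
apply: eq_bigr => j _; apply: eq_bigr => l _; apply: (congr1 ( *%R _)).
by apply: eq_bigr => i _; exact: KE.
Qed.

End Pullback.

(** * Scalar curvature under a change of coordinates *)

Section Invariance.
Context {R : realType} {m : nat}.
Implicit Types (h k : 'rV[R]_m -> 'M[R]_m) (U : set 'rV[R]_m) (x : 'rV[R]_m).
Lemma eq_on_pd U i (f g : 'rV[R]_m -> R) x : open U -> U x ->
  (forall y, U y -> f y = g y) -> pd i f x = pd i g x.
Proof. by move=> oU Ux fg; apply: near_eq_derive; apply: nbhs_eq_on fg. Qed.

Lemma pdM i (f g : 'rV[R]_m -> R^o) x : differentiable f x -> differentiable g x ->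
  pd i (fun y => f y * g y) x = pd i f x * g x + f x * pd i g x.
Proof.
move=> df dg; rewrite /pd (@deriveM R _ f g); try exact: diff_derivable.
by rewrite [LHS]addrC; congr (_ + _); exact: mulrC.
Qed.

Lemma pd_comm U (f : 'rV[R]_m -> R^o) x i j : open U -> smooth_on U f -> U x ->
  pd i (pd j f) x = pd j (pd i f) x.
Proof. move=> oU sf Ux; exact: (derive_comm _ _ oU (sf 2%N) Ux). Qed.

Lemma pd_cst i (c : R) x : pd i (cst c) x = 0.
Proof. exact: derive_cst. Qed.

Lemma smooth_pd U i (f : 'rV[R]_m -> R^o) : smooth_on U f -> smooth_on U (pd i f : 'rV[R]_m -> R^o).
Proof. exact: smooth_derive. Qed.

Lemma pd_mx p n i (f : 'rV[R]_m -> 'M[R]_(p, n)) x a b : differentiable f x ->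
  'D_(delta_mx 0 i) f x a b = pd i (fun y => f y a b) x.
Proof. exact: derive_mxE. Qed.

(** The entries of this matrix are partial derivatives of real functions, so that
    the formulas for the curvature apply to them directly. *)
Definition pdm p n i (f : 'rV[R]_m -> 'M[R]_(p, n)) x : 'M[R]_(p, n) :=
  \matrix_(a, b) pd i (fun y => f y a b) x.

Lemma eq_pd i (f g : 'rV[R]_m -> R) x : f =1 g -> pd i f x = pd i g x.
Proof. by move=> /funext ->. Qed.

Lemma pdmxE p n i (f : 'rV[R]_m -> 'M[R]_(p, n)) x a b :
  pdm i f x a b = pd i (fun y => f y a b) x.
Proof. exact: mxE. Qed.

Opaque pdm pd.

Lemma pdmE p n i (f : 'rV[R]_m -> 'M[R]_(p, n)) x : differentiable f x ->
  'D_(delta_mx 0 i) f x = pdm i f x.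
Proof. by move=> df; apply/matrixP => a b; rewrite pd_mx// pdmxE. Qed.

Lemma eq_on_pdm U p n i (f g : 'rV[R]_m -> 'M[R]_(p, n)) x : open U -> U x ->
  (forall y, U y -> f y = g y) -> pdm i f x = pdm i g x.
Proof.
move=> oU Ux fg; apply/matrixP => a b; rewrite [LHS]pdmxE [RHS]pdmxE.
by apply: (eq_on_pd _ oU) => // y /fg ->.
Qed.

Lemma smooth_pdm U p n i (f : 'rV[R]_m -> 'M[R]_(p, n)) : open U ->
  smooth_on U f -> smooth_on U (pdm i f).
Proof.
move=> oU sf; apply: eq_smooth (smooth_derive (delta_mx 0 i) sf) => // x Ux.
by rewrite pdmE//; exact: smooth_differentiable sf Ux.
Qed.

Lemma pdmD p n i (f g : 'rV[R]_m -> 'M[R]_(p, n)) x :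
  differentiable f x -> differentiable g x ->
  pdm i (fun y => f y + g y) x = pdm i f x + pdm i g x.
Proof.
move=> df dg; rewrite -(pdmE _ df) -(pdmE _ dg) -pdmE; last exact: differentiableD.
by apply: deriveD; exact: diff_derivable.
Qed.

Lemma differentiable_mulmx p n q (f : 'rV[R]_m -> 'M[R]_(p, n))
    (g : 'rV[R]_m -> 'M[R]_(n, q)) x :
  differentiable f x -> differentiable g x -> differentiable (fun y => f y *m g y) x.
Proof.
move=> df dg; apply: differentiable_mx => i j.
under eq_fun do rewrite mxE.
apply: differentiable_bigsum => l.
by apply: (@differentiableM R _ (fun y => f y i l) (fun y => g y l j));
  exact: differentiable_mx_coord.
Qed.

Lemma pdm_mulmx p n q i (f : 'rV[R]_m -> 'M[R]_(p, n)) (g : 'rV[R]_m -> 'M[R]_(n, q)) x :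
  differentiable f x -> differentiable g x ->
  pdm i (fun y => f y *m g y) x = pdm i f x *m g x + f x *m pdm i g x.
Proof.
move=> df dg; rewrite -!pdmE//; first exact: derive_mulmx.
exact: differentiable_mulmx.
Qed.

(** The Levi-Civita covariant derivative in the direction of the [i]-th coordinate
    is [pd i] plus this matrix, acting on the coordinate fields as on row vectors;
    hence the order of the indices. *)
Definition conn_mx h (i : 'I_m) x : 'M[R]_m := \matrix_(j, p) christoffel h p i j x.

Definition curv_mx h (i j : 'I_m) x : 'M[R]_m := \matrix_(k, l) curvature h l k i j x.

Lemma smooth_conn_mx U h i : open U -> smooth_on U h ->
  (forall x, U x -> h x \in unitmx) -> smooth_on U (conn_mx h i).
Proof.
move=> oU sh hu; have si := smooth_invmx oU hu sh.
apply/smooth_mxP => // j p; under eq_fun do rewrite mxE.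
apply: smoothM => //; first exact: smooth_cst.
have sk (f : 'rV[R]_m -> R^o) l : smooth_on U f -> smooth_on U (pd l f : 'rV[R]_m -> R^o).
  exact: smooth_pd.
apply: smooth_sum => // l; apply: smoothM => //; first exact: smooth_coord.
apply: smoothB => //; last by apply: sk; exact: smooth_coord.
by apply: (@smoothD R _ U oU R^o) => //; apply: sk; exact: smooth_coord.
Qed.

(** The Koszul formula. As [h x] is invertible it characterizes [conn_mx h i x]. *)
Lemma conn_mx_lower h i x : h x \in unitmx -> (h x)^T = h x ->
  conn_mx h i x *m h x = 2^-1 *: \matrix_(j, q)
    (pd i (fun y => h y j q) x + pd j (fun y => h y i q) x - pd q (fun y => h y i j) x).
Proof.
move=> hu hT.
have -> : conn_mx h i x = 2^-1 *: ((\matrix_(j, q)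
    (pd i (fun y => h y j q) x + pd j (fun y => h y i q) x - pd q (fun y => h y i j) x))
    *m invmx (h x)).
  have HT : (invmx (h x))^T = invmx (h x) by rewrite trmx_inv hT.
  apply/matrixP => j p; rewrite !mxE /christoffel; congr (_ * _).
  by apply: eq_bigr => l _; rewrite -{1}HT !mxE mulrC.
by rewrite -scalemxAl mulmxKV.
Qed.

(** Curvature is the exterior derivative of the connection matrix plus its
    commutator. The commutator has the sign that comes from matrices acting on row
    vectors. *)
Lemma curv_mxE U h i j x : open U -> smooth_on U h ->
  (forall x, U x -> h x \in unitmx) -> U x ->
  curv_mx h i j x = pdm i (conn_mx h j) x - pdm j (conn_mx h i) x
    + conn_mx h j x *m conn_mx h i x - conn_mx h i x *m conn_mx h j x.
Proof.
move=> oU sh hu Ux.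
apply/matrixP => a b.
have pC l l' : pdm l (conn_mx h l') x a b = pd l (christoffel h b l' a) x.
  by rewrite pdmxE; apply: eq_pd => y; rewrite mxE.
have S l l' : (conn_mx h l x *m conn_mx h l' x) a b =
    \sum_e christoffel h e l a x * christoffel h b l' e x.
  by rewrite mxE; apply: eq_bigr => e _; rewrite !mxE.
have E (A B C D : 'M[R]_m) : (A - B + C - D) a b = A a b - B a b + (C a b - D a b).
  by rewrite !mxE !addrA.
apply: (etrans _ (esym (E _ _ _ _))).
by rewrite [LHS]mxE /curvature sumrB -(S j i) -(S i j) -(pC i j) -(pC j i).
Qed.

Lemma curvxE h i j x a b : curv_mx h i j x a b = curvature h b a i j x.
Proof. exact: mxE. Qed.

Opaque conn_mx curv_mx curvature christoffel.

(** The matrix identity by which a change of frame conjugates the curvature. [J]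
    is the change of frame, [Ai], [Aj] and [Bi], [Bj] are the connection matrices
    in the two frames, and the remaining letters stand for derivatives: the last
    two hypotheses are the derivatives of the first two. *)
Lemma gauge_curvature (J Ai Aj Bi Bj Ji Jj Jij dAij dAji dBij dBji : 'M[R]_m) :
  Ai *m J = Ji + J *m Bi -> Aj *m J = Jj + J *m Bj ->
  dAij *m J + Aj *m Ji = Jij + Ji *m Bj + J *m dBij ->
  dAji *m J + Ai *m Jj = Jij + Jj *m Bi + J *m dBji ->
  (dAij - dAji + Aj *m Ai - Ai *m Aj) *m J =
  J *m (dBij - dBji + Bj *m Bi - Bi *m Bj).
Proof.
move=> ai aj eij eji.
rewrite !(mulmxDl, mulmxDr, mulNmx, mulmxN) -!mulmxA ai aj !mulmxDr.
rewrite !mulmxA ai aj !mulmxDl -!mulmxA.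
have {eij}-> : dAij *m J = Jij + Ji *m Bj + J *m dBij - Aj *m Ji by rewrite -eij addrK.
have {eji}-> : dAji *m J = Jij + Jj *m Bi + J *m dBji - Ai *m Jj by rewrite -eji addrK.
move: (Ji *m Bj) (Jj *m Bi) (J *m dBij) (J *m dBji) (Aj *m Ji) (Ai *m Jj)
  (J *m (Bi *m Bj)) (J *m (Bj *m Bi)) => *.
by apply/matrixP => a b; rewrite !mxE; ring.
Qed.

Section ChangeOfCoordinates.
Variables (U U' : set 'rV[R]_m) (tau : 'rV[R]_m -> 'rV[R]_m).
Variables (k h : 'rV[R]_m -> 'M[R]_m) (c : R).
Hypotheses (oU : open U) (oU' : open U') (stau : smooth_on U tau).
Hypotheses (tauU : forall x, U x -> U' (tau x)) (sk : smooth_on U' k).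
Hypotheses (ku : forall y, U' y -> k y \in unitmx).
Hypotheses (ksym : forall y, U' y -> (k y)^T = k y) (c0 : c != 0).
Let J x : 'M[R]_m := \matrix_(i, a) pd i (fun y => tau y 0 a) x.
Hypothesis Ju : forall x, U x -> J x \in unitmx.
Hypothesis hE : forall x, U x -> h x = c *: (J x *m k (tau x) *m (J x)^T).

Let smooth_J : smooth_on U J.
Proof.
apply/smooth_mxP => // i a; under eq_fun do rewrite mxE.
by apply: smooth_pd; exact: smooth_coord.
Qed.

Let smooth_kt : smooth_on U (k \o tau).
Proof. exact: (smooth_comp oU oU'). Qed.

Let smooth_h : smooth_on U h.
Proof.
apply: (@eq_smooth R _ U oU _ (fun x => c *: (J x *m k (tau x) *m (J x)^T))).
  by move=> x /hE.
apply: smoothZ => //; first exact: smooth_cst.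
apply: smooth_mulmx => //; first exact: smooth_mulmx.
exact: (smooth_mxlinear oU (@trmx R m m)).
Qed.

Let h_unit x : U x -> h x \in unitmx.
Proof.
move=> Ux; rewrite hE// unitmxZ ?unitfE//.
by rewrite !unitmx_mul unitmx_tr Ju// ku//; exact: tauU.
Qed.

Let h_sym x : U x -> (h x)^T = h x.
Proof.
move=> Ux; rewrite hE// linearZ /= !trmx_mul trmxK ksym ?mulmxA//; exact: tauU.
Qed.

Let derive_kt p n (f : 'rV[R]_m -> 'M[R]_(p, n)) i x : smooth_on U' f -> U x ->
  pdm i (f \o tau) x = \sum_e J x i e *: pdm e f (tau x).
Proof.
move=> sf Ux; have dt := smooth_differentiable stau Ux.
have df := smooth_differentiable sf (tauU Ux).
rewrite -pdmE; last exact: differentiable_comp.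
rewrite derive_compE// derive_rV_delta//; apply: eq_bigr => e _.
by rewrite pdmE// pdmE// pdmxE mxE.
Qed.

Let dJ_sym i j a x : U x -> pdm i J x j a = pdm j J x i a.
Proof.
move=> Ux; rewrite [LHS]pdmxE [RHS]pdmxE.
have E l l' : pd l (fun y => J y l' a) x = pd l (pd l' (fun y => tau y 0 a)) x.
  by apply: eq_pd => y; rewrite [LHS]mxE.
by rewrite (E i j) (E j i); apply: (pd_comm _ _ oU) => //; exact: smooth_coord.
Qed.

Let T x (i j q : 'I_m) (F : 'I_m -> 'I_m -> 'I_m -> R) :=
  \sum_e \sum_a \sum_b J x i e * J x j a * J x q b * F e a b.

Let sandwich x (M : 'M[R]_m) j q :
  (J x *m M *m (J x)^T) j q = \sum_a \sum_b J x j a * J x q b * M a b.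
Proof.
rewrite mxE exchange_big /=; apply: eq_bigr => b _; rewrite !mxE big_distrl /=.
by apply: eq_bigr => a _; rewrite mxE; ring.
Qed.

Let DK x (e a b : 'I_m) := pd e (fun y => k y a b) (tau x).
Let P x i j q := (pdm i J x *m k (tau x) *m (J x)^T) j q.

Let derive_h i j q x : U x -> pd i (fun y => h y j q) x =
  c * (P x i j q + P x i q j + T x i j q (DK x)).
Proof.
move=> Ux.
have dJ := smooth_differentiable smooth_J Ux.
have dk := smooth_differentiable smooth_kt Ux.
have dh := smooth_differentiable smooth_h Ux.
have dJT : differentiable (fun y => (J y)^T) x.
  by apply: smooth_differentiable Ux; exact: (smooth_mxlinear oU (@trmx R m m)).
have dJTE : pdm i (fun y => (J y)^T) x = (pdm i J x)^T.
  apply/matrixP => a b; rewrite pdmxE mxE pdmxE.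
  by apply: eq_pd => y; rewrite [LHS]mxE.
have dJk : differentiable (fun y => J y *m (k \o tau) y) x by exact: differentiable_mulmx.
have -> : pd i (fun y => h y j q) x = pd i (fun y => c * (J y *m (k \o tau) y *m (J y)^T) j q) x.
  by apply: (eq_on_pd _ oU) => // y Uy; rewrite hE// mxE.
rewrite (@pdM i (cst c)); first last.
- by apply: differentiable_mx_coord; exact: differentiable_mulmx.
- exact: differentiable_cst.
rewrite pd_cst mul0r add0r; congr (_ * _).
transitivity (pdm i (fun y => J y *m (k \o tau) y *m (J y)^T) x j q); first by rewrite pdmxE.
rewrite pdm_mulmx// pdm_mulmx// mulmxDl dJTE derive_kt//.
have E (A1 A2 A3 : 'M[R]_m) : (A1 + A2 + A3) j q = A1 j q + A3 j q + A2 j q.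
  by rewrite !mxE addrAC.
apply: (etrans (E _ _ _)); congr (_ + _ + _).
  rewrite /P; set D := pdm i J x.
  transitivity ((D *m k (tau x) *m (J x)^T)^T j q); last by rewrite mxE.
  by rewrite !trmx_mul trmxK ksym ?mulmxA//; exact: tauU.
rewrite mulmx_sumr mulmx_suml summxE /T; apply: eq_bigr => e _.
rewrite -scalemxAr -scalemxAl mxE sandwich big_distrr /=; apply: eq_bigr => a _.
rewrite big_distrr /=; apply: eq_bigr => b _.
by rewrite pdmxE /DK; ring.
Qed.

Let B i x := \sum_e J x i e *: conn_mx k e (tau x).

Let connection_change i x : U x ->
  conn_mx h i x *m J x = pdm i J x + J x *m B i x.
Proof.
move=> Ux; have hu := h_unit Ux; have ju := Ju Ux; have U't := tauU Ux.
(* It suffices to check the Koszul formula for the candidate on the right. By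
   [derive_h] the second derivatives of [tau] enter the formula through the
   terms [P], which cancel in pairs because [P] is symmetric in its first two
   indices. *)
suff E : (pdm i J x + J x *m B i x) *m invmx (J x) = conn_mx h i x.
  by rewrite -E mulmxKV.
apply: (can_inj (mulmxK hu)); rewrite conn_mx_lower ?h_sym//.
rewrite hE// -scalemxAr -!mulmxA (mulmxA (invmx _)) mulVmx// mul1mx mulmxA.
rewrite mulmxDl mulmxDl; apply/matrixP => j q.
rewrite [LHS]mxE [X in c * X]mxE [RHS]mxE [X in _ = 2^-1 * X]mxE.
rewrite (derive_h i j q Ux) (derive_h j i q Ux) (derive_h q i j Ux) -/(P x i j q).
have -> : (J x *m B i x *m k (tau x) *m (J x)^T) j q =
   2^-1 * (T x i j q (DK x) + T x j i q (DK x) - T x q i j (DK x)).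
  have -> : J x *m B i x *m k (tau x) = J x *m (B i x *m k (tau x)) by rewrite mulmxA.
  have -> : B i x *m k (tau x) = \sum_e J x i e *: (2^-1 *: \matrix_(a, b)
      (DK x e a b + DK x a e b - DK x b e a)).
    rewrite mulmx_suml; apply: eq_bigr => e _.
    by rewrite -scalemxAl conn_mx_lower ?ku ?ksym.
  rewrite mulmx_sumr mulmx_suml summxE.
  have -> : T x j i q (DK x) = T x i j q (fun e a b => DK x a e b).
    rewrite /T exchange_big /=; apply: eq_bigr => e _; apply: eq_bigr => a _.
    by apply: eq_bigr => b _; ring.
  have -> : T x q i j (DK x) = T x i j q (fun e a b => DK x b e a).
    rewrite /T exchange_big /=; apply: eq_bigr => e _.
    rewrite exchange_big /=; apply: eq_bigr => a _.
    by apply: eq_bigr => b _; ring.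
  rewrite /T -big_split /= -sumrB big_distrr /=; apply: eq_bigr => e _.
  rewrite -!scalemxAr -!scalemxAl [LHS]mxE [X in _ * X]mxE sandwich.
  rewrite -big_split /= -sumrB !big_distrr /=; apply: eq_bigr => a _.
  rewrite -big_split /= -sumrB !big_distrr /=; apply: eq_bigr => b _.
  by rewrite mxE; ring.
have PS i' j' q' : P x i' j' q' = P x j' i' q'.
  have rowE (A A' M N : 'M[R]_m) : (forall a, A j' a = A' i' a) ->
      (A *m M *m N) j' q' = (A' *m M *m N) i' q'.
    move=> E; rewrite -!mulmxA mxE [RHS]mxE.
    by apply: eq_bigr => a _; rewrite E.
  exact: (rowE (pdm i' J x) (pdm j' J x) _ _ (fun a => dJ_sym i' j' a Ux)).
rewrite (PS j i q) (PS q i j) (PS q j i); by field.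
Qed.

Let smooth_B i : smooth_on U (B i).
Proof.
apply: smooth_sum => // e; apply: smoothZ => //; first exact: smooth_coord.
exact: (smooth_comp oU oU' tauU (smooth_conn_mx e oU' sk ku)).
Qed.

Let derive_B i j x : U x -> pdm i (B j) x =
  \sum_b pdm i J x j b *: conn_mx k b (tau x) +
  \sum_b \sum_a (J x i a * J x j b) *: pdm a (conn_mx k b) (tau x).
Proof.
move=> Ux; have dJ := smooth_differentiable smooth_J Ux.
have sC b := smooth_conn_mx b oU' sk ku.
have dC b : differentiable (conn_mx k b \o tau) x.
  by apply: smooth_differentiable Ux; exact: (smooth_comp oU oU' tauU (sC b)).
have dJC b : differentiable (fun y => J y j b *: conn_mx k b (tau y)) x.
  apply: smooth_differentiable Ux; apply: smoothZ => //; first exact: smooth_coord.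
  exact: (smooth_comp oU oU' tauU (sC b)).
rewrite -pdmE; last exact: differentiable_bigsum.
rewrite derive_bigsum// -big_split /=; apply: eq_bigr => b _; rewrite pdmE//.
have -> : pdm i (fun y => J y j b *: conn_mx k b (tau y)) x =
   pdm i J x j b *: conn_mx k b (tau x) + J x j b *: pdm i (conn_mx k b \o tau) x.
  apply/matrixP => p q; rewrite pdmxE.
  transitivity (pd i (fun y => J y j b * conn_mx k b (tau y) p q) x).
    by apply: eq_pd => y; rewrite [LHS]mxE.
  rewrite (@pdM i (fun y => J y j b) (fun y => conn_mx k b (tau y) p q)).
  - rewrite [RHS]mxE [X in _ = X + _]mxE [X in _ = _ + X]mxE.
    by rewrite (pdmxE i J x j b) (pdmxE i (conn_mx k b \o tau) x p q).
  - exact: differentiable_mx_coord.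
  - exact: (differentiable_mx_coord p q (dC b)).
congr (_ + _); rewrite derive_kt// scaler_sumr; apply: eq_bigr => a _.
by rewrite scalerA mulrC.
Qed.

Let curvature_change i j x : U x -> curv_mx h i j x *m J x =
  J x *m \sum_a \sum_b (J x i a * J x j b) *: curv_mx k a b (tau x).
Proof.
move=> Ux; have U't := tauU Ux.
have dJ := smooth_differentiable smooth_J Ux.
have dB l : differentiable (B l) x by exact: smooth_differentiable (smooth_B l) Ux.
have dA l : differentiable (conn_mx h l) x.
  by apply: smooth_differentiable Ux; exact: smooth_conn_mx.
have ddJ l : differentiable (pdm l J) x.
  by apply: smooth_differentiable Ux; exact: smooth_pdm.
have E l l' : pdm l (conn_mx h l') x *m J x + conn_mx h l' x *m pdm l J x =
    pdm l (pdm l' J) x + pdm l J x *m B l' x + J x *m pdm l (B l') x.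
  have : pdm l (fun y => conn_mx h l' y *m J y) x =
      pdm l (fun y => pdm l' J y + J y *m B l' y) x.
    by apply: (eq_on_pdm _ oU) => // y; exact: connection_change.
  rewrite (pdm_mulmx l (dA l') dJ) (pdmD l (ddJ l') (differentiable_mulmx dJ (dB l'))).
  by rewrite (pdm_mulmx l dJ (dB l')) addrA.
have JC : pdm i (pdm j J) x = pdm j (pdm i J) x.
  apply/matrixP => a b; rewrite [LHS]pdmxE [RHS]pdmxE.
  have EE l l' : pd l (fun y => pdm l' J y a b) x = pd l (pd l' (fun y => J y a b)) x.
    by apply: eq_pd => y; rewrite [LHS]mxE.
  by rewrite (EE i j) (EE j i); apply: (pd_comm _ _ oU) => //; exact: smooth_coord.
have Eji := E j i; rewrite -JC in Eji.
rewrite (curv_mxE _ _ oU smooth_h h_unit Ux).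
rewrite (gauge_curvature (connection_change i Ux) (connection_change j Ux) (E i j) Eji).
apply: (congr1 (mulmx _)).
rewrite (derive_B i j Ux).
rewrite (derive_B j i Ux).
have -> : \sum_b pdm j J x i b *: conn_mx k b (tau x) =
          \sum_b pdm i J x j b *: conn_mx k b (tau x).
  apply: eq_bigr => b _.
  apply: (congr1 (fun t : R => t *: conn_mx k b (tau x))).
  exact: (dJ_sym j i b Ux).
rewrite opprD addrACA subrr add0r.
have -> : B j x *m B i x = \sum_a \sum_b (J x i a * J x j b) *:
    (conn_mx k b (tau x) *m conn_mx k a (tau x)).
  rewrite /B mulmx_sumr; apply: eq_bigr => a _; rewrite mulmx_suml.
  by apply: eq_bigr => b _; rewrite -scalemxAl -scalemxAr scalerA mulrC.
have -> : B i x *m B j x = \sum_a \sum_b (J x i a * J x j b) *: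
    (conn_mx k a (tau x) *m conn_mx k b (tau x)).
  rewrite /B mulmx_suml; apply: eq_bigr => a _; rewrite mulmx_sumr.
  by apply: eq_bigr => b _; rewrite -scalemxAl -scalemxAr scalerA.
rewrite [X in X - _ + _ - _]exchange_big /= -!sumrB -big_split /= -sumrB.
apply: eq_bigr => a _; rewrite -!sumrB -big_split /= -sumrB.
apply: eq_bigr => b _; rewrite (curv_mxE _ _ oU' sk ku U't) !scalerDr !scalerN.
by rewrite (mulrC (J x j b)).
Qed.

Let ric f x : 'M[R]_m := \matrix_(j, l) ricci f j l x.

Let ricci_change x : U x -> ric h x = J x *m ric k (tau x) *m (J x)^T.
Proof.
move=> Ux; have ju := Ju Ux.
have curvE i j : curv_mx h i j x =
    \sum_a \sum_b (J x i a * J x j b) *: (J x *m curv_mx k a b (tau x) *m invmx (J x)).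
  rewrite -[LHS](mulmxK ju) curvature_change// mulmx_sumr mulmx_suml.
  apply: eq_bigr => a _; rewrite mulmx_sumr mulmx_suml.
  by apply: eq_bigr => b _; rewrite -scalemxAr -scalemxAl.
apply/matrixP => j l; rewrite sandwich mxE /ricci.
transitivity (\sum_i curv_mx h i j x l i); first by apply: eq_bigr => i _; rewrite curvxE.
transitivity (\sum_a \sum_b J x j b * (J x *m curv_mx k a b (tau x) *m invmx (J x) *m J x) l a).
  under eq_bigr do rewrite curvE summxE.
  rewrite exchange_big /=; apply: eq_bigr => a _.
  under eq_bigr do rewrite summxE.
  rewrite exchange_big /=; apply: eq_bigr => b _.
  rewrite [X in _ = _ * X]mxE big_distrr /=; apply: eq_bigr => i _.
  by rewrite [LHS]mxE; ring.
rewrite exchange_big /=; apply: eq_bigr => b _.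
rewrite -big_distrr /=.
under eq_bigr do rewrite mulmxKV// mxE.
rewrite exchange_big /= big_distrr /=; apply: eq_bigr => d _.
rewrite [X in _ = _ * X]mxE /ricci -mulrA; apply: (congr1 ( *%R _)).
rewrite big_distrr /=; by apply: eq_bigr => a _; rewrite curvxE.
Qed.

(** The connection matrices of [h] and [k] differ by the change of frame [J]
    ([connection_change]). By [gauge_curvature] the curvatures are then
    conjugate, and so the Ricci tensor transforms like a bilinear form
    ([ricci_change]). Contracting it with the inverse metric removes [J], while a
    constant factor [c] of the metric divides the scalar curvature. *)
Theorem scalar_curvature_change x : U x ->
  coord_scalar_curvature h x = c^-1 * coord_scalar_curvature k (tau x).
Proof.
move=> Ux; have ju := Ju Ux; have U't := tauU Ux.
have trE f y : coord_scalar_curvature f y = \tr (invmx (f y) *m (ric f y)^T).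
  rewrite /mxtrace; apply: eq_bigr => a _; rewrite mxE.
  by apply: eq_bigr => b _; rewrite !mxE.
rewrite !trE ricci_change// hE//.
have -> : invmx (c *: (J x *m k (tau x) *m (J x)^T)) =
    c^-1 *: (invmx (J x)^T *m invmx (k (tau x)) *m invmx (J x)).
  have kt := ku U't.
  apply: (can_inj (mulmxK (h_unit Ux))); rewrite hE// mulVmx; last first.
    by rewrite -hE//; exact: h_unit.
  rewrite -scalemxAl -scalemxAr scalerA mulVf// scale1r.
  rewrite -!mulmxA (mulmxA (invmx (J x))) mulVmx// mul1mx (mulmxA (invmx (k _))) mulVmx//.
  by rewrite mul1mx mulVmx// unitmx_tr.
rewrite -scalemxAl linearZ /=; congr (_ * _).
rewrite !trmx_mul trmxK -!mulmxA (mulmxA (invmx (J x))) mulVmx// mul1mx.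
rewrite mxtrace_mulC -!mulmxA mulmxV ?unitmx_tr//.
by rewrite mulmx1.
Qed.

End ChangeOfCoordinates.
End Invariance.

(** * The product of a flat space and a round sphere *)

Section RoundSphere.
Context {R : realType} {m : nat}.
Implicit Types (h : 'rV[R]_m -> 'M[R]_m) (U : set 'rV[R]_m) (x w : 'rV[R]_m).

(** Differentiability goes together with the value of the derivative, so that the
    rules of calculus can be composed without side conditions. *)
Definition has_pd c (f : 'rV[R]_m -> R^o) w (df : R) :=
  differentiable f w /\ pd c f w = df.

Lemma has_pd_cst c a w : has_pd c (fun=> a) w 0.
Proof. by split; [exact: differentiable_cst|exact: pd_cst]. Qed.

Lemma has_pdD c (f g : 'rV[R]_m -> R^o) w df dg : has_pd c f w df -> has_pd c g w dg ->
  has_pd c (fun y => f y + g y) w (df + dg).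
Proof.
move=> [f1 <-] [g1 <-]; split; first exact: differentiableD.
by apply: deriveD; exact: diff_derivable.
Qed.

Lemma has_pdM c (f g : 'rV[R]_m -> R^o) w df dg : has_pd c f w df -> has_pd c g w dg ->
  has_pd c (fun y => f y * g y) w (df * g w + f w * dg).
Proof.
move=> [f1 <-] [g1 <-]; split; last exact: pdM.
exact: (@differentiableM R _ f g).
Qed.

Lemma has_pdV c (f : 'rV[R]_m -> R^o) w df : f w != 0 -> has_pd c f w df ->
  has_pd c (fun y => (f y)^-1) w (- (f w)^-1 ^+ 2 * df).
Proof.
move=> f0 [f1 <-]; split; first exact: (@differentiableV R _ f).
rewrite /pd (@deriveV R _ f)//; last exact: diff_derivable.
by rewrite exprVn.
Qed.

Lemma has_pd_sum c (I : Type) (r : seq I) (F : I -> 'rV[R]_m -> R^o) w dF :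
  (forall i, has_pd c (F i) w (dF i)) ->
  has_pd c (fun y => \sum_(i <- r) F i y) w (\sum_(i <- r) dF i).
Proof.
move=> hF; have dF' i : differentiable (F i) w by have [] := hF i.
split; first exact: differentiable_bigsum.
rewrite /pd derive_bigsum//; apply: eq_bigr => i _.
by have [_ <-] := hF i.
Qed.

Lemma has_pd_coord c a w : has_pd c (fun y => y 0 a) w (c == a)%:R.
Proof.
split; first exact: differentiable_coord.
have -> : pd c (fun y => y 0 a) w = ('D_(delta_mx 0 c) (@id 'rV[R]_m) w) 0 a.
  by rewrite pd_mx.
by rewrite derive_id mxE eqxx eq_sym.
Qed.

Lemma has_pd_ext c (f g : 'rV[R]_m -> R^o) w df dg :
  (forall y, f y = g y) -> df = dg -> has_pd c f w df -> has_pd c g w dg.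
Proof. by move=> /funext -> ->. Qed.

Lemma open_neq0 : open [set t : R^o | t != 0].
Proof.
rewrite (_ : [set t : R^o | t != 0] = ~` [set 0]).
  by rewrite openC; exact: closed_eq.
by apply/seteqP; split=> t /=; [move=> /eqP|move=> h; apply/eqP].
Qed.

Lemma open_unitmx (V : normedModType R) (U : set V) (h : V -> 'M[R]_m) : open U -> smooth_on U h ->
  open [set x | U x /\ h x \in unitmx].
Proof.
move=> oU sh; rewrite openE => x [Ux hx].
have cd : {for x, continuous (fun y => \det (h y) : R^o)}.
  by apply: smooth_continuous Ux; exact: smooth_det.
have d0 : \det (h x) != 0 by move: hx; rewrite unitmxE unitfE.
have N1 : \forall y \near x, U y by exact: open_nbhs_nbhs.
have N2 : \forall y \near x, \det (h y) != 0.
  apply: (cd [set t : R^o | t != 0]).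
  by apply: open_nbhs_nbhs; split=> //; exact: open_neq0.
rewrite /interior; apply: filterS2 N1 N2 => y Uy hy.
by split=> //; rewrite unitmxE unitfE.
Qed.

(** At a point where the first derivatives of the metric vanish so do the
    Christoffel symbols, and only the second derivatives of the metric are left in
    the curvature. *)
Lemma scalar_curvature_critical U h x : open U -> smooth_on U h ->
  (forall y, U y -> h y \in unitmx) -> U x ->
  (forall i j l, pd l (fun y => h y i j) x = 0) ->
  let dd i j a b := pd i (pd j (fun y => h y a b)) x in
  coord_scalar_curvature h x = \sum_j \sum_k \sum_i \sum_e
    2^-1 * (invmx (h x) j k * invmx (h x) i e *
    (dd i k j e - dd i e j k - dd j k i e + dd j e i k)).
Proof.
move=> oU sh hu Ux crit dd; have si := smooth_invmx oU hu sh.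
have hs a b : smooth_on U (fun y => h y a b : R^o) by exact: smooth_coord.
have dpd i (f : 'rV[R]_m -> R^o) : smooth_on U f -> differentiable (pd i f : 'rV[R]_m -> R^o) x.
  by move=> sf; apply: smooth_differentiable Ux; exact: smooth_pd.
have chr0 k i j : christoffel h k i j x = 0.
  by rewrite /christoffel big1 ?mulr0// => l _; rewrite !crit subr0 addr0 mulr0.
have dchr i l j k : pd i (christoffel h l j k) x =
    2^-1 * \sum_e invmx (h x) l e * (dd i j k e + dd i k j e - dd i e j k).
  pose Q e (y : 'rV[R]_m) : R^o := pd j (fun z => h z k e) y + pd k (fun z => h z j e) y
    - pd e (fun z => h z j k) y.
  have Q0 e : Q e x = 0 by rewrite /Q !crit subr0 addr0.
  have HQ e : has_pd i (Q e) x (dd i j k e + dd i k j e - dd i e j k).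
    apply: has_pdD; first by apply: has_pdD; split=> //; exact: dpd.
    apply: has_pd_ext (has_pdM (has_pd_cst i (-1) x) (conj (dpd e _ (hs j k)) erefl)) => [y|].
      by rewrite mulN1r.
    by rewrite mul0r add0r mulN1r.
  have HI e : has_pd i (fun y => invmx (h y) l e) x (pd i (fun y => invmx (h y) l e) x).
    by split=> //; apply: smooth_differentiable Ux; exact: (smooth_coord oU).
  have [_ E] := has_pdM (has_pd_cst i 2^-1 x)
    (has_pd_sum (index_enum 'I_m) (fun e => has_pdM (HI e) (HQ e))).
  apply: etrans E _; rewrite mul0r add0r; congr (_ * _); apply: eq_bigr => e _.
  by rewrite Q0 mulr0 add0r.
rewrite /coord_scalar_curvature; apply: eq_bigr => j _; apply: eq_bigr => k _.
rewrite /ricci big_distrr /=; apply: eq_bigr => i _.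
have -> : curvature h i k i j x = pd i (christoffel h i j k) x - pd j (christoffel h i i k) x.
  rewrite /curvature [X in _ + X]big1 ?addr0// => a _.
  by rewrite (chr0 a j k) (chr0 a i k) !mul0r subrr.
rewrite (dchr i i j k) (dchr j i i k).
rewrite -mulrBr -sumrB !big_distrr /=; apply: eq_bigr => e _.
have -> : dd j i k e = dd i j k e by exact: (pd_comm _ _ oU).
move: (invmx (h x) j k) (invmx (h x) i e) (dd i j k e) (dd i k j e) (dd i e j k)
  (dd j k i e) (dd j e i k) => *; ring.
Qed.

Section Gnomonic.
Variables (C b : 'M[R]_m).
Hypotheses (bT : b^T = b) (CT : C^T = C) (Cbu : C + b \in unitmx).

Let q w : R := 1 + (w *m b *m w^T) 0 0.
Let y_ a w : R := (w *m b) 0 a.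

(** The central projection of the unit sphere to the tangent space at one of its
    points turns the round metric into [|du|^2 / q - (u . du)^2 / q^2] with
    [q = 1 + |u|^2]. Here [b] is the scalar product of that tangent space,
    extended by 0 to further directions, on which the constant [C] is a flat
    metric. *)
Definition gnomonic_metric w : 'M[R]_m :=
  C + ((q w)^-1 *: b - (q w)^-1 ^+ 2 *: ((w *m b)^T *m (w *m b))).

Lemma gnomonicE w i j : gnomonic_metric w i j =
  C i j + (b i j * (q w)^-1 + -1 * (y_ i w * y_ j w * ((q w)^-1 * (q w)^-1))).
Proof.
rewrite !mxE big_ord1 mulN1r; congr (_ + (_ - _)); first exact: mulrC.
by rewrite mxE -expr2 mulrC.
Qed.

Let bS i j : b i j = b j i.
Proof. by rewrite -{1}bT mxE. Qed.

Let has_pd_y c a w : has_pd c (y_ a : _ -> R^o) w (b c a).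
Proof.
apply: has_pd_ext (has_pd_sum (index_enum 'I_m) (fun i => has_pdM (has_pd_coord c i w)
  (has_pd_cst c (b i a) w))) => [y|]; first by rewrite /y_ mxE.
rewrite (bigD1 c)//= eqxx mulr0 addr0 mul1r big1 ?addr0// => i ic.
by rewrite eq_sym (negbTE ic) mul0r mulr0 addr0.
Qed.

Lemma has_pd_q c w : has_pd c (q : _ -> R^o) w (2 * y_ c w).
Proof.
apply: has_pd_ext (has_pdD (has_pd_cst c 1 w) (has_pd_sum (index_enum 'I_m)
  (fun i => has_pdM (has_pd_y c i w) (has_pd_coord c i w)))) => [y|].
  by rewrite /q mxE; congr (_ + _); apply: eq_bigr => i _; rewrite [X in _ = _ * X]mxE.
rewrite add0r big_split /= mulr_natl mulr2n; congr (_ + _).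
  by rewrite /y_ mxE; apply: eq_bigr => i _; rewrite mulrC bS.
rewrite (bigD1 c)//= eqxx mulr1 big1 ?addr0// => i ic.
by rewrite eq_sym (negbTE ic) mulr0.
Qed.

Let p w : R := (q w)^-1.

Let has_pd_p c w : q w != 0 -> has_pd c (p : _ -> R^o) w (- 2 * y_ c w * (p w * p w)).
Proof.
move=> q0; apply: has_pd_ext (has_pdV q0 (has_pd_q c w)) => //.
by rewrite /p expr2; ring.
Qed.

Let dh i j d w : R := -2 * b i j * y_ d w * (p w * p w)
  + -1 * ((b d i * y_ j w + b d j * y_ i w) * (p w * p w))
  + 4 * (y_ i w * y_ j w * y_ d w) * (p w * p w * p w).

Let has_pd_h i j d w : q w != 0 ->
  has_pd d (fun y => gnomonic_metric y i j : R^o) w (dh i j d w).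
Proof.
move=> q0; have hp := has_pd_p d q0.
apply: has_pd_ext (has_pdD (has_pd_cst d (C i j) w) (has_pdD
   (has_pdM (has_pd_cst d (b i j) w) hp)
   (has_pdM (has_pd_cst d (-1) w) (has_pdM (has_pdM (has_pd_y d i w) (has_pd_y d j w))
      (has_pdM hp hp))))) => [y|]; first by rewrite gnomonicE.
by rewrite /dh; ring.
Qed.

Let q0E : q 0 = 1.
Proof. by rewrite /q !mul0mx mxE addr0. Qed.

Let p0E : p 0 = 1.
Proof. by rewrite /p q0E invr1. Qed.

Let y0E a : y_ a 0 = 0.
Proof. by rewrite /y_ mul0mx mxE. Qed.

Let U : set 'rV[R]_m := [set w | q w != 0].

Let smooth_q : smooth_on setT (q : 'rV[R]_m -> R^o).
Proof.
have oT := @openT 'rV[R]_m; have sid := @smooth_id_mx R 1 m setT.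
apply: (@smoothD R _ _ oT R^o) => //; first exact: smooth_cst.
apply: smooth_coord => //; apply: smooth_mulmx => //;
  last exact: (smooth_mxlinear oT (@trmx R 1 m)).
by apply: smooth_mulmx => //; exact: smooth_cst.
Qed.

Let oU : open U.
Proof.
apply: (@open_comp _ _ (q : _ -> R^o) [set t : R^o | t != 0]); last exact: open_neq0.
by move=> w _; exact: (smooth_continuous smooth_q).
Qed.

Let has_pd_dh i j d c : has_pd c (dh i j d : _ -> R^o) 0
  (- 2 * b i j * b c d - (b d i * b c j + b d j * b c i)).
Proof.
have hp : has_pd c (p : _ -> R^o) 0 0.
  by have := @has_pd_p c 0; rewrite q0E y0E mulr0 mul0r; apply; exact: oner_neq0.
have hy a := has_pd_y c a 0.
have hpp := has_pdM hp hp.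
apply: has_pd_ext (has_pdD (has_pdD
  (has_pdM (has_pdM (has_pd_cst c (-2 * b i j) 0) (hy d)) hpp)
  (has_pdM (has_pd_cst c (-1) 0)
    (has_pdM (has_pdD (has_pdM (has_pd_cst c (b d i) 0) (hy j))
                      (has_pdM (has_pd_cst c (b d j) 0) (hy i))) hpp)))
  (has_pdM (has_pdM (has_pd_cst c 4 0) (has_pdM (has_pdM (hy i) (hy j)) (hy d)))
           (has_pdM hpp hp))) => [y|] //.
by rewrite !y0E p0E; ring.
Qed.

Let smooth_gnomonic : smooth_on U gnomonic_metric.
Proof.
have sid := @smooth_id_mx R 1 m U.
have sq : smooth_on U (q : 'rV[R]_m -> R^o) by exact: smooth_subset smooth_q.
have sp : smooth_on U (p : 'rV[R]_m -> R^o) by exact: smoothV.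
have swb : smooth_on U (fun w : 'rV[R]_m => w *m b).
  by apply: smooth_mulmx => //; exact: smooth_cst.
apply/smooth_mxP => // i j; apply: (eq_smooth oU (f := fun w =>
   C i j + (b i j * (q w)^-1 + -1 * (y_ i w * y_ j w * ((q w)^-1 * (q w)^-1))) : R^o)).
  by move=> w _; rewrite gnomonicE.
apply: (@smoothD R _ _ oU R^o) => //; first exact: smooth_cst.
apply: (@smoothD R _ _ oU R^o) => //; first by apply: smoothM => //; exact: smooth_cst.
apply: smoothM => //; first exact: smooth_cst.
by apply: smoothM => //; apply: smoothM => //; exact: smooth_coord.
Qed.

(** The metric is critical at the origin, where its curvature tensor is found to be
    [b j k * b i e - b i k * b j e]. The right-hand side is [k * (k - 1)] when
    [b] has rank [k] and the radicals of [b] and [C] are complementary. *)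
Theorem gnomonic_scalar_curvature :
  coord_scalar_curvature gnomonic_metric 0 =
  (\tr (invmx (C + b) *m b)) ^+ 2 - \tr (invmx (C + b) *m b *m (invmx (C + b) *m b)).
Proof.
have U0 : U 0 by rewrite /U /= q0E oner_neq0.
have g0 : gnomonic_metric 0 = C + b.
  apply/matrixP => i j; rewrite gnomonicE !y0E q0E invr1 [RHS]mxE.
  by rewrite !mulr0 !mul0r mulr0 addr0 mulr1.
pose U1 : set 'rV[R]_m := [set x | U x /\ gnomonic_metric x \in unitmx].
have oU1 : open U1 by exact: open_unitmx.
have U10 : U1 0 by split=> //; rewrite g0.
have sU1 : smooth_on U1 gnomonic_metric by apply: smooth_subset smooth_gnomonic => x [].
have uU1 y : U1 y -> gnomonic_metric y \in unitmx by case.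
have pdE i j d w : U w -> pd d (fun y => gnomonic_metric y i j) w = dh i j d w.
  by move=> Uw; have [] := has_pd_h i j d Uw.
have crit i j l : pd l (fun y => gnomonic_metric y i j) 0 = 0.
  by rewrite pdE// /dh !y0E; ring.
rewrite (scalar_curvature_critical oU1 sU1 uU1 U10 crit) g0.
have ddE i j a e : pd i (pd j (fun y => gnomonic_metric y a e)) 0 =
    - 2 * b a e * b i j - (b j a * b i e + b j e * b i a).
  have [_ <-] := has_pd_dh a e j i.
  by apply: (eq_on_pd _ oU) => // y; exact: pdE.
set H := invmx (C + b).
have HT : H^T = H by rewrite /H trmx_inv linearD /= bT CT.
have HS i j : H i j = H j i by rewrite -{1}HT mxE.
transitivity (\sum_j \sum_k \sum_i \sum_e
    (H j k * b k j * (H i e * b e i) - H j k * b k i * (H i e * b e j))).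
  apply: eq_bigr => j _; apply: eq_bigr => k _; apply: eq_bigr => i _.
  apply: eq_bigr => e _; rewrite (ddE i k j e) (ddE i e j k) (ddE j k i e) (ddE j e i k).
  rewrite (bS k j) (bS e i) (bS k i) (bS e j) (bS e k) (bS j i).
  by field.
have trE : \tr (H *m b) = \sum_j \sum_k H j k * b k j.
  by rewrite /mxtrace; apply: eq_bigr => j _; rewrite mxE.
rewrite trE expr2 big_distrl /= /mxtrace -sumrB; apply: eq_bigr => j _.
rewrite mxE.
under [X in _ = _ - X]eq_bigr do rewrite mxE mxE big_distrl /=.
rewrite [X in _ = _ - X]exchange_big /= big_distrl /= -sumrB; apply: eq_bigr => k _.
rewrite big_distrr /= -sumrB; apply: eq_bigr => i _.
rewrite !big_distrr /= -sumrB; apply: eq_bigr => e _; ring.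
Qed.

End Gnomonic.
End RoundSphere.

(** * The Sasakian metric in the charts of the tangent bundle *)

Section SasakiForm.
Context {R : realType} {n : nat}.

Definition bilin (N : nat) (B : 'M[R]_N) (u v : 'rV[R]_N) : R := (u *m B *m v^T) 0 0.

Lemma bilinE N (B : 'M[R]_N) u v : bilin B u v = \sum_i \sum_j u 0 i * B i j * v 0 j.
Proof.
rewrite /bilin mxE exchange_big /=; apply: eq_bigr => j _; rewrite mxE big_distrl /=.
by apply: eq_bigr => i _; rewrite mxE.
Qed.

Variables (h : 'rV[R]_n -> 'M[R]_n) (Gam : 'I_n -> 'I_n -> 'rV[R]_n -> 'rV[R]_n).

Definition conn_form (x a y : 'rV[R]_n) : 'rV[R]_n :=
  \sum_i \sum_j (a 0 i * y 0 j) *: Gam i j x.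

(** The expression [g (dx, dx) + g (dy + Gamma (dx, y), dy + Gamma (dx, y))] of the
    Sasakian metric at the point [w = (x, y)]. *)
Definition sasaki_form (w v v' : 'rV[R]_(n + n)) : R :=
  let x := lsubmx w in let y := rsubmx w in
  bilin (h x) (lsubmx v) (lsubmx v') +
  bilin (h x) (rsubmx v + conn_form x (lsubmx v) y)
              (rsubmx v' + conn_form x (lsubmx v') y).

End SasakiForm.

Section Transition.
Context {R : realType} {n : nat} (M : manifold R n).
Local Notation A := (matlas M).
Local Notation TM := (tangent_bundle M).
Implicit Types (c d e : chart R n M) (p q : M).

Lemma open_preimage_on (V V' : normedModType R) (U : set V) (U' : set V') (f : V -> V') :
  open U -> open U' -> (forall x, U x -> {for x, continuous f}) ->
  open [set x | U x /\ U' (f x)].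
Proof.
move=> oU oU' cf; rewrite openE => x [Ux U'x]; rewrite /interior.
have N1 : \forall y \near x, U y by exact: open_nbhs_nbhs.
have N2 : \forall y \near x, U' (f y) by apply: (cf x Ux); exact: open_nbhs_nbhs.
by apply: filterS2 N1 N2 => y.
Qed.

Definition overlap c d : set 'rV[R]_n := cmap c @` (cdom c `&` cdom d).

Definition trans c d : 'rV[R]_n -> 'rV[R]_n := cmap d \o cinv c.

Lemma cinvK c : charts A c -> forall p, cdom c p -> cinv c (cmap c p) = p.
Proof. by move=> /mchart[]. Qed.

Lemma cmapK c : charts A c -> forall x, cimg c x -> cmap c (cinv c x) = x.
Proof. by move=> cA x [p cp <-]; rewrite cinvK. Qed.

Lemma cdom_cinv c : charts A c -> forall x, cimg c x -> cdom c (cinv c x).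
Proof. by move=> cA x [p cp <-]; rewrite cinvK. Qed.

Lemma chart_atP p : charts A (chart_at A p). Proof. by have [] := mchart_at p. Qed.
Lemma cdom_chart_at p : cdom (chart_at A p) p. Proof. by have [] := mchart_at p. Qed.

Lemma overlapP c d x : charts A c -> overlap c d x <-> cimg c x /\ cdom d (cinv c x).
Proof.
move=> cA; split=> [[p [cp dp] <-]|[cx dx]].
  by rewrite (cinvK cA)//; split=> //; exists p.
exists (cinv c x); last exact: cmapK.
by split=> //; exact: cdom_cinv.
Qed.

Lemma overlap_cmap c d p : cdom c p -> cdom d p -> overlap c d (cmap c p).
Proof. by move=> cp dp; exists p. Qed.

Lemma open_overlap c d : charts A c -> charts A d -> open (overlap c d).
Proof.
move=> cA dA; have [_ oc _ _ cc] := mchart cA; have [od _ _ _ _] := mchart dA.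
rewrite openE => x /(overlapP _ _ cA)[cx dx]; rewrite /interior.
have N1 : \forall y \near x, cimg c y by exact: open_nbhs_nbhs.
have N2 : \forall y \near x, cdom d (cinv c y).
  by apply: (cc x cx); exact: open_nbhs_nbhs.
by apply: filterS2 N1 N2 => y h1 h2; apply/(overlapP _ _ cA).
Qed.

Lemma smooth_trans c d : charts A c -> charts A d -> smooth_on (overlap c d) (trans c d).
Proof. exact: mcompat. Qed.

Lemma trans_overlap c d x : charts A c -> charts A d -> overlap c d x ->
  overlap d c (trans c d x).
Proof. by move=> cA dA [p [cp dp] <-]; rewrite /trans /= cinvK//; exists p. Qed.

Lemma trans_differentiable c d p : charts A c -> charts A d -> cdom c p -> cdom d p ->
  differentiable (trans c d) (cmap c p).
Proof.
by move=> cA dA cp dp; apply: (smooth_differentiable (smooth_trans cA dA)); exists p.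
Qed.

Lemma tchange_diff c d p : charts A c -> charts A d -> cdom c p -> cdom d p ->
  tchange c d p = 'd (trans c d) (cmap c p) :> ('rV[R]_n -> 'rV[R]_n).
Proof.
move=> cA dA cp dp; apply/funext => v; rewrite /tchange -deriveE//.
exact: trans_differentiable.
Qed.

Lemma tchange_comp c d e p v : charts A c -> charts A d -> charts A e ->
  cdom c p -> cdom d p -> cdom e p ->
  tchange d e p (tchange c d p v) = tchange c e p v.
Proof.
move=> cA dA eA cp dp ep; rewrite /tchange.
have Ecd : trans c d (cmap c p) = cmap d p by rewrite /trans /= (cinvK cA).
have <- : 'D_v (trans d e \o trans c d) (cmap c p) = 'D_v (cmap e \o cinv c) (cmap c p).
  apply: near_eq_derive; apply: (nbhs_eq_on (open_overlap cA dA)); first by exists p.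
  by move=> _ [q [cq dq] <-]; rewrite /trans /= (cinvK cA)// (cinvK dA).
rewrite derive_compE ?Ecd//; first exact: trans_differentiable.
exact: trans_differentiable.
Qed.

Lemma tchange_id c p v : charts A c -> cdom c p -> tchange c c p v = v.
Proof.
move=> cA cp; rewrite /tchange.
have [_ oc _ _ _] := mchart cA.
rewrite -[RHS](derive_id (cmap c p) v); apply: near_eq_derive.
apply: (nbhs_eq_on oc); first by exists p.
by move=> x cx; rewrite /= (cmapK cA).
Qed.

Lemma tchangeK c d p v : charts A c -> charts A d -> cdom c p -> cdom d p ->
  tchange d c p (tchange c d p v) = v.
Proof. by move=> cA dA cp dp; rewrite tchange_comp// tchange_id. Qed.

Lemma tchange_sum c d p (I : Type) (r : seq I) (F : I -> 'rV[R]_n) : charts A c -> charts A d ->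
  cdom c p -> cdom d p ->
  tchange c d p (\sum_(i <- r) F i) = \sum_(i <- r) tchange c d p (F i).
Proof. by move=> cA dA cp dp; rewrite tchange_diff// linear_sum. Qed.

Lemma tchangeZ c d p k v : charts A c -> charts A d -> cdom c p -> cdom d p ->
  tchange c d p (k *: v) = k *: tchange c d p v.
Proof. by move=> cA dA cp dp; rewrite tchange_diff// linearZ. Qed.

Lemma tchangeD c d p v w : charts A c -> charts A d -> cdom c p -> cdom d p ->
  tchange c d p (v + w) = tchange c d p v + tchange c d p w.
Proof. by move=> cA dA cp dp; rewrite tchange_diff// linearD. Qed.

Lemma tchange_coord c p v : charts A c -> cdom c p ->
  tchange c (chart_at A p) p v = \sum_i v 0 i *: coord_field A c i p.
Proof.
move=> cA cp; have dA := chart_atP p; have dp := cdom_chart_at p.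
rewrite {1}(row_sum_delta v) tchange_sum//; apply: eq_bigr => i _.
by rewrite tchangeZ.
Qed.

(** The transition map between two charts of the tangent bundle. Its second
    component is the derivative of [trans c d] in the direction [rsubmx w], written
    with partial derivatives because they are visibly smooth. *)
Definition ttrans c d (w : 'rV[R]_(n + n)) : 'rV[R]_(n + n) :=
  row_mx (trans c d (lsubmx w))
    (\sum_j rsubmx w 0 j *: 'D_(delta_mx 0 j) (trans c d) (lsubmx w)).

Definition toverlap c d : set 'rV[R]_(n + n) := [set w | overlap c d (lsubmx w)].

Lemma open_toverlap c d : charts A c -> charts A d -> open (toverlap c d).
Proof.
move=> cA dA; apply: (@open_comp _ _ (lsubmx : 'rV[R]_(n + n) -> 'rV[R]_n)) => [w _|].
  exact: continuous_lsubmx.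
exact: open_overlap.
Qed.

Lemma smooth_ttrans c d : charts A c -> charts A d -> smooth_on (toverlap c d) (ttrans c d).
Proof.
move=> cA dA; have oT := open_toverlap cA dA; have oO := open_overlap cA dA.
have sid := @smooth_id_mx R 1 (n + n) (toverlap c d).
have sl : smooth_on (toverlap c d) (fun w => lsubmx w : 'rV[R]_n).
  exact: (smooth_mxlinear oT (@lsubmx R 1 n n)).
have sr : smooth_on (toverlap c d) (fun w => rsubmx w : 'rV[R]_n).
  exact: (smooth_mxlinear oT (@rsubmx R 1 n n)).
have sc f : smooth_on (overlap c d) f ->
    smooth_on (toverlap c d) (fun w : 'rV[R]_(n + n) => f (lsubmx w) : 'rV[R]_n).
  by move=> sf; exact: (smooth_comp oT oO _ sf sl).
apply: smooth_row_mx => //; first by apply: sc; exact: smooth_trans.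
apply: smooth_sum => // j; apply: smoothZ => //; first exact: smooth_coord.
exact: (sc ('D_(delta_mx 0 j) (trans c d)) (smooth_derive _ (smooth_trans cA dA))).
Qed.

Lemma tangent_cmap_change c d (z : TM) : charts A c -> charts A d -> cdom c z.1 -> cdom d z.1 ->
  cmap (tangent_chart d) z = ttrans c d (cmap (tangent_chart c) z).
Proof.
move=> cA dA cz dz; have aA := chart_atP z.1; have az := cdom_chart_at z.1.
rewrite /ttrans /= row_mxKl row_mxKr /trans /= (cinvK cA)//; congr row_mx.
rewrite -(@tchange_comp (chart_at A z.1) c d z.1 z.2)//.
rewrite {1}(row_sum_delta (tchange _ c _ _)) tchange_sum//.
by apply: eq_bigr => j _; rewrite tchangeZ.
Qed.

(** The expression of [psi] in the chart [c] is continuous, so that near [x] it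
    stays in the open set where the charts [c] and [d] overlap. There the
    expression in [d] is its composition with [ttrans c d]. *)
Lemma smooth_map_change (V : normedModType R) (psi : V -> TM) (W : set V) c d x :
  charts A c -> charts A d -> open W -> W x -> psi @` W `<=` cdom (tangent_chart c) ->
  smooth_on W (cmap (tangent_chart c) \o psi) -> cdom d (psi x).1 ->
  exists W' : set V, [/\ open W', W' x, W' `<=` W,
    psi @` W' `<=` cdom (tangent_chart d) &
    smooth_on W' (cmap (tangent_chart d) \o psi)].
Proof.
move=> cA dA oW Wx Wc sW dx.
pose f := cmap (tangent_chart c) \o psi.
have fE y : lsubmx (f y) = cmap c (psi y).1 by rewrite /f /= row_mxKl.
have Wcd y : W y -> cdom c (psi y).1 by move=> Wy; apply: (Wc (psi y)); exists y.
pose W' : set V := [set y | W y /\ toverlap c d (f y)].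
have oW' : open W'.
  apply: (open_preimage_on oW (open_toverlap cA dA)) => y Wy.
  exact: (smooth_continuous sW).
have W'd y : W' y -> cdom d (psi y).1.
  move=> [Wy]; rewrite /toverlap /= fE => /(overlapP _ _ cA)[_].
  by rewrite (cinvK cA)//; exact: Wcd.
exists W'; split; first exact: oW'.
- by split; [exact: Wx|rewrite /toverlap /= fE; apply: overlap_cmap; [exact: Wcd|exact: dx]].
- by move=> y [].
- by move=> _ [y Wy <-]; exact: W'd.
apply: (eq_smooth oW' (f := ttrans c d \o f)).
  move=> y W'y; rewrite /= -tangent_cmap_change//; last exact: W'd.
  by apply: Wcd; case: W'y.
apply: (smooth_comp oW' (open_toverlap cA dA)); first by move=> y [].
- exact: smooth_ttrans.
- by apply: smooth_subset sW => y [].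
Qed.

(** This is the chain rule. The chart in which [tangent_map] is computed is the
    preferred one at the point [psi x], and it varies with [x]; the right-hand
    side is based on a single chart [c]. *)
Lemma tangent_map_change (V : normedModType R) (psi : V -> TM) (W : set V) c x v :
  charts A c -> open W -> W x -> psi @` W `<=` cdom (tangent_chart c) ->
  smooth_on W (cmap (tangent_chart c) \o psi) ->
  let f := cmap (tangent_chart c) \o psi in
  let d := chart_at A (psi x).1 in
  tangent_map (tangent_atlas M) psi x v = 'D_('D_v f x) (ttrans c d) (f x).
Proof.
move=> cA oW Wx Wc sW f d.
have dA : charts A d by exact: chart_atP.
have dx : cdom d (psi x).1 by exact: cdom_chart_at.
have [W' [oW' W'x W'W W'd sW']] := smooth_map_change cA dA oW Wx Wc sW dx.
have cx : cdom c (psi x).1 by apply: (Wc (psi x)); exists x.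
rewrite -derive_compE; last 2 first.
- exact: smooth_differentiable sW Wx.
- apply: (smooth_differentiable (smooth_ttrans cA dA)).
  by rewrite /toverlap /= row_mxKl; exact: overlap_cmap.
apply: near_eq_derive; apply: (nbhs_eq_on oW' W'x) => y W'y.
rewrite /= -/d -tangent_cmap_change//.
  by apply: (Wc (psi y)); exists y => //; exact: W'W.
by apply: (W'd (psi y)); exists y.
Qed.

Lemma derive_ttrans c d (w v : 'rV[R]_(n + n)) : charts A c -> charts A d -> toverlap c d w ->
  'D_v (ttrans c d) w = row_mx ('D_(lsubmx v) (trans c d) (lsubmx w))
    ('D_(rsubmx v) (trans c d) (lsubmx w) +
     \sum_j rsubmx w 0 j *: 'D_(lsubmx v) ('D_(delta_mx 0 j) (trans c d)) (lsubmx w)).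
Proof.
move=> cA dA ow.
have st := smooth_trans cA dA.
have dt := smooth_differentiable st ow.
have dT := smooth_differentiable (smooth_ttrans cA dA) ow.
have dl : differentiable (lsubmx : 'rV[R]_(n + n) -> 'rV[R]_n) w by exact: differentiable_lsubmx.
have lin_l (F : 'rV[R]_n -> 'rV[R]_n) : 'D_v (fun y => F (lsubmx y)) w = 'D_(lsubmx v) F (lsubmx w).
  by apply: (derive_along F) => t; rewrite linearD linearZ.
have ddt j : differentiable (fun y : 'rV[R]_(n + n) => 'D_(delta_mx 0 j) (trans c d) (lsubmx y)) w.
  have dj := smooth_differentiable (smooth_derive (delta_mx 0 j) st) ow.
  exact: (@differentiable_comp _ _ _ _ lsubmx ('D_(delta_mx 0 j) (trans c d)) w dl dj).
have dr j : differentiable (fun y : 'rV[R]_(n + n) => rsubmx y 0 j : R^o) w.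
  by apply: (differentiable_mx_coord (f := rsubmx)); exact: differentiable_rsubmx.
have ds j : differentiable (fun y : 'rV[R]_(n + n) =>
    rsubmx y 0 j *: 'D_(delta_mx 0 j) (trans c d) (lsubmx y)) w.
  exact: differentiable_scalemx.
rewrite /ttrans derive_row_mx; last 2 first.
- exact: (@differentiable_comp _ _ _ _ lsubmx (trans c d) w dl dt).
- exact: differentiable_bigsum.
rewrite lin_l; congr row_mx; rewrite derive_bigsum//.
rewrite [X in _ = X + _]derive_rV_delta// -big_split /=; apply: eq_bigr => j _.
rewrite (derive_scalemx v (dr j) (ddt j)) (lin_l ('D_(delta_mx 0 j) (trans c d))).
apply: (congr1 (fun t : R => t *: 'D_(delta_mx 0 j) (trans c d) (lsubmx w) + _)).
transitivity ('D_(rsubmx v) (fun y : 'rV[R]_n => y 0 j : R^o) (rsubmx w)).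
  by apply: (derive_along (fun y : 'rV[R]_n => y 0 j : R^o)) => t; rewrite linearD linearZ.
by rewrite -(derive_mxE (f := id)) ?derive_id//.
Qed.

Variables (g : M -> 'rV[R]_n -> 'rV[R]_n -> R).
Variable nabla : M -> 'rV[R]_n -> (M -> 'rV[R]_n) -> 'rV[R]_n.
Hypothesis gR : is_riemannian A g.
Hypothesis nablaC : is_affine_connection A nabla.

Lemma smooth_coord_field c i p : charts A c -> cdom c p ->
  smooth_field_at A p (coord_field A c i).
Proof.
move=> cA cp; have dA := chart_atP p; have dp := cdom_chart_at p.
set d := chart_at A p in dA dp.
have oO := open_overlap dA cA.
exists (overlap d c); split=> //.
- exact: overlap_cmap.
- by move=> x /(overlapP _ _ dA)[].
apply: (eq_smooth oO (f := 'D_(delta_mx 0 i) (trans c d) \o trans d c)).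
  move=> _ [q [dq cq] <-]; rewrite /field_in /coord_field /trans /= (cinvK dA dq).
  by rewrite (tchange_comp _ cA (chart_atP q) dA cq (cdom_chart_at q) dq).
apply: (smooth_comp oO (open_overlap cA dA)).
- by move=> x; exact: trans_overlap.
- by apply: smooth_derive; exact: smooth_trans.
- exact: smooth_trans.
Qed.

Lemma smooth_fieldZ p (f : M -> R) Y : smooth_fun_at A p f -> smooth_field_at A p Y ->
  smooth_field_at A p (fun q => f q *: Y q).
Proof.
move=> [W1 [oW1 W1p W1c sf]] [W2 [oW2 W2p W2c sY]].
have cA := chart_atP p.
exists (W1 `&` W2); split; [exact: openI|exact: conj W1p W2p|by move=> x [/W1c]|].
have oW : open (W1 `&` W2) by exact: openI.
have s1 : smooth_on (W1 `&` W2) (f \o cinv (chart_at A p) : 'rV[R]_n -> R^o).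
  by apply: smooth_subset sf => x [].
have s2 : smooth_on (W1 `&` W2) (field_in A (chart_at A p) Y).
  by apply: smooth_subset sY => x [].
apply: (eq_smooth oW _ (smoothZ oW s1 s2)) => x [/W1c cx _].
rewrite /field_in /= tchangeZ//; first exact: chart_atP.
  exact: cdom_chart_at.
exact: cdom_cinv.
Qed.

Lemma smooth_fieldD p Y Y' : smooth_field_at A p Y -> smooth_field_at A p Y' ->
  smooth_field_at A p (fun q => Y q + Y' q).
Proof.
move=> [W1 [oW1 W1p W1c sf]] [W2 [oW2 W2p W2c sY]].
have cA := chart_atP p.
exists (W1 `&` W2); split; [exact: openI|exact: conj W1p W2p|by move=> x [/W1c]|].
have oW : open (W1 `&` W2) by exact: openI.
have s1 : smooth_on (W1 `&` W2) (field_in A (chart_at A p) Y).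
  by apply: smooth_subset sf => x [].
have s2 : smooth_on (W1 `&` W2) (field_in A (chart_at A p) Y').
  by apply: smooth_subset sY => x [].
apply: (eq_smooth oW _ (smoothD oW s1 s2)) => x [/W1c cx _].
rewrite /field_in /= tchangeD//; first exact: chart_atP.
  exact: cdom_chart_at.
exact: cdom_cinv.
Qed.

Lemma smooth_fun_cst p (a : R) : smooth_fun_at A p (fun=> a).
Proof.
have cA := chart_atP p; have [_ oc _ _ _] := mchart cA.
exists (cimg (chart_at A p)); split=> //; first by exists p => //; exact: cdom_chart_at.
exact: smooth_cst.
Qed.

Lemma smooth_field0 p : smooth_field_at A p (fun=> 0).
Proof.
have cA := chart_atP p; have [_ oc _ _ _] := mchart cA.
exists (cimg (chart_at A p)); split=> //; first by exists p => //; exact: cdom_chart_at.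
apply: (eq_smooth oc (f := cst 0)); last exact: smooth_cst.
by move=> x _; rewrite /field_in /tchange derive0.
Qed.

Lemma dir_deriv_cst p X (a : R) : dir_deriv A p X (fun=> a) = 0.
Proof. exact: derive_cst. Qed.

Local Opaque smooth_field_at.

(** The Leibniz rule for the zero function and the zero field. *)
Lemma conn0 p X : nabla p X (fun=> 0) = 0.
Proof.
have E := conn_leibniz nablaC X (smooth_fun_cst p 0) (smooth_field0 p).
rewrite dir_deriv_cst !scale0r addr0 in E; rewrite -[RHS]E; congr (nabla p X _).
Qed.

Lemma conn_sum p X (I : Type) (r : seq I) (F : I -> M -> 'rV[R]_n) :
  (forall i, smooth_field_at A p (F i)) ->
  nabla p X (fun q => \sum_(i <- r) F i q) = \sum_(i <- r) nabla p X (F i).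
Proof.
move=> sF; elim: r => [|i r IH].
  rewrite big_nil -[RHS](conn0 p X); congr (nabla p X _).
  by apply/funext => q; rewrite big_nil.
have sr : smooth_field_at A p (fun q => \sum_(i <- r) F i q).
  elim: r {IH} => [|j r IH].
    rewrite (_ : (fun q => _) = fun=> 0); first exact: smooth_field0.
    by apply/funext => q; rewrite big_nil.
  rewrite (_ : (fun q => _) = fun q => F j q + \sum_(i <- r) F i q).
    exact: (smooth_fieldD (sF j) IH).
  by apply/funext => q; rewrite big_cons.
rewrite big_cons -IH -(conn_add nablaC X (sF i) sr); congr (nabla p X _).
by apply/funext => q; rewrite big_cons.
Qed.

(** The products of the two fields with the indicator function of [N] coincide, and
    this function is constant near [p]; apply the Leibniz rule. *)
Lemma conn_local p X Y Y' (N : set M) : open N -> N p ->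
  smooth_field_at A p Y -> smooth_field_at A p Y' -> (forall q, N q -> Y q = Y' q) ->
  nabla p X Y = nabla p X Y'.
Proof.
move=> oN Np sY sY' YY'.
have cA := chart_atP p; have cp := cdom_chart_at p.
set c := chart_at A p in cA cp; have [_ oc _ _ cc] := mchart cA.
pose f (q : M) : R := \1_N q.
pose W : set 'rV[R]_n := [set x | cimg c x /\ N (cinv c x)].
have oW : open W.
  rewrite openE => x [cx Nx]; rewrite /interior.
  have N1 : \forall y \near x, cimg c y by exact: open_nbhs_nbhs.
  have N2 : \forall y \near x, N (cinv c y) by apply: (cc x cx); exact: open_nbhs_nbhs.
  by apply: filterS2 N1 N2 => y.
have Wp : W (cmap c p) by split; [exists p|rewrite (cinvK cA)].
have f1 x : W x -> 1 = f (cinv c x).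
  by move=> [_ Nx]; rewrite /f indicE mem_set.
have sf : smooth_fun_at A p f.
  exists W; split=> //; first by move=> x [].
  by apply: (eq_smooth oW (f := cst (1 : R^o))) => //; exact: smooth_cst.
have df : dir_deriv A p X f = 0.
  rewrite -(dir_deriv_cst p X 1); apply: near_eq_derive.
  by apply: (nbhs_eq_on oW Wp) => x /f1.
have fp : f p = 1 by rewrite /f indicE mem_set.
have E Z : smooth_field_at A p Z -> nabla p X (fun q => f q *: Z q) = nabla p X Z.
  by move=> sZ; rewrite (conn_leibniz nablaC)// df fp scale0r add0r scale1r.
rewrite -E// -[RHS]E//; congr (nabla p X _); apply/funext => q.
have [Nq|Nq] := pselect (N q); first by rewrite YY'.
by rewrite /f indicE memNset// !scale0r.
Qed.

(** The transformation law of the Christoffel symbols. Near [p] the field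
    [coord_field A c j] is a combination of the coordinate fields of the chart [d],
    with the entries of the Jacobian matrix of [trans c d] as coefficients, so that
    it follows from the Leibniz rule. *)
Lemma christoffel_change c p a j : charts A c -> cdom c p ->
  let d := chart_at A p in
  let X := tchange c d p a in
  nabla p X (coord_field A c j) =
    'D_a ('D_(delta_mx 0 j) (trans c d)) (cmap c p) +
    \sum_k (tchange c d p (delta_mx 0 j)) 0 k *: nabla p X (coord_field A d k).
Proof.
move=> cA cp d X; have dA : charts A d by exact: chart_atP.
have dp : cdom d p by exact: cdom_chart_at.
pose f k (q : M) : R := (tchange c d q (delta_mx 0 j)) 0 k.
have oO := open_overlap dA cA; have oO' := open_overlap cA dA.
pose F : 'rV[R]_n -> 'rV[R]_n := 'D_(delta_mx 0 j) (trans c d) \o trans d c.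
have sF : smooth_on (overlap d c) F.
  apply: (smooth_comp oO oO') => [x||]; first exact: trans_overlap.
    by apply: smooth_derive; exact: smooth_trans.
  exact: smooth_trans.
have fE k x : overlap d c x -> F x 0 k = f k (cinv d x).
  by move=> [q [dq cq] <-]; rewrite /F /f /tchange /trans /= (cinvK dA).
have Op : overlap d c (cmap d p) by exact: overlap_cmap.
have sf k : smooth_fun_at A p (f k).
  exists (overlap d c); split=> //; first by move=> x /(overlapP _ _ dA)[].
  apply: (eq_smooth oO (f := fun x => F x 0 k : R^o)) => [x /fE //|].
  exact: smooth_coord.
have sd k := smooth_coord_field k dA dp.
have [oc _ _ _ _] := mchart cA; have [od _ _ _ _] := mchart dA.
have loc : forall q, (cdom c `&` cdom d) q ->
    coord_field A c j q = \sum_k f k q *: coord_field A d k q.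
  move=> q [cq dq]; rewrite /f -(tchange_coord _ dA dq).
  by rewrite (tchange_comp _ cA dA (chart_atP q) cq dq (cdom_chart_at q)).
have sfd k : smooth_field_at A p (fun q => f k q *: coord_field A d k q).
  exact: smooth_fieldZ.
have ssum : smooth_field_at A p (fun q => \sum_k f k q *: coord_field A d k q).
  elim: (index_enum 'I_n) => [|k r IH].
    rewrite (_ : (fun q => _) = fun=> 0); first exact: smooth_field0.
    by apply/funext => q; rewrite big_nil.
  rewrite (_ : (fun q => _) = fun q => f k q *: coord_field A d k q +
     \sum_(i <- r) f i q *: coord_field A d i q).
    exact: (smooth_fieldD (sfd k) IH).
  by apply/funext => q; rewrite big_cons.
rewrite (conn_local X (openI oc od) (conj cp dp) (smooth_coord_field j cA cp) ssum loc).
rewrite (conn_sum X _ sfd) [X in _ = X + _]row_sum_delta -big_split /=.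
apply: eq_bigr => k _; rewrite (conn_leibniz nablaC X (sf k) (sd k)).
congr (_ *: _ + _); last first.
  by rewrite /coord_field tchange_id.
have dF := smooth_differentiable sF Op.
have -> : dir_deriv A p X (f k) = ('D_X F (cmap d p)) 0 k.
  rewrite (derive_mxE _ _ _ dF); apply/esym; apply: near_eq_derive.
  by apply: (nbhs_eq_on oO Op) => x /fE.
have Ep : trans d c (cmap d p) = cmap c p by rewrite /trans /= (cinvK dA).
rewrite /F derive_compE; last 2 first.
- exact: trans_differentiable.
- rewrite Ep; apply: (smooth_differentiable (smooth_derive _ (smooth_trans cA dA))).
  exact: overlap_cmap.
have -> : 'D_X (trans d c) (cmap d p) = a.
  exact: (tchangeK a cA dA cp dp).
by rewrite Ep.
Qed.

Definition metric_in c (x : 'rV[R]_n) : 'M[R]_n := \matrix_(i, j)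
  g (cinv c x) (coord_field A c i (cinv c x)) (coord_field A c j (cinv c x)).

Definition christoffel_in c (i j : 'I_n) (x : 'rV[R]_n) : 'rV[R]_n :=
  field_in A c (fun q => nabla q (coord_field A c i q) (coord_field A c j)) x.

Definition sasaki_in c := sasaki_form (metric_in c) (christoffel_in c).

Lemma metric_sumr p (I : Type) (r : seq I) (a : I -> R) (F : I -> 'rV[R]_n) Y :
  g p (\sum_(i <- r) a i *: F i) Y = \sum_(i <- r) a i * g p (F i) Y.
Proof.
elim: r => [|i r IH]; last by rewrite !big_cons (metric_linear gR) IH.
rewrite !big_nil; have := metric_linear gR p 1 0 0 Y.
by rewrite scale1r addr0 mul1r => /eqP; rewrite -subr_eq0 opprD addNKr oppr_eq0 => /eqP.
Qed.

Lemma metric_tchange c p u v : charts A c -> cdom c p ->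
  g p (tchange c (chart_at A p) p u) (tchange c (chart_at A p) p v) =
  bilin (metric_in c (cmap c p)) u v.
Proof.
move=> cA cp; rewrite !tchange_coord// metric_sumr bilinE; apply: eq_bigr => i _.
rewrite (Defs.metric_sym gR) metric_sumr big_distrr /=; apply: eq_bigr => j _.
have -> : metric_in c (cmap c p) i j = g p (coord_field A c i p) (coord_field A c j p).
  by rewrite /metric_in mxE (cinvK cA cp).
have e := Defs.metric_sym gR p (coord_field A c j p) (coord_field A c i p).
apply: (etrans (congr1 (fun t => u 0 i * (v 0 j * t)) e)).
by move: (g p _ _) => t; ring.
Qed.

Lemma tchange_christoffel c p i j : charts A c -> cdom c p ->
  tchange c (chart_at A p) p (christoffel_in c i j (cmap c p)) =
  nabla p (coord_field A c i p) (coord_field A c j).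
Proof.
move=> cA cp; rewrite /christoffel_in /field_in (cinvK cA)// tchangeK//.
  exact: chart_atP.
exact: cdom_chart_at.
Qed.

Lemma conn_sumr p (I : Type) (r : seq I) (a : I -> R) (F : I -> 'rV[R]_n) Y :
  smooth_field_at A p Y ->
  nabla p (\sum_(i <- r) a i *: F i) Y = \sum_(i <- r) a i *: nabla p (F i) Y.
Proof.
move=> sY; elim: r => [|i r IH]; last by rewrite !big_cons (conn_linear nablaC)// IH.
rewrite !big_nil; have := conn_linear nablaC 1 0 0 sY.
rewrite scale1r addr0 scale1r => /eqP; rewrite -subr_eq0 opprD addNKr oppr_eq0.
by move=> /eqP.
Qed.

Variable G : TM -> 'rV[R]_(n + n) -> 'rV[R]_(n + n) -> R.
Hypothesis GS : is_sasakian g nabla G.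

Lemma vertical_liftE (z : TM) X : vertical_lift z X = row_mx 0 X.
Proof.
have cA := chart_atP z.1; have cz := cdom_chart_at z.1.
rewrite /vertical_lift /velocity.
have E : (cmap (tangent_chart (chart_at A z.1)) \o (fun t : R => (z.1, z.2 + t *: X) : TM)) =
  (fun t : R^o => row_mx (cmap (chart_at A z.1) z.1) z.2 + t *: row_mx 0 X).
  apply/funext => t /=; rewrite tchange_id// scale_row_mx scaler0.
  by rewrite add_row_mx addr0.
have D : 'D_1 (fun t : R^o => row_mx (cmap (chart_at A z.1) z.1) z.2 + t *: row_mx 0 X)
    (0 : R^o) = row_mx 0 X.
  apply: derive_affine => t; rewrite scale0r !addr0; congr (_ + _ *: _).
  exact: mulr1.
by rewrite -{}D -E.
Qed.

(** In the chart at the base point the equation of a parallel field expresses the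
    derivative of its components by the Christoffel symbols. *)
Lemma horizontal_liftE (z : TM) X w : is_horizontal_lift nabla z X w ->
  w = row_mx X (- \sum_j z.2 0 j *: nabla z.1 X (coord_field A (chart_at A z.1) j)).
Proof.
move=> [e [zeta [e0 H z0 vX wE]]].
have [|[W [oW W0 Wc sW]] _ cov] := H 0; first by rewrite normr0.
set c := chart_at A z.1; have cA : charts A c := chart_atP z.1.
have cE : chart_at A (zeta 0).1 = c by rewrite z0.
move: Wc sW; rewrite /= cE => Wc sW.
pose f : R^o -> 'rV[R]_(n + n) := cmap (tangent_chart c) \o zeta.
have df : differentiable f (0 : R^o) by exact: smooth_differentiable sW W0.
have wf : w = 'D_1 f (0 : R^o).
  by rewrite /f -cE; exact: wE.
have dl : X = lsubmx w.
  rewrite wf -(derive_lsubmx _ df) -vX /velocity /tangent_map cE.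
  apply: (congr1 (fun F : R^o -> _ => 'D_1 F (0 : R^o))).
  by apply/funext => s; rewrite /f /= row_mxKl.
have dr : - \sum_j z.2 0 j *: nabla z.1 X (coord_field A c j) = rsubmx w.
  rewrite wf -(derive_rsubmx _ df); apply/eqP; rewrite eq_sym -addr_eq0; apply/eqP.
  rewrite -[RHS]cov /cov_along cE vX z0.
  apply: (congr1 (fun t => t + _)).
  apply: (congr1 (fun F : R^o -> _ => 'D_1 F (0 : R^o))).
  by apply/funext => s; rewrite /f /= row_mxKr.
by rewrite dr {1}dl hsubmxK.
Qed.

(** A tangent vector of [TM] splits as the horizontal lift of its first component
    plus the vertical lift of [vert], by the formulas for the two lifts. *)
Lemma sasaki_chart_at (z : TM) (v v' : 'rV[R]_(n + n)) :
  let vert u := rsubmx u + \sum_j z.2 0 j *: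
     nabla z.1 (lsubmx u) (coord_field A (chart_at A z.1) j) in
  G z v v' = g z.1 (lsubmx v) (lsubmx v') + g z.1 (vert v) (vert v').
Proof.
move=> vert; have [GR [H Hlift HG]] := GS.
have E u : u = 1 *: H z (lsubmx u) + vertical_lift z (vert u).
  rewrite vertical_liftE (horizontal_liftE (Hlift _ _)) scale1r add_row_mx addr0.
  by rewrite /vert addrCA addNr addr0 hsubmxK.
have [_ h1 _] := HG z (lsubmx v) (lsubmx v').
have [h2 _ _] := HG z (vert v) (vert v').
have [_ _ h3] := HG z (vert v) (lsubmx v').
have [_ _ h4] := HG z (vert v') (lsubmx v).
have bil a b a' b' : G z (1 *: a + b) (1 *: a' + b') =
    G z a a' + G z b b' + G z b a' + G z b' a.
  rewrite (metric_linear GR) (Defs.metric_sym GR z a) (Defs.metric_sym GR z b).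
  rewrite (metric_linear GR z 1 a' b' a) (metric_linear GR z 1 a' b' b) !mul1r.
  rewrite (Defs.metric_sym GR z a' a) (Defs.metric_sym GR z b' b) (Defs.metric_sym GR z a' b).
  by move: (G z a a') (G z b' a) (G z b a') (G z b b') => *; ring.
apply: etrans (congr2 (G z) (E v) (E v')) _.
have comb (t1 t2 t3 t4 s1 s2 : R) : t1 = s1 -> t2 = s2 -> t3 = 0 -> t4 = 0 ->
    t1 + t2 + t3 + t4 = s1 + s2 by move=> -> -> -> ->; rewrite !addr0.
exact: etrans (bil _ _ _ _) (comb _ _ _ _ _ _ h1 h2 h3 h4).
Qed.

(** In the preferred chart at [psi x] this is [sasaki_chart_at]. On passing to the
    chart [c] the second derivatives of the transition map in [derive_ttrans] are
    those in the transformation law of the Christoffel symbols, and they cancel. *)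
Theorem sasaki_pullback (V : normedModType R) (psi : V -> TM) (W : set V) c x v v' :
  charts A c -> open W -> W x -> psi @` W `<=` cdom (tangent_chart c) ->
  smooth_on W (cmap (tangent_chart c) \o psi) ->
  let f := cmap (tangent_chart c) \o psi in
  G (psi x) (tangent_map (tangent_atlas M) psi x v) (tangent_map (tangent_atlas M) psi x v') =
  sasaki_in c (f x) ('D_v f x) ('D_v' f x).
Proof.
move=> cA oW Wx Wc sW f.
rewrite !(tangent_map_change _ cA oW Wx Wc sW) -/f sasaki_chart_at.
set q := (psi x).1; set d := chart_at A q; set xi := (psi x).2.
have dA : charts A d := chart_atP q; have dq : cdom d q := cdom_chart_at q.
have cq : cdom c q by apply: (Wc (psi x)); exists x.
have fl : lsubmx (f x) = cmap c q by rewrite /f /= row_mxKl.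
have fr : rsubmx (f x) = tchange d c q xi by rewrite /f /= row_mxKr.
have ov : toverlap c d (f x) by rewrite /toverlap /= fl; exact: overlap_cmap.
set y := rsubmx (f x).
have key u : rsubmx ('D_u (ttrans c d) (f x)) +
    \sum_j xi 0 j *: nabla q (lsubmx ('D_u (ttrans c d) (f x))) (coord_field A d j) =
    tchange c d q (rsubmx u + conn_form (christoffel_in c) (cmap c q) (lsubmx u) y).
  rewrite derive_ttrans// row_mxKl row_mxKr fl -/y.
  rewrite tchangeD//; rewrite -addrA; congr (_ + _).
  set X := 'D_(lsubmx u) (trans c d) (cmap c q).
  have -> : xi = tchange c d q y by rewrite /y fr tchangeK.
  have yk k : (tchange c d q y) 0 k = \sum_j y 0 j * (tchange c d q (delta_mx 0 j)) 0 k.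
    rewrite {1}(row_sum_delta y) tchange_sum// summxE; apply: eq_bigr => j _.
    by rewrite tchangeZ// mxE.
  have -> : \sum_k (tchange c d q y) 0 k *: nabla q X (coord_field A d k) =
     \sum_j y 0 j *: \sum_k (tchange c d q (delta_mx 0 j)) 0 k *: nabla q X (coord_field A d k).
    have E k := etrans (congr1 (fun t : R => t *: nabla q X (coord_field A d k)) (yk k))
      (scaler_suml _ _ _ _).
    apply: (etrans (eq_bigr _ (fun k _ => E k))); rewrite exchange_big /=.
    apply: eq_bigr => j _; rewrite scaler_sumr.
    by apply: eq_bigr => k _; rewrite scalerA.
  rewrite -big_split /=.
  transitivity (\sum_j y 0 j *: nabla q X (coord_field A c j)).
    apply: eq_bigr => j _; rewrite -scalerDr; congr (_ *: _).
    by rewrite (christoffel_change (lsubmx u) j cA cq).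
  rewrite /conn_form tchange_sum//.
  under [RHS]eq_bigr do rewrite tchange_sum//.
  rewrite exchange_big /=; apply: eq_bigr => j _.
  have -> : X = \sum_i (lsubmx u) 0 i *: coord_field A c i q.
    by rewrite -tchange_coord.
  rewrite conn_sumr; last exact: smooth_coord_field.
  rewrite scaler_sumr; apply: eq_bigr => i _.
  by rewrite tchangeZ// tchange_christoffel// scalerA mulrC.
have keyl u : lsubmx ('D_u (ttrans c d) (f x)) = tchange c d q (lsubmx u).
  by rewrite derive_ttrans// row_mxKl fl.
apply: etrans (congr2 +%R (congr2 (g q) (keyl ('D_v f x)) (keyl ('D_v' f x)))
  (congr2 (g q) (key ('D_v f x)) (key ('D_v' f x)))) _.
by rewrite (metric_tchange _ _ cA cq) (metric_tchange _ _ cA cq) /sasaki_in /sasaki_form fl.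
Qed.

End Transition.

(** * The blow-up of the sphere bundle along a fibre *)

Section BilinearForms.
Context {R : realType} {n : nat}.
Implicit Types (B : 'M[R]_n) (u v w : 'rV[R]_n).

Lemma bilinDl B u v w : bilin B (u + v) w = bilin B u w + bilin B v w.
Proof. by rewrite /bilin !mulmxDl mxE. Qed.

Lemma bilinDr B u v w : bilin B w (u + v) = bilin B w u + bilin B w v.
Proof. by rewrite /bilin linearD mulmxDr mxE. Qed.

Lemma bilinZl B a u v : bilin B (a *: u) v = a * bilin B u v.
Proof. by rewrite /bilin -!scalemxAl mxE. Qed.

Lemma bilinZr B a u v : bilin B u (a *: v) = a * bilin B u v.
Proof. by rewrite /bilin linearZ -scalemxAr mxE. Qed.

Lemma bilin0l B v : bilin B 0 v = 0.
Proof. by rewrite /bilin !mul0mx mxE. Qed.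

Lemma bilin_suml B (I : Type) (r : seq I) (F : I -> 'rV[R]_n) v :
  bilin B (\sum_(i <- r) F i) v = \sum_(i <- r) bilin B (F i) v.
Proof.
elim: r => [|i r IH]; first by rewrite !big_nil bilin0l.
by rewrite !big_cons bilinDl IH.
Qed.

Lemma bilin_sym B u v : B^T = B -> bilin B u v = bilin B v u.
Proof.
move=> BT; rewrite /bilin; transitivity ((u *m B *m v^T)^T 0 0); first by rewrite [RHS]mxE.
by rewrite !trmx_mul trmxK BT mulmxA.
Qed.

Lemma bilin_delta_mul m B (J : 'M[R]_(m, n)) i j :
  bilin B (delta_mx 0 i *m J) (delta_mx 0 j *m J) = (J *m B *m J^T) i j.
Proof.
rewrite /bilin trmx_mul trmx_delta !mulmxA -colE mxE -!mulmxA -rowE mxE.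
by rewrite !mulmxA.
Qed.

Lemma smooth_bilin (V : normedModType R) (U : set V) (B : V -> 'M[R]_n) (u v : V -> 'rV[R]_n) :
  open U -> smooth_on U B -> smooth_on U u -> smooth_on U v ->
  smooth_on U (fun y => bilin (B y) (u y) (v y) : R^o).
Proof.
move=> oU sB su sv; apply: smooth_coord => //.
apply: smooth_mulmx => //; first exact: smooth_mulmx.
exact: (smooth_mxlinear oU (@trmx R 1 n)).
Qed.

Lemma unitmx_inj (J : 'M[R]_n) : (forall v : 'rV[R]_n, v *m J = 0 -> v = 0) -> J \in unitmx.
Proof.
move=> J0; rewrite -row_free_unit -kermx_eq0; apply/eqP/row_matrixP => i.
by rewrite row0; apply: J0; apply/sub_kermxP; exact: row_sub.
Qed.

Lemma posdef_unitmx (B : 'M[R]_n) : (forall v, v != 0 -> 0 < bilin B v v) -> B \in unitmx.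
Proof.
move=> Bpos; apply: unitmx_inj => v vB; apply/eqP; apply/negPn/negP => /Bpos.
by rewrite /bilin vB mul0mx mxE ltxx.
Qed.

End BilinearForms.

(** The rows of [F] are a basis of the orthogonal complement of [eta], which is the
    kernel of [B *m eta^T]. *)
Lemma orthogonal_frame {R : realType} n' (B : 'M[R]_n'.+1) (eta : 'rV[R]_n'.+1) :
  B^T = B -> bilin B eta eta = 1 ->
  exists F : 'M[R]_(n', n'.+1),
    (forall u, bilin B eta (u *m F) = 0) /\ (col_mx eta F : 'M[R]_(1 + n')) \in unitmx.
Proof.
move=> BT B1.
have Be0 : B *m eta^T != 0.
  apply/eqP => h; move: B1; rewrite /bilin -mulmxA h mulmx0 mxE => /eqP.
  by rewrite eq_sym oner_eq0.
have rk1 : \rank (B *m eta^T) = 1%N.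
  apply/eqP; rewrite eqn_leq rank_leq_col lt0n mxrank_eq0; exact: Be0.
have rk : \rank (kermx (B *m eta^T)) = n' by rewrite mxrank_ker rk1 subn1.
pose F := castmx (rk, erefl n'.+1) (row_base (kermx (B *m eta^T))).
have FB : F *m (B *m eta^T) = 0.
  by apply/sub_kermxP; rewrite /F eqmx_cast eq_row_base.
have Ff : row_free F.
  by rewrite /row_free /F eqmx_cast; apply/eqP; rewrite eq_row_base.
have orth u : bilin B eta (u *m F) = 0.
  by rewrite bilin_sym// /bilin -!mulmxA FB mulmx0 mxE.
exists F; split=> //; apply: unitmx_inj => v.
rewrite -[v](@hsubmxK R 1 1 n') mul_row_col => h.
have l0 : lsubmx v = 0 :> 'rV[R]_1.
  have := congr1 (bilin B eta) h; rewrite bilinDr orth addr0.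
  rewrite [lsubmx v]mx11_scalar mul_scalar_mx bilinZr B1 mulr1 => ->.
  by rewrite bilin_sym// bilin0l; apply/matrixP => i j; rewrite !mxE mul0rn.
rewrite l0 mul0mx add0r in h.
have r0 : rsubmx v = 0 :> 'rV[R]_n' by apply: (row_free_inj Ff); rewrite h mul0mx.
by rewrite l0 r0 row_mx0.
Qed.

Section Core.
Context {R : realType} {n' : nat}.
Local Notation N := n'.+1.
Variables (W0 : set 'rV[R]_N) (h : 'rV[R]_N -> 'M[R]_N).
Variable Gam : 'I_N -> 'I_N -> 'rV[R]_N -> 'rV[R]_N.
Hypotheses (oW0 : open W0) (sh : smooth_on W0 h).
Hypothesis sGam : forall i j, smooth_on W0 (Gam i j).
Hypothesis hT : forall x, W0 x -> (h x)^T = h x.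
Hypothesis hpos : forall x, W0 x -> forall v, v != 0 -> 0 < bilin (h x) v v.
Variables (x0 eta0 : 'rV[R]_N) (B : 'M[R]_(n', N)).
Hypotheses (W0x0 : W0 x0) (eta01 : bilin (h x0) eta0 eta0 = 1).
Hypothesis orthB : forall u, bilin (h x0) eta0 (u *m B) = 0.
Hypothesis frame_unit : (col_mx eta0 B : 'M[R]_(1 + n')) \in unitmx.

(** A point [om] of this space is [(x, r, u, s)]. The base point [x] and the radius
    [r] are parameters and [(u, s)] are the coordinates of the point of the sphere
    bundle of radius [r] over [x + r s] in the direction of [eta0 + u B]. In these
    coordinates distances in the base and in the fibre are both of order [r]. *)
Definition base_point (om : 'rV[R]_(N + 1 + (n' + N))) : 'rV[R]_N := lsubmx (lsubmx om).
Definition radius (om : 'rV[R]_(N + 1 + (n' + N))) : R := rsubmx (lsubmx om) 0 0.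
Definition fibre_part (w : 'rV[R]_(n' + N)) : 'rV[R]_n' := lsubmx w.
Definition base_part (w : 'rV[R]_(n' + N)) : 'rV[R]_N := rsubmx w.

Definition position om : 'rV[R]_N := base_point om + radius om *: base_part (rsubmx om).
Definition direction (om : 'rV[R]_(N + 1 + (n' + N))) : 'rV[R]_N :=
  eta0 + fibre_part (rsubmx om) *m B.
Definition dir_norm om : R := Num.sqrt (bilin (h (position om)) (direction om) (direction om)).
Definition unit_dir om : 'rV[R]_N := (dir_norm om)^-1 *: direction om.

Definition blowup_dom : set 'rV[R]_(N + 1 + (n' + N)) := [set om | W0 (position om)].

Definition coord_dir (i : 'I_(n' + N)) : 'rV[R]_(N + 1 + (n' + N)) := row_mx 0 (delta_mx 0 i).

(** The covariant derivative of the unit vector [unit_dir] in the [i]-th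
    coordinate direction. *)
Definition cov_dir i om : 'rV[R]_N :=
  'D_(coord_dir i) unit_dir om +
  radius om *: conn_form Gam (position om) (base_part (delta_mx 0 i)) (unit_dir om).

(** The metric of the sphere bundle of radius [r] in the coordinates [(u, s)],
    divided by [r^2]. It is smooth also at [r = 0], where the sphere bundle itself
    has shrunk to the zero section. *)
Definition blowup om : 'M[R]_(n' + N) := \matrix_(i, j)
  (bilin (h (position om)) (base_part (delta_mx 0 i)) (base_part (delta_mx 0 j)) +
   bilin (h (position om)) (cov_dir i om) (cov_dir j om)).

(** The frame is a basis and [eta0] enters with the coefficient 1. *)
Lemma direction_neq0 om : direction om != 0.
Proof.
apply/eqP => d0; pose v : 'rV[R]_(1 + n') := row_mx 1%:M (fibre_part (rsubmx om)).
have : v *m (col_mx eta0 B : 'M[R]_(1 + n')) = 0.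
  by rewrite mul_row_col mul1mx.
move/(congr1 (mulmx^~ (invmx (col_mx eta0 B : 'M[R]_(1 + n'))))).
rewrite mulmxK// mul0mx => /(congr1 (fun t : 'rV[R]_(1 + n') => lsubmx t 0 0)).
by rewrite /v row_mxKl !mxE eqxx => /eqP; rewrite oner_eq0.
Qed.

Section SmoothPieces.
Variable U : set 'rV[R]_(N + 1 + (n' + N)).
Hypothesis oU : open U.

Lemma smooth_base : smooth_on U base_point.
Proof.
apply: (smooth_mxlinear oU (@lsubmx R 1 N 1)).
exact: (smooth_mxlinear oU (@lsubmx R 1 (N + 1) (n' + N)) (smooth_id_mx _)).
Qed.

Lemma smooth_rad : smooth_on U (radius : _ -> R^o).
Proof.
apply: smooth_coord => //; apply: (smooth_mxlinear oU (@rsubmx R 1 N 1)).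
exact: (smooth_mxlinear oU (@lsubmx R 1 (N + 1) (n' + N)) (smooth_id_mx _)).
Qed.

Lemma smooth_pos : smooth_on U position.
Proof.
apply: smoothD => //; first exact: smooth_base.
apply: smoothZ => //; first exact: smooth_rad.
apply: (smooth_mxlinear oU (@rsubmx R 1 n' N)).
exact: (smooth_mxlinear oU (@rsubmx R 1 (N + 1) (n' + N)) (smooth_id_mx _)).
Qed.

Lemma smooth_direction : smooth_on U direction.
Proof.
apply: smoothD => //; first exact: smooth_cst.
apply: smooth_mulmx => //; last exact: smooth_cst.
apply: (smooth_mxlinear oU (@lsubmx R 1 n' N)).
exact: (smooth_mxlinear oU (@rsubmx R 1 (N + 1) (n' + N)) (smooth_id_mx _)).
Qed.
End SmoothPieces.

Lemma open_dom : open blowup_dom.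
Proof.
apply: (@open_comp _ _ position W0) => // om _.
by apply: (smooth_continuous (smooth_pos openT)).
Qed.

Lemma smooth_on_pos k l (F : 'rV[R]_N -> 'M[R]_(k, l)) : smooth_on W0 F ->
  smooth_on blowup_dom (fun om => F (position om)).
Proof. by move=> sF; exact: (smooth_comp open_dom oW0 _ sF (smooth_pos open_dom)). Qed.

Lemma sqlen_gt0 om : blowup_dom om -> 0 < bilin (h (position om)) (direction om) (direction om).
Proof. by move=> dm; apply: hpos => //; exact: direction_neq0. Qed.

Lemma smooth_unit_dir : smooth_on blowup_dom unit_dir.
Proof.
have oD := open_dom; have sd := smooth_direction oD.
apply: smoothZ => //; apply: smoothV => //.
  by move=> om dm; rewrite gt_eqF// sqrtr_gt0 sqlen_gt0.
apply: smooth_sqrt => //; first by move=> om; exact: sqlen_gt0.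
by apply: smooth_bilin => //; exact: smooth_on_pos.
Qed.

Lemma smooth_cov_dir i : smooth_on blowup_dom (cov_dir i).
Proof.
have oD := open_dom; have se := smooth_unit_dir.
apply: smoothD => //; first exact: smooth_derive.
apply: smoothZ => //; first exact: smooth_rad.
apply: smooth_sum => // k; apply: smooth_sum => // l; apply: smoothZ => //.
  apply: smoothM => //; first exact: smooth_cst.
  exact: smooth_coord.
exact: smooth_on_pos.
Qed.

Lemma smooth_blowup : smooth_on blowup_dom blowup.
Proof.
have oD := open_dom; apply/smooth_mxP => // i j; under eq_fun do rewrite mxE.
apply: (@smoothD R _ _ oD R^o) => //.
  by apply: smooth_bilin => //; [exact: smooth_on_pos|exact: smooth_cst|exact: smooth_cst].
by apply: smooth_bilin => //; [exact: smooth_on_pos|exact: smooth_cov_dir|exact: smooth_cov_dir].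
Qed.

Lemma blowup_sym om : blowup_dom om -> (blowup om)^T = blowup om.
Proof.
move=> dm; apply/matrixP => i j; rewrite !mxE.
by congr (_ + _); apply: bilin_sym; exact: hT.
Qed.

Definition scal_blowup om : R := dir_scalar_curvature coord_dir blowup om.

Definition blowup_regular : set 'rV[R]_(N + 1 + (n' + N)) :=
  [set om | blowup_dom om /\ blowup om \in unitmx].

Lemma open_good : open blowup_regular.
Proof. exact: (open_unitmx open_dom smooth_blowup). Qed.

Lemma smooth_scal_blowup : smooth_on blowup_regular (scal_blowup : _ -> R^o).
Proof.
apply: smooth_dir_scalar_curvature; first exact: open_good.
  by apply: smooth_subset smooth_blowup => om [].
by move=> om [].
Qed.

Lemma scal_blowup_slice (th : 'rV[R]_(N + 1)) w :
  coord_scalar_curvature (fun v => blowup (row_mx th v)) w = scal_blowup (row_mx th w).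
Proof.
apply: (@coord_scalar_curvature_along R _ _ blowup (fun v => row_mx th v) coord_dir) => i t v.
by rewrite /coord_dir scale_row_mx add_row_mx scaler0 add0r.
Qed.

Let gam := h x0.
Let beta : 'M[R]_n' := B *m gam *m B^T.
Let b : 'M[R]_(n' + N) := block_mx beta 0 0 0.
Let C : 'M[R]_(n' + N) := block_mx 0 0 0 gam.
Let th0 : 'rV[R]_(N + 1) := row_mx x0 0.

Let gamT : gam^T = gam. Proof. exact: hT. Qed.

Let betaT : beta^T = beta.
Proof. by rewrite /beta !trmx_mul trmxK gamT mulmxA. Qed.

Let beta_unit : beta \in unitmx.
Proof.
apply: posdef_unitmx => u u0.
have -> : bilin beta u u = bilin gam (u *m B) (u *m B).
  by rewrite /bilin /beta trmx_mul !mulmxA.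
apply: hpos => //; apply/eqP => uB; move/eqP: u0; apply.
have : (row_mx 0 u : 'rV[R]_(1 + n')) *m (col_mx eta0 B : 'M[R]_(1 + n')) = 0.
  by rewrite mul_row_col mul0mx add0r uB.
move/(congr1 (mulmx^~ (invmx (col_mx eta0 B : 'M[R]_(1 + n'))))).
rewrite mulmxK// mul0mx => /(congr1 (fun t : 'rV[R]_(1 + n') => rsubmx t)).
by rewrite row_mxKr => ->; apply/matrixP => i j; rewrite !mxE.
Qed.

Let gam_unit : gam \in unitmx.
Proof. by apply: posdef_unitmx; exact: hpos. Qed.

Let Cb : C + b = block_mx beta 0 0 gam.
Proof. by rewrite /C /b add_block_mx !add0r addr0. Qed.

Let Hinv : block_mx (invmx beta) 0 0 (invmx gam) *m (C + b) = 1%:M.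
Proof.
by rewrite Cb mulmx_block !mulmx0 !mul0mx !addr0 !add0r !mulVmx// -scalar_mx_block.
Qed.

Let Cb_unit : C + b \in unitmx.
Proof. by have [] := mulmx1_unit Hinv. Qed.

Let bT : b^T = b.
Proof. by rewrite /b tr_block_mx betaT !trmx0. Qed.

Let CT : C^T = C.
Proof. by rewrite /C tr_block_mx gamT !trmx0. Qed.

Let y_ i (w : 'rV[R]_(n' + N)) : R := (w *m b) 0 i.
Let q (w : 'rV[R]_(n' + N)) : R := 1 + (w *m b *m w^T) 0 0.

Let rad_th0 w : radius (row_mx th0 w) = 0.
Proof. by rewrite /radius row_mxKl row_mxKr mxE. Qed.

Let pos_th0 w : position (row_mx th0 w) = x0.
Proof. by rewrite /position rad_th0 scale0r addr0 /base_point row_mxKl row_mxKl. Qed.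

Let dir_th0 w : direction (row_mx th0 w) = eta0 + fibre_part w *m B.
Proof. by rewrite /direction row_mxKr. Qed.

Let bilin_B u v : bilin gam (u *m B) (v *m B) = bilin beta u v.
Proof. by rewrite /bilin /beta trmx_mul !mulmxA. Qed.

Let bilin_b w v : bilin b w v = bilin beta (fibre_part w) (fibre_part v).
Proof.
rewrite /bilin -{1}(hsubmxK w) -{1}(hsubmxK v) /b tr_row_mx mul_row_block.
by rewrite !mulmx0 !addr0 mul_row_col mul0mx addr0.
Qed.

Let bilin_delta w i : bilin b w (delta_mx 0 i) = y_ i w.
Proof. by rewrite /bilin trmx_delta -colE mxE. Qed.

Let qE w : bilin gam (direction (row_mx th0 w)) (direction (row_mx th0 w)) = q w.
Proof.
rewrite dir_th0 bilinDl !bilinDr eta01 orthB addr0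
  (bilin_sym (fibre_part w *m B) eta0 gamT) orthB add0r.
by rewrite bilin_B -bilin_b.
Qed.

Let q_gt0 w : 0 < q w.
Proof. by rewrite -qE; apply: hpos => //; exact: direction_neq0. Qed.

Let dq i w : 'D_(delta_mx 0 i) (q : 'rV[R]_(n' + N) -> R^o) w = 2 * y_ i w.
Proof. by have [_ /= <-] := has_pd_q bT i w. Qed.

Let a w : R := (Num.sqrt (q w))^-1.

Let a2 w : a w * a w * q w = 1.
Proof.
have s0 : Num.sqrt (q w) != 0 by rewrite gt_eqF// sqrtr_gt0.
have e : q w = Num.sqrt (q w) * Num.sqrt (q w) by rewrite -expr2 sqr_sqrtr// ltW.
by rewrite [X in _ * X]e /a; field.
Qed.

Let da i w : differentiable (a : 'rV[R]_(n' + N) -> R^o) w /\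
  'D_(delta_mx 0 i) (a : 'rV[R]_(n' + N) -> R^o) w = - y_ i w * (a w * a w * a w).
Proof.
have [dfq _] := has_pd_q bT i w.
have [ds Es] := derive_sqrt_comp (delta_mx 0 i) dfq (q_gt0 w).
have s0 : Num.sqrt (q w) != 0 by rewrite gt_eqF// sqrtr_gt0.
have [dV EV] := has_pdV s0 (conj ds Es : has_pd i (fun y => Num.sqrt (q y) : R^o) w _).
split; first exact: dV.
apply: etrans EV _; rewrite dq /a; field.
by rewrite s0.
Qed.

Let dunit i w : 'D_(coord_dir i) unit_dir (row_mx th0 w) =
  (- y_ i w * (a w * a w * a w)) *: (eta0 + fibre_part w *m B) +
  a w *: (fibre_part (delta_mx 0 i) *m B).
Proof.
have along : 'D_(delta_mx 0 i) (fun v => unit_dir (row_mx th0 v)) w =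
    'D_(coord_dir i) unit_dir (row_mx th0 w).
  apply: (derive_along unit_dir) => t.
  by rewrite /coord_dir scale_row_mx add_row_mx scaler0 add0r.
rewrite -along.
have -> : (fun v => unit_dir (row_mx th0 v)) = (fun v => a v *: (eta0 + fibre_part v *m B)).
  by apply/funext => v; rewrite /unit_dir /dir_norm pos_th0 qE dir_th0.
have [dfa <-] := da i w.
have sL : smooth_on setT (fun v : 'rV[R]_(n' + N) => eta0 + fibre_part v *m B).
  have oT := @openT 'rV[R]_(n' + N).
  apply: smoothD => //; first exact: smooth_cst.
  apply: smooth_mulmx => //; last exact: smooth_cst.
  exact: (smooth_mxlinear oT (@lsubmx R 1 n' N) (smooth_id_mx _)).
have dL := smooth_differentiable sL (I : setT w).
rewrite derive_scalemx//; congr (_ + _ *: _).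
have -> // : 'D_(delta_mx 0 i) (fun v : 'rV[R]_(n' + N) => eta0 + fibre_part v *m B) w =
    fibre_part (delta_mx 0 i) *m B.
apply: derive_affine => t.
by rewrite /fibre_part linearD linearZ mulmxDl -scalemxAl addrA addrAC.
Qed.

Let blowup_limit w : blowup (row_mx th0 w) = gnomonic_metric C b w.
Proof.
have cE i : cov_dir i (row_mx th0 w) =
    (- y_ i w * (a w * a w * a w)) *: (eta0 + fibre_part w *m B) +
  a w *: (fibre_part (delta_mx 0 i) *m B).
  by rewrite /cov_dir rad_th0 scale0r addr0 dunit.
have Dy i : bilin gam (eta0 + fibre_part w *m B) (fibre_part (delta_mx 0 i) *m B) = y_ i w.
  by rewrite bilinDl orthB add0r bilin_B -bilin_b bilin_delta.
have bij i j : bilin beta (fibre_part (delta_mx 0 i)) (fibre_part (delta_mx 0 j)) = b i j.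
  by rewrite -bilin_b bilin_delta /y_ -rowE mxE.
have Cij i j : bilin gam (base_part (delta_mx 0 i)) (base_part (delta_mx 0 j)) = C i j.
  have -> : C i j = bilin C (delta_mx 0 i) (delta_mx 0 j).
    by rewrite /bilin trmx_delta -colE -rowE !mxE.
  rewrite /bilin -{2}(hsubmxK (delta_mx 0 i)) -{2}(hsubmxK (delta_mx 0 j)) /C.
  rewrite tr_row_mx mul_row_block.
  by rewrite !mulmx0 !add0r mul_row_col mul0mx add0r.
apply/matrixP => i j; rewrite mxE pos_th0 Cij !cE.
rewrite !bilinDl !bilinDr !bilinZl !bilinZr -(dir_th0 w) qE dir_th0 !Dy.
rewrite (bilin_sym (fibre_part (delta_mx 0 i) *m B) _ gamT) Dy bilin_B bij.
(* The scalar products of [eta0 + u B] with itself and with the rows of [B] are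
   [q] and [y_], and [a] is the inverse of the norm of [eta0 + u B]. *)
have GE : gnomonic_metric C b w i j = C i j + (b i j * (q w)^-1 +
    -1 * (y_ i w * y_ j w * ((q w)^-1 * (q w)^-1))) by exact: gnomonicE.
have q0 : q w != 0 by rewrite gt_eqF.
have aE : (q w)^-1 = a w * a w by apply: (mulIf q0); rewrite mulVf// a2.
rewrite GE aE.
have := a2 w; move: (a w) (q w) (y_ i w) (y_ j w) (b i j) (C i j) => u Q Y Z bb CC e.
apply/eqP; rewrite -subr_eq0; apply/eqP.
transitivity (Y * Z * u ^+ 4 * (u * u * Q - 1)); first by ring.
by rewrite e subrr mulr0.
Qed.

(** For [r = 0] the base point is frozen and the Christoffel terms disappear. What
    is left is the metric of [h x0] in the variable [s], which is flat, and the
    gnomonic metric of its unit sphere of dimension [n'] in the variable [u]. *)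
Theorem scal_blowup_limit : scal_blowup (row_mx th0 0) = (n' * n'.-1)%:R /\
  blowup_regular (row_mx th0 0).
Proof.
have g0 : gnomonic_metric C b 0 = C + b.
  rewrite /gnomonic_metric !mul0mx mulmx0 scaler0 subr0.
  by rewrite mxE addr0 invr1 scale1r.
split; last first.
  split; first by rewrite /blowup_dom /= pos_th0.
  by rewrite blowup_limit g0.
rewrite -scal_blowup_slice.
have -> : (fun v => blowup (row_mx th0 v)) = gnomonic_metric C b.
  by apply/funext => v; exact: blowup_limit.
rewrite (gnomonic_scalar_curvature bT CT Cb_unit).
have -> : invmx (C + b) = block_mx (invmx beta) 0 0 (invmx gam).
  by rewrite -[LHS]mul1mx -Hinv mulmxK.
have -> : block_mx (invmx beta) 0 0 (invmx gam) *m b = block_mx 1%:M 0 0 0.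
  by rewrite /b mulmx_block !mulmx0 !mul0mx !addr0 mulVmx.
rewrite mulmx_block !mulmx0 !mul0mx !addr0 mulmx1 mxtrace_block mxtrace0 addr0 mxtrace1.
have arith k : (k%:R : R) ^+ 2 - k%:R = (k * k.-1)%:R.
  by case: k => [|k]; [rewrite expr0n subrr|rewrite natrM -natr1 /=; ring].
exact: arith.
Qed.

End Core.

(** * Coordinates of the sphere bundle *)

Section SphereCoordinates.
Context {R : realType} {n' : nat}.
Local Notation N := n'.+1.
Variables (W0 : set 'rV[R]_N) (h : 'rV[R]_N -> 'M[R]_N).
Variable Gam : 'I_N -> 'I_N -> 'rV[R]_N -> 'rV[R]_N.
Hypotheses (oW0 : open W0) (sh : smooth_on W0 h).
Hypothesis sGam : forall i j, smooth_on W0 (Gam i j).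
Hypothesis hT : forall x, W0 x -> (h x)^T = h x.
Hypothesis hpos : forall x, W0 x -> forall v, v != 0 -> 0 < bilin (h x) v v.
Variables (eta0 : 'rV[R]_N) (B : 'M[R]_(n', N)).
Let E : 'M[R]_(1 + n') := col_mx eta0 B.
Hypothesis frame_unit : E \in unitmx.

(** The components of [y] along [eta0] and along the rows of [B]; dividing the
    latter by the former gives the gnomonic coordinates of the direction of [y]. *)
Definition height (y : 'rV[R]_N) : R := lsubmx ((y : 'rV[R]_(1 + n')) *m invmx E) 0 0.
Definition slope (y : 'rV[R]_N) : 'rV[R]_n' :=
  (height y)^-1 *: rsubmx ((y : 'rV[R]_(1 + n')) *m invmx E).

Lemma heightE y : height y != 0 -> height y *: (eta0 + slope y *m B) = y.
Proof.
move=> hy; rewrite scalerDr /slope -scalemxAl scalerA mulfV// scale1r.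
rewrite -[RHS](mulmxKV frame_unit) -[X in _ = X *m E](@hsubmxK R 1 1 n') /E mul_row_col.
by congr (_ + _); rewrite [X in _ = X *m _]mx11_scalar mul_scalar_mx.
Qed.

Lemma height_dir k (u : 'rV[R]_n') : k != 0 ->
  height (k *: (eta0 + u *m B)) = k /\ slope (k *: (eta0 + u *m B)) = u.
Proof.
move=> k0.
have e : ((k *: (eta0 + u *m B)) : 'rV[R]_(1 + n')) *m invmx E = k *: row_mx 1%:M u.
  rewrite -scalemxAl; congr (_ *: _).
  have -> : (eta0 + u *m B : 'rV[R]_(1 + n')) = row_mx 1%:M u *m E.
    by rewrite /E mul_row_col mul1mx.
  by rewrite mulmxK.
have hk : height (k *: (eta0 + u *m B)) = k.
  by rewrite /height e scale_row_mx row_mxKl !mxE eqxx mulr1.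
by rewrite /slope hk e scale_row_mx row_mxKr scalerA mulVf// scale1r.
Qed.

Lemma heightZ k y : height (k *: y) = k * height y.
Proof. by rewrite /height -scalemxAl linearZ mxE. Qed.

Lemma slopeZ k y : k != 0 -> slope (k *: y) = slope y.
Proof.
move=> k0; rewrite /slope heightZ -scalemxAl linearZ /= scalerA invfM.
by rewrite mulrAC mulVf// mul1r.
Qed.

Lemma smooth_height (U : set 'rV[R]_N) : open U -> smooth_on U (height : _ -> R^o).
Proof.
move=> oU; apply: smooth_coord => //; apply: (smooth_mxlinear oU (@lsubmx R 1 1 n')).
apply: smooth_mulmx => //; last exact: smooth_cst.
exact: smooth_id_mx.
Qed.

Lemma smooth_slope (U : set 'rV[R]_N) : open U -> (forall y, U y -> height y != 0) ->
  smooth_on U slope.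
Proof.
move=> oU U0; apply: smoothZ => //; first by apply: smoothV => //; exact: smooth_height.
apply: (smooth_mxlinear oU (@rsubmx R 1 1 n')).
apply: smooth_mulmx => //; last exact: smooth_cst.
exact: smooth_id_mx.
Qed.

Lemma open_height : open [set y : 'rV[R]_N | 0 < height y].
Proof.
apply: (@open_comp _ _ (height : _ -> R^o) [set t : R^o | 0 < t]); last exact: open_gt.
by move=> y _; exact: (smooth_continuous (smooth_height openT)).
Qed.

Variable th : 'rV[R]_(N + 1).
Let r : R := rsubmx th 0 0.
Hypothesis r0 : 0 < r.

Local Notation om w := (row_mx th w).
Local Notation udir := (unit_dir h eta0 B).

(** The parametrization of the sphere bundle by the coordinates [(u, s)], with
    values in a chart of the tangent bundle, and a left inverse of it which is
    defined on an open set of this chart. *)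
Definition sphere_coord (w : 'rV[R]_(n' + N)) : 'rV[R]_(N + N) :=
  row_mx (position (om w)) (r *: udir (om w)).

Definition coord_back (v : 'rV[R]_(N + N)) : 'rV[R]_(n' + N) :=
  row_mx (slope (rsubmx v)) (r^-1 *: (lsubmx v - lsubmx th)).

Definition param_dom : set 'rV[R]_(n' + N) := [set w | blowup_dom W0 (om w)].

Let rad_om w : radius (om w) = r.
Proof. by rewrite /radius row_mxKl. Qed.

Let pos_om w : position (om w) = lsubmx th + r *: base_part w.
Proof. by rewrite /position rad_om /base_point row_mxKl row_mxKr. Qed.

Let dir_om w : direction eta0 B (om w) = eta0 + fibre_part w *m B.
Proof. by rewrite /direction row_mxKr. Qed.

Lemma smooth_om (U : set 'rV[R]_(n' + N)) : open U -> smooth_on U (fun w => om w).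
Proof. by move=> oU; apply: smooth_row_mx => //; [exact: smooth_cst|exact: smooth_id_mx]. Qed.

Lemma open_param_dom : open param_dom.
Proof.
apply: (@open_comp _ _ (fun w => om w) (blowup_dom W0)) => [w _|]; last exact: open_dom.
exact: (smooth_continuous (smooth_om openT)).
Qed.

Let smooth_udir : smooth_on (blowup_dom W0) udir.
Proof. exact: smooth_unit_dir. Qed.

Lemma smooth_sphere_coord : smooth_on param_dom sphere_coord.
Proof.
have oP := open_param_dom; have oD := open_dom oW0; have so := smooth_om oP.
apply: smooth_row_mx => //.
  exact: (smooth_comp oP oD _ (smooth_pos oD) so).
apply: smoothZ => //; first exact: smooth_cst.
exact: (smooth_comp oP oD _ smooth_udir so).
Qed.

Lemma len_gt0 w : param_dom w -> 0 < dir_norm h eta0 B (om w).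
Proof. by move=> dw; rewrite sqrtr_gt0; exact: (sqlen_gt0 hpos frame_unit). Qed.

Lemma sphere_coordK w : param_dom w -> coord_back (sphere_coord w) = w.
Proof.
move=> dw; rewrite /coord_back /sphere_coord row_mxKl row_mxKr slopeZ ?gt_eqF//.
have l0 : (dir_norm h eta0 B (om w))^-1 != 0 by rewrite invr_eq0 gt_eqF// len_gt0.
rewrite /unit_dir dir_om; have [_ ->] := height_dir (fibre_part w) l0.
by rewrite pos_om addrC addKr scalerA mulVf ?gt_eqF// scale1r hsubmxK.
Qed.

Lemma sphere_coord_norm w : param_dom w ->
  bilin (h (position (om w))) (r *: udir (om w)) (r *: udir (om w)) = r ^+ 2.
Proof.
move=> dw; rewrite bilinZl bilinZr /unit_dir bilinZl bilinZr.
have l0 := len_gt0 dw; have lE : dir_norm h eta0 B (om w) ^+ 2 =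
    bilin (h (position (om w))) (direction eta0 B (om w)) (direction eta0 B (om w)).
  by rewrite sqr_sqrtr// ltW//; exact: (sqlen_gt0 hpos frame_unit).
by rewrite -lE; field; rewrite gt_eqF.
Qed.

Lemma sphere_coord_height w : param_dom w -> 0 < height (rsubmx (sphere_coord w)).
Proof.
move=> dw; have l0 := len_gt0 dw.
rewrite /sphere_coord row_mxKr /unit_dir scalerA dir_om.
have k0 : 0 < r * (dir_norm h eta0 B (om w))^-1 by rewrite mulr_gt0// invr_gt0.
by have [->] := height_dir (fibre_part w) (lt0r_neq0 k0).
Qed.

Lemma coord_backK v : W0 (lsubmx v) -> 0 < height (rsubmx v) ->
  bilin (h (lsubmx v)) (rsubmx v) (rsubmx v) = r ^+ 2 ->
  param_dom (coord_back v) /\ sphere_coord (coord_back v) = v.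
Proof.
move=> Wv hv nv.
have pE : position (om (coord_back v)) = lsubmx v.
  by rewrite pos_om /coord_back /base_part row_mxKr scalerA mulfV ?gt_eqF// scale1r addrC subrK.
have dE : direction eta0 B (om (coord_back v)) = (height (rsubmx v))^-1 *: rsubmx v.
  rewrite dir_om /coord_back /fibre_part row_mxKl ; apply: (scalerI (lt0r_neq0 hv)).
  by rewrite heightE ?gt_eqF// scalerA mulfV ?gt_eqF// scale1r.
have lE : dir_norm h eta0 B (om (coord_back v)) = (height (rsubmx v))^-1 * r.
  rewrite /dir_norm pE dE bilinZl bilinZr nv mulrA -expr2 -exprMn sqrtr_sqr ger0_norm//.
  by rewrite mulr_ge0// ?invr_ge0 ltW.
split; first by rewrite /param_dom /blowup_dom /= pE.
rewrite /sphere_coord pE /unit_dir dE lE -[RHS]hsubmxK; congr row_mx.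
rewrite !scalerA -[RHS]scale1r; congr (_ *: _).
by field; rewrite !gt_eqF.
Qed.

Lemma smooth_coord_back (U : set 'rV[R]_(N + N)) : open U ->
  (forall v, U v -> height (rsubmx v) != 0) -> smooth_on U coord_back.
Proof.
move=> oU U0; have sid := @smooth_id_mx R 1 (N + N) U.
have sr := smooth_mxlinear oU (@rsubmx R 1 N N) sid.
have sl := smooth_mxlinear oU (@lsubmx R 1 N N) sid.
apply: smooth_row_mx => //.
  have oH : open [set y : 'rV[R]_N | height y != 0].
    apply: (@open_comp _ _ (height : _ -> R^o) [set t : R^o | t != 0]); last exact: open_neq0.
    by move=> y _; exact: (smooth_continuous (smooth_height openT)).
  by apply: (smooth_comp oU oH _ (smooth_slope oH _) sr).
apply: smoothZ => //; first exact: smooth_cst.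
by apply: smoothD => //; exact: smooth_cst.
Qed.

Lemma derive_sphere_coord v w : param_dom w ->
  'D_v sphere_coord w = \sum_i v 0 i *: row_mx (r *: base_part (delta_mx 0 i))
     (r *: 'D_(coord_dir i) udir (om w)).
Proof.
move=> dw; have ds := smooth_differentiable smooth_sphere_coord dw.
rewrite derive_rV_delta//; apply: eq_bigr => i _; congr (_ *: _).
have along t : om (t *: delta_mx 0 i + w) = t *: coord_dir i + om w.
  by rewrite /coord_dir scale_row_mx add_row_mx scaler0 add0r.
have dp : differentiable (fun w => position (om w)) w.
  have oP := open_param_dom.
  exact: (smooth_differentiable (smooth_comp oP (open_dom oW0) (fun x hx => hx)
    (smooth_pos (open_dom oW0)) (smooth_om oP)) dw).
have du : differentiable (fun w => udir (om w)) w.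
  have oP := open_param_dom.
  exact: (smooth_differentiable (smooth_comp oP (open_dom oW0) (fun x hx => hx)
    smooth_udir (smooth_om oP)) dw).
have dru : differentiable (fun w => r *: udir (om w)) w.
  by apply: (@differentiable_scalemx _ _ _ _ (fun=> r)) => //; exact: differentiable_cst.
rewrite /sphere_coord derive_row_mx//; congr row_mx.
  apply: derive_affine => t; rewrite !pos_om /base_part linearD linearZ /=.
  by rewrite scalerDr addrCA addrC scalerA mulrC -scalerA.
rewrite deriveZ; last exact: diff_derivable.
apply: (congr1 (GRing.scale r)).
exact: (@derive_along R _ _ _ udir (fun w => om w) w _ _ along).
Qed.

Lemma conn_formZ x k l a y : conn_form Gam x (k *: a) (l *: y) = (k * l) *: conn_form Gam x a y.
Proof.
rewrite /conn_form scaler_sumr; apply: eq_bigr => i _; rewrite scaler_sumr.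
by apply: eq_bigr => j _; rewrite scalerA !mxE; congr (_ *: _); ring.
Qed.

Lemma conn_form_suml x (I : Type) (s : seq I) (k : I -> R) (F : I -> 'rV[R]_N) y :
  conn_form Gam x (\sum_(i <- s) k i *: F i) y = \sum_(i <- s) k i *: conn_form Gam x (F i) y.
Proof.
elim: s => [|i s IH].
  rewrite !big_nil /conn_form big1// => i _; rewrite big1// => j _.
  by rewrite mxE mul0r scale0r.
rewrite !big_cons -IH /conn_form scaler_sumr -big_split; apply: eq_bigr => a _.
rewrite scaler_sumr -big_split; apply: eq_bigr => b _ /=.
by rewrite scalerA -scalerDl !mxE; congr (_ *: _); ring.
Qed.

(** In the coordinates [(u, s)] both [dx = r ds] and [y = r unit_dir] carry a
    factor [r], and the Christoffel term carries one more. *)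
Lemma sasaki_sphere_coord v v' w : param_dom w ->
  sasaki_form h Gam (sphere_coord w) ('D_v sphere_coord w) ('D_v' sphere_coord w) =
  r ^+ 2 * bilin (blowup h Gam eta0 B (om w)) v v'.
Proof.
move=> dw; rewrite /sasaki_form !derive_sphere_coord//.
have lE u : lsubmx (\sum_i u 0 i *: row_mx (r *: base_part (delta_mx 0 i))
    (r *: 'D_(coord_dir i) udir (om w))) = \sum_i u 0 i *: (r *: base_part (delta_mx 0 i)).
  by rewrite linear_sum; apply: eq_bigr => i _; rewrite linearZ /= row_mxKl.
have rE u : rsubmx (\sum_i u 0 i *: row_mx (r *: base_part (delta_mx 0 i))
    (r *: 'D_(coord_dir i) udir (om w))) = \sum_i u 0 i *: (r *: 'D_(coord_dir i) udir (om w)).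
  by rewrite linear_sum; apply: eq_bigr => i _; rewrite linearZ /= row_mxKr.
rewrite !lE !rE /sphere_coord row_mxKl row_mxKr.
have covE u : \sum_i u 0 i *: (r *: 'D_(coord_dir i) udir (om w)) +
    conn_form Gam (position (om w)) (\sum_i u 0 i *: (r *: base_part (delta_mx 0 i)))
      (r *: udir (om w)) =
    \sum_i u 0 i *: (r *: cov_dir h Gam eta0 B i (om w)).
  rewrite conn_form_suml -big_split /=; apply: eq_bigr => i _; rewrite conn_formZ -scalerDr.
  by congr (_ *: _); rewrite /cov_dir rad_om [RHS]scalerDr scalerA.
rewrite !covE [in RHS]bilinE.
have expand (F : 'I_(n' + N) -> 'rV[R]_N) u u' :
   bilin (h (position (om w))) (\sum_i u 0 i *: (r *: F i)) (\sum_i u' 0 i *: (r *: F i)) =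
   r ^+ 2 * \sum_i \sum_j u 0 i * bilin (h (position (om w))) (F i) (F j) * u' 0 j.
  rewrite bilin_suml big_distrr /=; apply: eq_bigr => i _.
  rewrite bilin_sym; last exact: hT.
  rewrite bilin_suml big_distrr /=; apply: eq_bigr => j _.
  rewrite bilin_sym; last exact: hT.
  by rewrite !bilinZl !bilinZr; ring.
rewrite !expand -mulrDr; congr (_ * _); rewrite -big_split /=; apply: eq_bigr => i _.
rewrite -big_split /=; apply: eq_bigr => j _; rewrite [blowup _ _ _ _ _ _ _]mxE.
by rewrite mulrDr mulrDl.
Qed.

End SphereCoordinates.

(** * Scalar curvature of the sphere bundle *)

Section SphereBundle.
Context {R : realType} {n' : nat} (M : manifold R n'.+1).
Local Notation N := n'.+1.
Local Notation A := (matlas M).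
Local Notation TM := (tangent_bundle M).
Variables (g : M -> 'rV[R]_N -> 'rV[R]_N -> R).
Variable nabla : M -> 'rV[R]_N -> (M -> 'rV[R]_N) -> 'rV[R]_N.
Variable G : TM -> 'rV[R]_(N + N) -> 'rV[R]_(N + N) -> R.
Hypothesis gR : is_riemannian A g.
Hypothesis nablaC : is_affine_connection A nabla.
Hypothesis GS : is_sasakian g nabla G.
Variable c : chart R N M.
Hypothesis cA : charts A c.
Local Notation h := (metric_in g c).
Local Notation Gam := (christoffel_in nabla c).
Local Notation tc := (tangent_chart c).

Lemma smooth_metric_in : smooth_on (cimg c) h.
Proof.
have [_ oc _ _ _] := mchart cA.
apply/smooth_mxP => // i j; apply: eq_smooth (metric_smooth gR cA i j) => // x _.
by rewrite mxE.
Qed.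

Lemma metric_in_sym x : (h x)^T = h x.
Proof. by apply/matrixP => i j; rewrite !mxE; exact: (Defs.metric_sym gR). Qed.

Lemma metric_in_pos x : cimg c x -> forall v, v != 0 -> 0 < bilin (h x) v v.
Proof.
move=> [p cp <-] v v0; rewrite -(metric_tchange gR)//; apply: (metric_pos gR).
apply/eqP => tv; move/eqP: v0; apply.
rewrite -(tchangeK v cA (chart_atP p) cp (cdom_chart_at p)) tv.
by rewrite /tchange derive0.
Qed.

Lemma tangent_chart_norm (z : TM) : cdom c z.1 ->
  bilin (h (lsubmx (cmap tc z))) (rsubmx (cmap tc z)) (rsubmx (cmap tc z)) = g z.1 z.2 z.2.
Proof.
move=> cz; rewrite /= row_mxKl row_mxKr -(metric_tchange gR)//.
by rewrite tchangeK//; [exact: chart_atP|exact: cdom_chart_at].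
Qed.

Lemma cmap_tangentK v : cimg c (lsubmx v) -> cmap tc (cinv tc v) = v.
Proof.
move=> cv; rewrite /= (cmapK cA)// tchangeK//; first by rewrite hsubmxK.
- exact: chart_atP.
- exact: cdom_cinv.
- exact: cdom_chart_at.
Qed.

(** The derivative of [ttrans] is block triangular, and its diagonal blocks are
    the invertible derivative of the transition map. *)
Lemma derive_ttrans_inj p v w : cdom c p -> lsubmx w = cmap c p ->
  'D_v (ttrans c (chart_at A p)) w = 0 -> v = 0.
Proof.
move=> cp wp; have dA := chart_atP p; have dp := cdom_chart_at p.
have ov : toverlap c (chart_at A p) w by rewrite /toverlap /= wp; exact: overlap_cmap.
rewrite derive_ttrans// -row_mx0 wp => /eq_row_mx[e1 e2].
have inj u : 'D_u (trans c (chart_at A p)) (cmap c p) = 0 -> u = 0.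
  move=> u0; rewrite -(tchangeK u cA dA cp dp).
  have -> : tchange c (chart_at A p) p u = 0 by exact: u0.
  by rewrite /tchange derive0.
have l0 := inj _ e1.
have r0 : rsubmx v = 0.
  apply: inj; move: e2; rewrite l0 big1 ?addr0// => j _.
  by rewrite derive0 scaler0.
by rewrite -[v]hsubmxK l0 r0 row_mx0.
Qed.

Variable W0 : set 'rV[R]_N.
Hypotheses (oW0 : open W0) (W0c : W0 `<=` cimg c).
Hypothesis sGam : forall i j, smooth_on W0 (Gam i j).
Variables (eta0 : 'rV[R]_N) (B : 'M[R]_(n', N)).
Hypothesis frame_unit : (col_mx eta0 B : 'M[R]_(1 + n')) \in unitmx.
Variable th : 'rV[R]_(N + 1).
Let r : R := rsubmx th 0 0.
Hypothesis r0 : 0 < r.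

Let sh : smooth_on W0 h.
Proof. by apply: smooth_subset smooth_metric_in. Qed.
Let hT x : W0 x -> (h x)^T = h x. Proof. by move=> _; exact: metric_in_sym. Qed.
Let hpos x : W0 x -> forall v, v != 0 -> 0 < bilin (h x) v v.
Proof. by move=> Wx; apply: metric_in_pos; exact: W0c. Qed.

Local Notation F := (sphere_coord h eta0 B th).
Local Notation back := (coord_back eta0 B th).
Local Notation K := (fun w => blowup h Gam eta0 B (row_mx th w)).

Let Ugood : set 'rV[R]_(n' + N) := [set w | blowup_regular W0 h Gam eta0 B (row_mx th w)].

Let oUgood : open Ugood.
Proof.
apply: (@open_comp _ _ (fun w => row_mx th w) (blowup_regular W0 h Gam eta0 B)).
  by move=> w _; exact: (smooth_continuous (smooth_om th openT)).
exact: (open_good oW0 sh sGam hpos frame_unit).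
Qed.

Let UgoodP w : Ugood w -> param_dom W0 th w.
Proof. by case. Qed.

Let region : set 'rV[R]_(N + N) := [set v | [/\ W0 (lsubmx v), 0 < height eta0 B (rsubmx v) &
   Ugood (back v)]].

Let hgt_region : set 'rV[R]_(N + N) := [set v | 0 < height eta0 B (rsubmx v)].

Let open_hgt_region : open hgt_region.
Proof.
have oH := @open_height R n' eta0 B.
rewrite openE => v hv; rewrite /interior.
apply: (@continuous_rsubmx R 1 N N v [set y | 0 < height eta0 B y]).
by apply: open_nbhs_nbhs.
Qed.

Let smooth_back : smooth_on hgt_region back.
Proof. by apply: (smooth_coord_back th open_hgt_region) => v /lt0r_neq0. Qed.

Let open_region : open region.
Proof.
have o1 : open [set v | hgt_region v /\ Ugood (back v)].
  apply: (open_preimage_on open_hgt_region oUgood) => v hv.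
  exact: (smooth_continuous smooth_back).
have o2 : open [set v : 'rV[R]_(N + N) | W0 (lsubmx v)].
  apply: (@open_comp _ _ (lsubmx : 'rV[R]_(N + N) -> 'rV[R]_N)) => // v _.
  exact: continuous_lsubmx.
rewrite (_ : region = [set v : 'rV[R]_(N + N) | W0 (lsubmx v)] `&`
    [set v | hgt_region v /\ Ugood (back v)]).
  exact: openI.
by apply/seteqP; split=> v; [move=> [? ? ?]; split|move=> [? [? ?]]; split].
Qed.

Variable z : TM.
Hypothesis zS : sphere_bundle g r z.
Hypothesis zc : cdom c z.1.
Hypothesis zreg : region (cmap tc z).

(** The left inverse of [sphere_coord] yields a smooth [tau] with
    [psi = sphere_coord \o tau] in the chart [c], near [u]. It is an immersion since
    [psi] is, hence its Jacobian matrix is invertible, and the metric pulled back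
    by [psi] is the pullback by [tau] of [r ^+ 2] times the blown-up metric. *)
Theorem scalar_curvature_parametrization (U : set 'rV[R]_(n' + N))
    (psi : 'rV[R]_(n' + N) -> TM) (u : 'rV[R]_(n' + N)) :
  local_parametrization (tangent_atlas M) (sphere_bundle g r) U psi -> U u -> psi u = z ->
  coord_scalar_curvature (pullback_metric (tangent_atlas M) G psi) u =
  (r ^+ 2)^-1 * scal_blowup h Gam eta0 B (row_mx th (back (cmap tc z))).
Proof.
move=> [oU psiU] Uu psiz; have [_ [W1 [oW1 W1u W1d sW1]] _] := psiU u Uu.
have dA := chart_atP (psi u).1.
have cu : cdom c (psi u).1 by rewrite psiz.
have [W2 [oW2 W2u W21 W2c sW2]] := smooth_map_change dA cA oW1 W1u W1d sW1 cu.
pose f := cmap tc \o psi.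
pose W3 : set 'rV[R]_(n' + N) := [set w | (W2 `&` U) w /\ region (f w)].
have oW3 : open W3.
  apply: open_preimage_on; [exact: openI|exact: open_region|].
  by move=> w [W2w _]; exact: (smooth_continuous sW2).
have W3u : W3 u by split; [|rewrite /f /= psiz].
have W32 : W3 `<=` W2 by move=> w [[]].
have W3U : W3 `<=` U by move=> w [[]].
have W3c w : W3 w -> cdom c (psi w).1.
  by move=> W3w; apply: (W2c (psi w)); exists w => //; exact: W32.
have sf : smooth_on W3 f by exact: smooth_subset sW2.
pose tau := back \o f.
have stau : smooth_on W3 tau.
  by apply: (smooth_comp oW3 open_hgt_region _ smooth_back sf) => w [_ []].
have tauU w : W3 w -> Ugood (tau w) by move=> [_ []].
have fE w : W3 w -> f w = F (tau w).
  move=> W3w; have [_ [Wf hf _]] := W3w.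
  have nf : bilin (h (lsubmx (f w))) (rsubmx (f w)) (rsubmx (f w)) = r ^+ 2.
    apply: etrans (tangent_chart_norm (W3c w W3w)) _.
    by have [] := psiU w (W3U w W3w).
  by have [_ /esym] := coord_backK frame_unit r0 Wf hf nf.
have sF : smooth_on Ugood F.
  by apply: smooth_subset (smooth_sphere_coord oW0 sh hpos frame_unit th) => w /UgoodP.
have df w v : W3 w -> 'D_v f w = 'D_('D_v tau w) F (tau w).
  move=> W3w; rewrite -derive_compE; last 2 first.
  - exact: smooth_differentiable stau W3w.
  - exact: smooth_differentiable sF (tauU w W3w).
  by apply: near_eq_derive; apply: (nbhs_eq_on oW3 W3w) => y /fE.
have W2c' : psi @` W3 `<=` cdom tc by move=> _ [w W3w <-]; exact: W3c.
pose J w : 'M[R]_(n' + N) := \matrix_(i, a) pd i (fun y => tau y 0 a) w.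
have JE w v : W3 w -> v *m J w = 'D_v tau w.
  move=> W3w; have dt := smooth_differentiable stau W3w.
  rewrite derive_rV_delta//; apply/rowP => a; rewrite mxE summxE.
  by apply: eq_bigr => i _; rewrite !mxE pd_mx.
have sK : smooth_on Ugood K.
  have sb := smooth_blowup oW0 sh sGam hpos frame_unit.
  apply: (smooth_comp oUgood (open_dom oW0) _ sb (smooth_om th oUgood)).
  by move=> w [].
have Ku w : Ugood w -> K w \in unitmx by case.
have Ksym w : Ugood w -> (K w)^T = K w by case=> dw _; exact: (blowup_sym Gam hT eta0 B dw).
have c0 : r ^+ 2 != 0 by rewrite expf_neq0// gt_eqF.
have Ju w : W3 w -> J w \in unitmx.
  move=> W3w; apply: unitmx_inj => v vJ.
  have [_ _ inj] := psiU w (W3U w W3w); apply: inj.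
  rewrite (tangent_map_change v cA oW3 W3w W2c' sf) -/f (df w v W3w) -(JE w v W3w) vJ.
  by rewrite !derive0.
have hE w : W3 w -> pullback_metric (tangent_atlas M) G psi w =
    r ^+ 2 *: (J w *m K (tau w) *m (J w)^T).
  move=> W3w; apply/matrixP => i j.
  apply: (etrans (mxE _ _ _ _)); apply: (etrans _ (esym (mxE _ _ _ _))).
  apply: (etrans (sasaki_pullback gR nablaC GS _ _ cA oW3 W3w W2c' sf)).
  rewrite -/f (df w _ W3w) (df w _ W3w) (fE w W3w) -(JE w _ W3w) -(JE w _ W3w).
  rewrite (JE w (delta_mx 0 i) W3w) (JE w (delta_mx 0 j) W3w).
  apply: (etrans (sasaki_sphere_coord Gam oW0 sh hT hpos frame_unit _ _ (UgoodP (tauU w W3w)))).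
  apply: (congr1 ( *%R _)); rewrite -(JE w _ W3w) -(JE w _ W3w).
  exact: bilin_delta_mul.
have := scalar_curvature_change oW3 oUgood stau tauU sK Ku Ksym c0 Ju hE W3u.
move=> ->; rewrite (scal_blowup_slice h Gam eta0 B th).
by rewrite /tau /f /= psiz.
Qed.

(** The scalar curvature of the sphere bundle is the common value for all the local
    parametrizations, which is meaningful only if there is one. *)
Theorem sphere_parametrization : exists (U : set 'rV[R]_(n' + N))
    (psi : 'rV[R]_(n' + N) -> TM) (u : 'rV[R]_(n' + N)),
  [/\ local_parametrization (tangent_atlas M) (sphere_bundle g r) U psi, U u & psi u = z].
Proof.
pose psi w : TM := cinv tc (F w).
have W0z : W0 (lsubmx (cmap tc z)) by case: zreg.
have hz : 0 < height eta0 B (rsubmx (cmap tc z)) by case: zreg.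
have nz := etrans (tangent_chart_norm zc) zS.
have [pz Fz] := coord_backK frame_unit r0 W0z hz nz.
have sF := smooth_sphere_coord oW0 sh hpos frame_unit th.
have oP := @open_param_dom R n' W0 oW0 th.
have Fl w : param_dom W0 th w -> W0 (lsubmx (F w)) by rewrite /sphere_coord row_mxKl.
have psic w : param_dom W0 th w -> cdom c (psi w).1.
  by move=> pw; apply: cdom_cinv => //; apply: W0c; exact: Fl.
have fE w : param_dom W0 th w -> cmap tc (psi w) = F w.
  by move=> pw; apply: cmap_tangentK; apply: W0c; exact: Fl.
have sf : smooth_on (param_dom W0 th) (cmap tc \o psi).
  exact: (eq_smooth oP (fun w pw => esym (fE w pw)) sF).
have psiD : psi @` param_dom W0 th `<=` cdom tc by move=> _ [w pw <-]; exact: psic.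
exists (param_dom W0 th), psi, (back (cmap tc z)); split; last 2 first.
- exact: pz.
- rewrite /psi Fz /= row_mxKl row_mxKr (cinvK cA)// tchangeK//; first by case: (z).
  exact: chart_atP.
  exact: cdom_chart_at.
split; first exact: oP.
move=> w pw; split.
- apply: (etrans (esym (tangent_chart_norm (psic w pw)))).
  rewrite (fE w pw) /sphere_coord row_mxKl row_mxKr.
  exact: (sphere_coord_norm hpos frame_unit).
- have [W' [oW' W'w _ W'd sW']] := smooth_map_change cA (chart_atP (psi w).1) oP pw psiD sf
    (cdom_chart_at (psi w).1).
  by exists W'.
- move=> v; rewrite (tangent_map_change v cA oP pw psiD sf) => tv.
  have dF0 : 'D_v F w = 0.
    rewrite -(@near_eq_derive _ _ _ (cmap tc \o psi)); last by apply: (nbhs_eq_on oP pw) => y /fE.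
    apply: (derive_ttrans_inj (psic w pw) _ tv).
    by rewrite /= row_mxKl.
  have hF : hgt_region (F w) by exact: (sphere_coord_height hpos frame_unit).
  have id : 'D_v (back \o F) w = v.
    rewrite -[RHS](derive_id w v); apply: near_eq_derive.
    by apply: (nbhs_eq_on oP pw) => y py; exact: (sphere_coordK hpos frame_unit r0 py).
  rewrite -id derive_compE; last 2 first.
  - exact: smooth_differentiable sF pw.
  - exact: smooth_differentiable smooth_back hF.
  by rewrite dF0 derive0.
Qed.

Theorem sphere_scalar_curvatureE : sphere_scalar_curvature g G r z =
  (r ^+ 2)^-1 * scal_blowup h Gam eta0 B (row_mx th (back (cmap tc z))).
Proof.
rewrite /sphere_scalar_curvature /induced_scalar_curvature.
case: xgetP => [y _ [U [psi [u [lp Uu pz ->]]]]|nE].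
  exact: scalar_curvature_parametrization lp Uu pz.
have [U [psi [u [lp Uu pz]]]] := sphere_parametrization.
exfalso; apply: (nE (coord_scalar_curvature (pullback_metric (tangent_atlas M) G psi) u)).
by exists U, psi, u.
Qed.

End SphereBundle.

(** * Small radii *)

Section SmallRadius.
Context {R : realType} {n' : nat} (M : manifold R n'.+1).
Local Notation N := n'.+1.
Local Notation A := (matlas M).
Local Notation TM := (tangent_bundle M).
Variables (g : M -> 'rV[R]_N -> 'rV[R]_N -> R).
Variable nabla : M -> 'rV[R]_N -> (M -> 'rV[R]_N) -> 'rV[R]_N.
Variable G : TM -> 'rV[R]_(N + N) -> 'rV[R]_(N + N) -> R.
Hypothesis gR : is_riemannian A g.
Hypothesis nablaC : is_affine_connection A nabla.
Hypothesis GS : is_sasakian g nabla G.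
Hypothesis n'2 : (1 < n')%N.

Lemma ball_row_mx m1 m2 (a a' : 'rV[R]_m1) (b b' : 'rV[R]_m2) (e : R) : 0 < e ->
  ball a e a' -> ball b e b' -> ball (row_mx a b) e (row_mx a' b').
Proof.
move=> e0 [_ ha] [_ hb]; split=> // i j; rewrite !mxE.
by case: (fintype.split j) => k; [exact: ha|exact: hb].
Qed.

(** Smoothness of the covariant derivative of a field is only given near one point
    and in the preferred chart there; hence the restriction to a neighbourhood,
    which is then made common to the finitely many coordinate fields. *)
Lemma smooth_christoffel_near p : exists W : set 'rV[R]_N,
  [/\ open W, W (cmap (chart_at A p) p), W `<=` cimg (chart_at A p) &
      forall i j, smooth_on W (christoffel_in nabla (chart_at A p) i j)].
Proof.
set c := chart_at A p; have cA : charts A c := chart_atP p.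
have cp : cdom c p := cdom_chart_at p.
have H (ij : 'I_N * 'I_N) : exists W : set 'rV[R]_N, [/\ open W, W (cmap c p), W `<=` cimg c &
    smooth_on W (christoffel_in nabla c ij.1 ij.2)].
  exact: (conn_smooth nablaC (smooth_coord_field ij.1 cA cp) (smooth_coord_field ij.2 cA cp)).
pose W ij := projT1 (cid (H ij)).
have HW ij : [/\ open (W ij), W ij (cmap c p), W ij `<=` cimg c &
    smooth_on (W ij) (christoffel_in nabla c ij.1 ij.2)] := projT2 (cid (H ij)).
exists [set x | forall ij, W ij x]; split.
- rewrite openE => x Wx; rewrite /interior; 
  apply: (@filter_forall _ _ (fun ij y => W ij y) (nbhs x) (nbhs_filter x)) => ij.
  by have [oW _ _ _] := HW ij; exact: open_nbhs_nbhs.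
- by move=> ij; have [] := HW ij.
- by move=> x /(_ (ord0, ord0)); have [_ _ h _] := HW (ord0, ord0); exact: h.
move=> i j; have [_ _ _ s] := HW (i, j).
by apply: smooth_subset s => x.
Qed.

Definition large_at (L r : R) (z : TM) : Prop :=
  sphere_bundle g r z -> L < sphere_scalar_curvature g G r z.

(** The scalar curvature at [z] is [(r ^+ 2)^-1 * scal_blowup om] for a point [om]
    which depends continuously on the base point, on the radius and on the
    direction [y], also at radius 0. There the factor [scal_blowup] is
    [n' * (n' - 1)], which is more than 1, so that it stays above 1 nearby. *)
Lemma large_near_direction (L : R) p0 (y0 : 'rV[R]_N) : y0 != 0 ->
  let c := chart_at A p0 in
  \forall y \near y0 & pr \near filter_prod (nbhs p0) (0^'+ : set_system R),
    forall (z : TM) (t : R), z.1 = pr.1 -> 0 < t ->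
      tchange (chart_at A z.1) c z.1 z.2 = t *: y -> large_at L pr.2 z.
Proof.
move=> y00 c; have cA : charts A c := chart_atP p0.
have cp : cdom c p0 := cdom_chart_at p0.
have [odc oic _ cc _] := mchart cA.
have [W0 [oW0 W0p W0c sGam]] := smooth_christoffel_near p0.
rewrite -/c in W0p W0c sGam.
set h := metric_in g c; set Gam := christoffel_in nabla c.
have sh : smooth_on W0 h by apply: smooth_subset (smooth_metric_in gR cA).
have hT x : W0 x -> (h x)^T = h x by move=> _; exact: metric_in_sym.
have hpos x : W0 x -> forall v, v != 0 -> 0 < bilin (h x) v v.
  by move=> Wx; apply: (metric_in_pos gR cA); exact: W0c.
pose x0 := cmap c p0; pose k := Num.sqrt (bilin (h x0) y0 y0).
have k0 : 0 < k by rewrite sqrtr_gt0; exact: hpos.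
pose eta0 := k^-1 *: y0.
have y0E : y0 = k *: eta0 by rewrite /eta0 scalerA mulfV ?gt_eqF// scale1r.
have eta01 : bilin (h x0) eta0 eta0 = 1.
  rewrite /eta0 bilinZl bilinZr -[bilin _ y0 y0]sqr_sqrtr; last exact/ltW/hpos.
  by rewrite -/k; field; rewrite gt_eqF.
have [B [orthB Eu]] := orthogonal_frame (hT x0 W0p) eta01.
have [limS limG] := scal_blowup_limit Gam hT hpos W0p eta01 orthB Eu.
pose S := scal_blowup h Gam eta0 B.
pose GG := blowup_regular W0 h Gam eta0 B.
have sS : smooth_on GG (S : _ -> R^o) := smooth_scal_blowup oW0 sh sGam hpos Eu.
have oGG : open GG := open_good oW0 sh sGam hpos Eu.
pose G1 : set 'rV[R]_(N + 1 + (n' + N)) := [set om | GG om /\ 1 < S om].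
have oG1 : open G1.
  apply: (@open_preimage_on R _ R^o GG [set t : R^o | 1 < t] S oGG).
    exact: open_gt.
  by move=> om Gom; exact: (smooth_continuous sS).
have G1lim : G1 (row_mx (row_mx x0 0) 0).
  split; first exact: limG.
  rewrite /S limS -[X in X < _]/(1%:R) ltr_nat.
  by move: n'2; case: (n') => [|[|j]]//= _; rewrite mulnS.
(* The coordinate [s] is 0 when the coordinates are centred at the base point. *)
pose omega (v : 'rV[R]_(N + 1 + N)) : 'rV[R]_(N + 1 + (n' + N)) :=
  row_mx (lsubmx v) (row_mx (slope eta0 B (rsubmx v)) 0).
pose D : set 'rV[R]_(N + 1 + N) := [set v | 0 < height eta0 B (rsubmx v)].
have oD : open D.
  rewrite openE => v hv; rewrite /interior.
  apply: (@continuous_rsubmx R 1 (N + 1) N v [set y | 0 < height eta0 B y]).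
  by apply: open_nbhs_nbhs; split=> //; exact: (@open_height R n' eta0 B).
have som : smooth_on D omega.
  have sid := @smooth_id_mx R 1 (N + 1 + N) D.
  have sl := smooth_mxlinear oD (@lsubmx R 1 (N + 1) N) sid.
  have sr := smooth_mxlinear oD (@rsubmx R 1 (N + 1) N) sid.
  apply: (smooth_row_mx oD sl); apply: (smooth_row_mx oD); last exact: smooth_cst.
  have oH := @open_height R n' eta0 B.
  have ss : smooth_on [set y | 0 < height eta0 B y] (slope eta0 B).
    by apply: smooth_slope => // y; rewrite /= => /lt0r_neq0.
  by apply: (smooth_comp oD oH _ ss sr).
pose Q : set 'rV[R]_(N + 1 + N) := [set v | D v /\ G1 (omega v)].
have oQ : open Q.
  by apply: (open_preimage_on oD oG1) => v Dv; exact: (smooth_continuous som).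
pose v0 : 'rV[R]_(N + 1 + N) := row_mx (row_mx x0 0) y0.
have [hk su] := height_dir Eu (0 : 'rV[R]_n') (lt0r_neq0 k0).
rewrite mul0mx addr0 -y0E in hk su.
have Qv0 : Q v0.
  split; first by rewrite /D /= row_mxKr hk.
  by rewrite /omega row_mxKl row_mxKr su row_mx0.
have /nbhs_ballP[e /= e0 eQ] : nbhs v0 Q by exact: open_nbhs_nbhs.
have N1 : \forall y \near y0, ball y0 e y by exact: nbhsx_ballx.
have N2 : \forall p \near p0, cdom c p /\ ball x0 e (cmap c p).
  apply: filterI; first exact: open_nbhs_nbhs.
  by apply: (cc p0 cp); exact: nbhsx_ballx.
have N3 : \forall r \near (0:R)^'+, [/\ 0 < r, r < e & L < (r ^+ 2)^-1].
  have h1 : \forall r \near (0:R)^'+, 0 < r by exact: nbhs_right_gt.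
  have h2 : \forall r \near (0:R)^'+, r < e by exact: nbhs_right_lt.
  have h3 : \forall r \near (0:R)^'+, r < (`|L| + 1)^-1.
    by apply: nbhs_right_lt; rewrite invr_gt0 ltr_wpDl.
  have h4 : \forall r \near (0:R)^'+, r < 1 by exact: nbhs_right_lt.
  apply: filterS2 (filterI h1 h2) (filterI h3 h4) => r [r0 re] [rL r1]; split=> //.
  have L1 : 0 < `|L| + 1 by rewrite ltr_wpDl.
  apply: (@lt_trans _ _ (`|L| + 1)); first by rewrite ltr_pwDr// ler_norm.
  apply: (@lt_le_trans _ _ r^-1); first by rewrite -[ltLHS]invrK ltf_pV2 ?posrE ?invr_gt0.
  by rewrite lef_pV2 ?posrE ?exprn_gt0// expr2 ger_pMl// ltW.
have NF : filter_prod (nbhs p0) ((0:R)^'+) [set pr : M * R |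
    (cdom c pr.1 /\ ball x0 e (cmap c pr.1)) /\ [/\ 0 < pr.2, pr.2 < e & L < (pr.2 ^+ 2)^-1]].
  by exists ([set p | cdom c p /\ ball x0 e (cmap c p)],
    [set r | [/\ 0 < r, r < e & L < (r ^+ 2)^-1]]).
exists ([set y | ball y0 e y], [set pr : M * R |
    (cdom c pr.1 /\ ball x0 e (cmap c pr.1)) /\ [/\ 0 < pr.2, pr.2 < e & L < (pr.2 ^+ 2)^-1]]).
  by split; [exact: N1|exact: NF].
move=> [y [p r]] /= [By [[cdp Bp] [r0 re Lr]]] z t zp t0 zy zS.
pose th : 'rV[R]_(N + 1) := row_mx (cmap c p) (const_mx r).
have thr : rsubmx th 0 0 = r by rewrite row_mxKr mxE.
have Qv : Q (row_mx th y).
  apply: eQ; apply: ball_row_mx => //; apply: ball_row_mx => //.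
  split=> // i j; rewrite !mxE /ball /= sub0r normrN gtr0_norm//.
case: Qv => Dy [Gy Sy]; rewrite /D /= row_mxKr in Dy.
have zc : cdom c z.1 by rewrite zp.
have vE : cmap (tangent_chart c) z = row_mx (cmap c p) (t *: y) by rewrite /= zp -zp zy zp.
have backE : coord_back eta0 B th (cmap (tangent_chart c) z) = row_mx (slope eta0 B y) 0.
  rewrite /coord_back vE row_mxKl row_mxKr slopeZ ?gt_eqF//.
  by rewrite row_mxKl subrr scaler0.
have omE : row_mx th (coord_back eta0 B th (cmap (tangent_chart c) z)) = omega (row_mx th y).
  by rewrite backE /omega row_mxKl row_mxKr.
have W0z : W0 (lsubmx (cmap (tangent_chart c) z)).
  rewrite vE row_mxKl; case: Gy => + _.
  rewrite /blowup_dom /= /position /omega !row_mxKl !row_mxKr /base_part row_mxKr.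
  by rewrite scaler0 addr0 /base_point !row_mxKl.
have := @sphere_scalar_curvatureE R n' M g nabla G gR nablaC GS c cA W0 oW0 W0c sGam eta0 B Eu th.
rewrite thr => /(_ r0 z zS zc) ->; last first.
  split; first exact: W0z.
    by rewrite vE row_mxKr heightZ; exact: (mulr_gt0 t0 Dy).
  by rewrite /= omE; exact: Gy.
rewrite omE; apply: (lt_le_trans Lr).
rewrite ler_pMr; first exact: (ltW Sy).
by rewrite invr_gt0; exact: (exprn_gt0 2 r0).
Qed.

(** A tangent vector is a positive multiple of a vector of norm 1 for the maximum
    norm of its components in the chart; the set of these is compact and does not
    depend on the base point. *)
Lemma large_near_point (L : R) (p0 : M) :
  filter_prod (nbhs p0) (0^'+ : set_system R)
    [set pr : M * R | forall z : TM, z.1 = pr.1 -> large_at L pr.2 z].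
Proof.
set c := chart_at A p0; have cA : charts A c := chart_atP p0.
have cp : cdom c p0 := cdom_chart_at p0.
have [odc _ _ _ _] := mchart cA.
pose K : set 'rV[R]_N := [set y | `|y| = 1].
have cK : compact K.
  apply: bounded_closed_compact.
    exists 1; split; first exact: num_real.
    by move=> x x1 y /= ->; exact: ltW.
  apply: (@closed_comp _ _ (fun y : 'rV[R]_N => `|y| : R^o) [set 1 : R^o]).
    by move=> y _; exact: norm_continuous.
  exact: closed_eq.
have cov := (compact_near_coveringP K).1 cK.
have K0 y : K y -> y != 0.
  by move=> /= Ky; rewrite -normr_gt0 Ky.
pose P (pr : M * R) (y : 'rV[R]_N) := forall (z : TM) (t : R), z.1 = pr.1 -> 0 < t ->
      tchange (chart_at A z.1) c z.1 z.2 = t *: y -> large_at L pr.2 z.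
have [[Np Nr] /= [hp hr] sub] := cov _ (filter_prod (nbhs p0) (0^'+ : set_system R)) P _
  (fun y (Ky : K y) => large_near_direction L p0 (K0 y Ky)).
have N1 : \forall p \near p0, cdom c p by exact: open_nbhs_nbhs.
have N2 : \forall r \near (0:R)^'+, 0 < r by exact: nbhs_right_gt.
exists (Np `&` cdom c, Nr `&` [set r | 0 < r]); first by split; exact: filterI.
move=> [p r] /= [[Npp cdp] [Nrr r0]] z zp zS.
set v := tchange (chart_at A z.1) c z.1 z.2.
have zc : cdom c z.1 by rewrite zp.
have v0 : v != 0.
  apply/eqP => v0; have := zS; rewrite /sphere_bundle /= -(tangent_chart_norm gR cA zc).
  rewrite /= row_mxKr -/v v0 bilin0l => /esym/eqP.
  by rewrite expf_eq0 /= gt_eqF.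
have nv : 0 < `|v| by rewrite normr_gt0.
apply: (sub (p, r) (conj Npp Nrr) (`|v|^-1 *: v) _ z `|v| zp nv _ zS).
  by rewrite /K /= normrZ normfV normr_id mulVf// gt_eqF.
by rewrite scalerA mulfV ?gt_eqF// scale1r.
Qed.

End SmallRadius.

Theorem theorem3p9 (R : realType) (n : nat) (M : manifold R n)
    (g : M -> 'rV[R]_n -> 'rV[R]_n -> R)
    (nabla : M -> 'rV[R]_n -> (M -> 'rV[R]_n) -> 'rV[R]_n)
    (G : tangent_bundle M -> 'rV[R]_(n + n) -> 'rV[R]_(n + n) -> R)
    (dimM : (2 < n)%N)
    (compactM : compact [set: M])
    (statM : is_statistical (matlas M) g nabla)
    (sasakiG : is_sasakian g nabla G) :
  forall L : R, exists r0 : R, 0 < r0 /\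
    forall r : R, 0 < r -> r < r0 ->
    forall z : tangent_bundle M, sphere_bundle g r z ->
      L < sphere_scalar_curvature g G r z.
Proof.
have [gR nablaC _ _] := statM.
case: n M g nabla G dimM compactM gR nablaC sasakiG {statM} =>
  [//|n'] M g nabla G n2 cM gR nablaC GS L.
have cov := (compact_near_coveringP [set: M]).1 cM.
have H := cov R (0^'+ : set_system R)
  (fun r p => forall z : tangent_bundle M, z.1 = p -> large_at g G L r z) _
  (fun p _ => large_near_point gR nablaC GS n2 L p).
have [e /= e0 He] := H.
exists e; split=> // r r0 re z zS.
apply: (He r _ r0 z.1 I z erefl zS).
by rewrite /= sub0r normrN gtr0_norm.
Qed.
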